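(* Let $G$ be a compact connected Lie group acting continuously on a compact topological space $S$, and consider the formal Hamiltonian $$\mathcal{H}(\boldsymbol{\phi})=\sum_{x\neq y}J_{x-y}\,U(\phi_x,\phi_y),\qquad \boldsymbol{\phi}=\{\phi_x\}_{x\in\mathbb{Z}^2}\in S^{\mathbb{Z}^2},$$ where the real coupling constants $\{J_x\}_{x\in\mathbb{Z}^2\setminus\{0\}}$ satisfy $\sum_{x\ne0}|J_x|=1$. Suppose that: - the random walk $X_\cdot$ on $\mathbb{Z}^2$ with transition probabilities from $x$ to $y$ given by $|J_{x-y}|$ is recurrent; - the two-body interaction function $U$ is continuous on $S\times S$ and $G$-invariant: $U(g\phi_1,g\phi_2)=U(\phi_1,\phi_2)$ for all $g\in G$, $\phi_1,\phi_2\in S$; - the free measure $d\phi$ on $S$ is $G$-invariant. Then all Gibbs states corresponding to the Hamiltonian $\mathcal{H}$ (and the free measure $d\phi$) are $G$-invariant.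
   Context: A Gibbs state for $\mathcal{H}$ and the (finite) free measure $d\phi$ is a probability measure on $S^{\mathbb{Z}^2}$ satisfying the DLR equations: for every finite $W\subset\mathbb{Z}^2$, its conditional distribution on $S^W$ given the configuration outside $W$ has density with respect to $\prod_{z\in W}d\phi_z$ proportional to $\exp\{-\mathcal{H}_W\}$, where $\mathcal{H}_W$ is the (absolutely convergent) sum of the terms $J_{x-y}U(\phi_x,\phi_y)$ with $\{x,y\}\cap W\neq\emptyset$. $G$ acts on $S^{\mathbb{Z}^2}$ by $(g\boldsymbol{\phi})_x=g\phi_x$, and $G$-invariance of a Gibbs state means invariance under this action for every $g\in G$. *)

(* Defs.v *)
From HB Require Import structures.
From mathcomp Require Import all_boot all_order all_algebra finmap.
From mathcomp Require Import all_classical all_reals all_analysis.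

Set Implicit Arguments.
Unset Strict Implicit.
Unset Printing Implicit Defensive.

Import Order.TTheory GRing.Theory Num.Theory.
Import numFieldNormedType.Exports.

Local Open Scope classical_set_scope.
Local Open Scope ring_scope.

HB.structure Definition PreTopologicalGroup := {G of Group G & Topological G}.

Notation preTopologicalGroupType := PreTopologicalGroup.type.

Section LieGroup.
Variable R : realType.

(* C^k on the open set D: the partial derivatives of order at most k exist and
   are continuous on D.  The values of f outside D are irrelevant. *)
Fixpoint Ck (k : nat) (n m : nat) (D : set 'rV[R]_n)
    (f : 'rV[R]_n -> 'rV[R]_m) : Prop :=
  (forall x, D x -> {for x, continuous f}) /\
  match k with
  | 0 => True
  | k'.+1 => forall i : 'I_n,
      (forall x, D x -> derivable f x (delta_mx 0 i)) /\
      Ck k' D (fun x => 'D_(delta_mx 0 i) f x)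
  end.

Definition smooth_on n m (D : set 'rV[R]_n) (f : 'rV[R]_n -> 'rV[R]_m) : Prop :=
  forall k, Ck k D f.

Variable G : preTopologicalGroupType.

(* chart_map is meaningful on chart_dom only, chart_inv on chart_cod only. *)
Record chart (n : nat) := Chart {
  chart_dom : set G ;
  chart_map : G -> 'rV[R]_n ;
  chart_inv : 'rV[R]_n -> G }.

Definition chart_cod n (c : chart n) : set 'rV[R]_n :=
  chart_map c @` chart_dom c.

Definition is_chart n (c : chart n) : Prop :=
  [/\ open (chart_dom c), open (chart_cod c),
      (forall x, chart_dom c x -> chart_inv c (chart_map c x) = x),
      (forall x, chart_dom c x -> {for x, continuous (chart_map c)}) &
      (forall v, chart_cod c v -> {for v, continuous (chart_inv c)})].

Definition smooth_atlas n (A : set (chart n)) : Prop :=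
  [/\ (forall c, A c -> is_chart c),
      (forall x, exists2 c, A c & chart_dom c x) &
      (forall a b, A a -> A b ->
         smooth_on [set v | chart_cod a v /\ chart_dom b (chart_inv a v)]
                   (fun v => chart_map b (chart_inv a v)))].

Definition smooth_mul n (A : set (chart n)) : Prop :=
  forall a b c, A a -> A b -> A c ->
    smooth_on [set w : 'rV[R]_(n + n) |
                 [/\ chart_cod a (lsubmx w), chart_cod b (rsubmx w) &
                     chart_dom c (chart_inv a (lsubmx w)
                                  * chart_inv b (rsubmx w))%g]]
              (fun w => chart_map c (chart_inv a (lsubmx w)
                                     * chart_inv b (rsubmx w))%g).

Definition smooth_inv n (A : set (chart n)) : Prop :=
  forall a b, A a -> A b ->
    smooth_on [set v | chart_cod a v /\ chart_dom b (chart_inv a v)^-1%g]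
              (fun v => chart_map b (chart_inv a v)^-1%g).

Definition lie_group : Prop :=
  [/\ hausdorff_space G, @second_countable G,
      continuous (fun p : G * G => (p.1 * p.2)%g),
      continuous (fun x : G => x^-1%g) &
      exists n (A : set (chart n)),
        [/\ smooth_atlas A, smooth_mul A & smooth_inv A]].

End LieGroup.

Definition continuous_action (G : preTopologicalGroupType) (S : topologicalType)
    (act : G -> S -> S) : Prop :=
  [/\ (forall s, act 1%g s = s),
      (forall g h s, act (g * h)%g s = act g (act h s)) &
      continuous (fun p : G * S => act p.1 p.2)].

Notation Z2 := (int * int)%type.

Section RandomWalk.
Variables (R : realType) (J : Z2 -> R).

(* J is only used away from the origin: its value at 0 is junk. *)
Definition step_proba (x y : Z2) : R :=
  if x == y then 0 else `|J (x - y)|.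

(* X is the Markov chain with transition probabilities step_proba, started at
   the origin; since step_proba is translation invariant, the starting point
   does not matter for recurrence. *)
Definition random_walk d (Omega : measurableType d) (P : probability Omega R)
    (X : nat -> Omega -> Z2) : Prop :=
  (forall n z, measurable (X n @^-1` [set z])) /\
  (forall (n : nat) (z : nat -> Z2),
     P [set w | forall k, (k <= n)%N -> X k w = z k] =
     ((z 0%N == 0)%:R * \prod_(k < n) step_proba (z k) (z k.+1))%:E).

Definition recurrent d (Omega : measurableType d) (P : probability Omega R)
    (X : nat -> Omega -> Z2) : Prop :=
  P [set w | exists n, X n.+1 w = X 0%N w] = 1%E.

End RandomWalk.

Definition borel (S : ptopologicalType) := g_sigma_algebraType (@open S).

(* Events generating the sigma-algebra of the coordinates in V. *)
Definition coord_events (S : ptopologicalType) (V : set Z2) :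
    set (set (Z2 -> S)) :=
  \bigcup_(x in V) preimage_set_system setT
    (fun phi : Z2 -> S => phi x) (measurable : set (set (borel S))).

Definition config (S : ptopologicalType) :=
  g_sigma_algebraType (@coord_events S setT).

Section Gibbs.
Variables (R : realType) (S : ptopologicalType).
Variables (J : Z2 -> R) (U : S -> S -> R).
Variable lambda : {finite_measure set (borel S) -> \bar R}.

(* The formal Hamiltonian is a sum over ordered pairs x != y; these are the
   pairs entering H_W. *)
Definition touching_pairs (W : {fset Z2}) : set (Z2 * Z2) :=
  [set p | p.1 != p.2 /\ (p.1 \in W \/ p.2 \in W)].

Definition pair_energy (phi : Z2 -> S) (p : Z2 * Z2) : \bar R :=
  (J (p.1 - p.2) * U (phi p.1) (phi p.2))%:E.

(* esum is only meaningful for nonnegative families, whence the splitting of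
   the absolutely convergent sum into positive and negative parts. *)
Definition hamiltonian (W : {fset Z2}) (phi : Z2 -> S) : R :=
  fine (\esum_(p in touching_pairs W) (pair_energy phi)^\+ p
        - \esum_(p in touching_pairs W) (pair_energy phi)^\- p)%E.

Definition update (phi : Z2 -> S) (x : Z2) (s : S) : Z2 -> S :=
  fun y => if y == x then s else phi y.

(* Integral of f with respect to the product measure lambda^(W) over the spins
   at the sites of the list W, the spins elsewhere being those of eta. *)
Fixpoint integrate_sites (W : seq Z2) (f : (Z2 -> S) -> \bar R)
    (eta : Z2 -> S) : \bar R :=
  match W with
  | [::] => f eta
  | x :: W' =>
      (\int[lambda]_(s in setT) integrate_sites W' f (update eta x s))%E
  end.

Definition boltzmann (W : {fset Z2}) (phi : Z2 -> S) : R :=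
  expR (- hamiltonian W phi).

Definition partition_function (W : {fset Z2}) (eta : Z2 -> S) : R :=
  fine (integrate_sites W (fun phi => (boltzmann W phi)%:E) eta).

(* Probability of A given eta outside W, with spins in W distributed with
   density proportional to exp (- H_W). *)
Definition gibbs_kernel (W : {fset Z2}) (A : set (Z2 -> S)) (eta : Z2 -> S) : R :=
  fine (integrate_sites W (fun phi => (\1_A phi * boltzmann W phi)%:E) eta)
  / partition_function W eta.

(* gibbs_kernel W is a version of the conditional distribution of the spins in
   W given the spins outside W. *)
Definition gibbs_state (mu : probability (config S) R) : Prop :=
  forall (W : {fset Z2}) (A B : set (Z2 -> S)),
    <<s coord_events [set x | x \in W] >> A ->
    <<s coord_events [set x | x \notin W] >> B ->
    mu (A `&` B) = (\int[mu]_(eta in B) (gibbs_kernel W A eta)%:E)%E.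

End Gibbs.

Definition invariant_measure (R : realType) (S : ptopologicalType)
    (G : preTopologicalGroupType) (act : G -> S -> S)
    (lambda : {measure set (borel S) -> \bar R}) : Prop :=
  forall g (A : set (borel S)), measurable A ->
    lambda (act g @^-1` A) = lambda A.

Definition config_act (S : ptopologicalType) (G : preTopologicalGroupType)
    (act : G -> S -> S) (g : G) (phi : Z2 -> S) : Z2 -> S :=
  fun x => act g (phi x).

Definition invariant_state (R : realType) (S : ptopologicalType)
    (G : preTopologicalGroupType) (act : G -> S -> S)
    (mu : probability (config S) R) : Prop :=
  forall g (A : set (config S)), measurable A ->
    mu (config_act act g @^-1` A) = mu A.

(* Main.v *)
Require Import Defs.
From HB Require Import structures.
From mathcomp Require Import all_boot all_order all_algebra finmap.
From mathcomp Require Import all_classical all_reals all_analysis.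
From mathcomp Require Import measurable_realfun.
From mathcomp Require Import ring lra zify.

(** The classical argument, when the interaction is twice differentiable along
    the orbits: fix an element g lying on a one-parameter subgroup, an event A
    that depends on the spins of a finite set L0, and a profile a on the lattice
    that is 1 on L0 and 0 outside a finite set.  Rotating the spin at x by
    g^(a x), and by g^(- a x), changes the energy by amounts whose first order
    terms cancel in the sum of the two, so that only a multiple of the Dirichlet
    energy sum_(x,y) |J (x - y)| (a x - a y)^2 remains.  By convexity of the
    exponential and invariance of the free measure,
    mu (g A) + mu (g^-1 A) >= 2 (1 - O(energy)) mu A.
    When the walk is recurrent the energy can be made arbitrarily small, whence
    mu (g A) + mu (g^-1 A) >= 2 mu A.  Applied to all the events g^k A, this
    makes k |-> mu (g^k A) a convex bounded sequence on the integers; such a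
    sequence is constant, and mu (g A) = mu A.

    Profiles.  The probability h_n x of visiting the origin within n steps from x
    has energy at most 2 (1 - return_proba n) ([hit_energy]); recurrence makes
    this small ([recurrent_return_proba]).  The walk need not be symmetric: the
    proof uses only that its transition matrix is doubly stochastic.  Truncating
    h_n makes its support finite, maxima of translates reach 1 on a given finite
    set, and rounding gives profiles with integer values ([integer_profile]).

    Interactions that are merely continuous.  All angles are multiples of a
    small root h of g with h^N = g, and N = M K where the powers h^j, |j| < K,
    move U by at most 1/16.  Averaging U over these powers gives a function V
    within 1/16 of U whose second differences along the rotation are
    O((k - l)^2 / K^2) ([smoothed_diff2]); as N / K = M stays bounded, this is as
    good as a bounded second derivative.  The remainder is absorbed by random
    bonds: with r = J (V - U) + |J| / 16 >= 0, write 1 = exp (- r) +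
    (1 - exp (- r)) for every pair of sites, the first term for a closed bond and
    the second for an open one.  A closed bond replaces U by V in the Boltzmann
    factor; an open bond leaves a factor without smoothness, but invariant under
    a common rotation of its two ends.  The angles are therefore taken constant
    on the clusters of open bonds ([angle]), namely equal to the minimum of the
    profile on the cluster.  Since r <= |J| / 8, the percolation is subcritical
    and the mean square difference between the profile and its cluster minimum
    is bounded by the Dirichlet energy ([cluster_min_variance]).  The result is
    [kernel_convexity] for the Gibbs kernels and [cylinder_convexity] for mu.

    Group elements.  Near the identity of a Lie group every element has
    successive square roots that tend to the identity uniformly enough
    ([nbhs_dyadic_roots]), by a contraction argument in a chart; this replaces
    the exponential map.  The elements preserving mu form a subgroup which
    contains a neighbourhood of the identity, and a connected group has no
    proper subgroup of this kind ([dyadic_roots_generate]). *)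

Set Implicit Arguments.
Unset Strict Implicit.
Unset Printing Implicit Defensive.

Import Order.TTheory GRing.Theory Num.Theory.
Import numFieldNormedType.Exports.

Local Open Scope classical_set_scope.
Local Open Scope ring_scope.

(** * Unordered sums over countable types *)

Lemma esumZl (R : realType) (T : choiceType) (D : set T) (c : R)
    (a : T -> \bar R) :
  0 <= c -> (forall i, D i -> 0 <= a i)%E ->
  (\esum_(i in D) (c%:E * a i) = c%:E * \esum_(i in D) a i)%E.
Proof.
move=> c0 a0.
have le_Zl (k : R) (b : T -> \bar R) : 0 <= k -> (forall i, D i -> 0 <= b i)%E ->
    (\esum_(i in D) (k%:E * b i) <= k%:E * \esum_(i in D) b i)%E.
  move=> k0 b0; apply: ge_ereal_sup => _ [X [finX XD] <-].
  have -> : (\sum_(x \in X) k%:E * b x = k%:E * \sum_(x \in X) b x)%E.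
    rewrite !fsbig_finite//= big_seq_cond [in RHS]big_seq_cond.
    rewrite ge0_sume_distrr// => i; rewrite andbT in_fset_set// inE.
    by move=> /XD/b0.
  by rewrite lee_wpmul2l ?lee_fin// esum_ge//; exists X.
apply/eqP; rewrite eq_le le_Zl//=.
have [->|cn0] := eqVneq c 0.
  by rewrite mul0e esum_ge0// => i Di; rewrite mul0e.
have {cn0}c0 : 0 < c by rewrite lt_neqAle eq_sym cn0.
rewrite -lee_pdivlMl//.
have ca0 i : D i -> (0 <= c%:E * a i)%E by move=> /a0 ai; rewrite mule_ge0// lee_fin ltW.
apply: le_trans (le_Zl c^-1 _ _ ca0); last by rewrite invr_ge0 ltW.
by apply: le_esum => i Di; rewrite muleA -EFinM mulVf ?gt_eqF// mul1e.
Qed.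

Lemma esum_pair (R : realType) (T1 T2 : choiceType) (a : T1 * T2 -> \bar R) :
  (forall z, 0 <= a z)%E ->
  \esum_(z in setT) a z = \esum_(x in setT) \esum_(y in setT) a (x, y).
Proof.
move=> a0; rewrite (@esum_esum _ _ _ setT (fun=> setT) (fun x y => a (x, y)))//.
rewrite (_ : setT `*`` _ = setT); last by apply/seteqP; split.
by apply: eq_esum => -[].
Qed.

Lemma exchange_esum (R : realType) (T1 T2 : choiceType) (a : T1 -> T2 -> \bar R) :
  (forall x y, 0 <= a x y)%E ->
  \esum_(x in setT) \esum_(y in setT) a x y =
  \esum_(y in setT) \esum_(x in setT) a x y.
Proof.
move=> a0.
rewrite -(esum_pair (a := fun z => a z.1 z.2))// -(esum_pair (a := fun z => a z.2 z.1))//.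
rewrite (reindex_esum setT setT (fun z : T2 * T1 => (z.2, z.1)))//; split => //.
- by move=> [? ?] [? ?] _ _ [-> ->].
- by move=> [x y] _; exists (y, x).
Qed.

Lemma reindex_esumT (R : realType) (T T' : choiceType) (e : T -> T')
    (e' : T' -> T) (a : T' -> \bar R) : cancel e e' -> cancel e' e ->
  \esum_(j in setT) a j = \esum_(i in setT) a (e i).
Proof.
move=> eK e'K; rewrite (reindex_esum setT setT e)//; split => //.
- by move=> x y _ _ /(congr1 e'); rewrite !eK.
- by move=> y _; exists (e' y).
Qed.

(** Countable additivity, with the countable range of X as index set instead of
    the natural numbers. *)
Lemma measure_countable_partition (R : realType) d (T : measurableType d)
    (mu : {measure set T -> \bar R}) (I : countType) (X : T -> I) (A : set T) :
  measurable A -> (forall i, measurable (X @^-1` [set i])) ->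
  mu A = \esum_(i in setT) mu (A `&` X @^-1` [set i]).
Proof.
move=> mA mX.
have pickle_inj : injective (@choice.pickle I).
  by move=> i j /(congr1 (@choice.unpickle I)); rewrite !choice.pickleK => -[].
pose F n := A `&` [set w | choice.pickle (X w) = n].
have FE (i : I) : F (choice.pickle i) = A `&` X @^-1` [set i].
  apply/seteqP; split => w /= [Aw Xw]; split => //=; last by rewrite Xw.
  exact: pickle_inj.
have F0 n : ~ range (@choice.pickle I) n -> F n = set0.
  by move=> nr; apply/seteqP; split => // w /= [_ Xw]; apply: nr; exists (X w).
have mF n : measurable (F n).
  have [[i _ <-]|/F0->] := pselect (range (@choice.pickle I) n); last exact: measurable0.
  by rewrite FE; apply: measurableI.
have -> : A = \bigcup_n F n.
  apply/seteqP; split => [w Aw|w [n _ []]//].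
  by exists (choice.pickle (X w)).
rewrite measure_bigcup//; last first.
  by move=> m n _ _ [w [[_ /= <-] [_ /= <-]]].
rewrite nneseries_esum// (esumID (range (@choice.pickle I)))//.
rewrite [X in (_ + X)%E]esum1 ?adde0; last first.
  by move=> n [_ /F0 ->]; rewrite measure0.
rewrite (reindex_esum setT _ (@choice.pickle I)).
  apply: eq_esum => i _; rewrite FE; congr (mu _).
  by apply/seteqP; split => [w [Aw Xw]|w [[_ _ [Aw _]] Xw]]; split => //; exists (choice.pickle (X w)).
split.
- by move=> i _ /=; split; [rewrite in_setT|exists i].
- by move=> i j _ _ /pickle_inj.
- by move=> n [_ [i _ <-]]; exists i.
Qed.

(** * Hitting probabilities of the walk *)

Section Walk.
Variables (R : realType) (J : Z2 -> R).
Hypothesis J_sum :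
  (\esum_(x in [set z : Z2 | z != 0%R]) `|J x|%:E = 1)%E.

Local Notation p x y := (step_proba J x y).

Lemma step_proba_ge0 x y : 0 <= p x y.
Proof. by rewrite /step_proba; case: ifP. Qed.

Let jump (z : Z2) : \bar R := if z == 0 then 0%E else `|J z|%:E.

Let jump_sum : (\esum_(z in setT) jump z = 1)%E.
Proof.
rewrite -J_sum [RHS]esum_mkcond; apply: eq_esum => z _; rewrite /jump.
by case: eqVneq => [->|z0]; [rewrite memNset//= eqxx|rewrite mem_set].
Qed.

Let step_jump x y : (p x y)%:E = jump (x - y).
Proof. by rewrite /step_proba /jump subr_eq0; case: ifP. Qed.

Lemma step_proba_suml x : (\esum_(y in setT) (p x y)%:E = 1)%E.
Proof.
rewrite -jump_sum [RHS](@reindex_esumT _ _ _ (fun y => x - y) (fun y => x - y)).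
- by apply: eq_esum => y _; rewrite step_jump.
- by move=> y; rewrite opprB addrC subrK.
- by move=> y; rewrite opprB addrC subrK.
Qed.

Lemma step_proba_sumr y : (\esum_(x in setT) (p x y)%:E = 1)%E.
Proof.
rewrite -jump_sum [RHS](@reindex_esumT _ _ _ (fun x => x - y) (fun x => x + y)).
- by apply: eq_esum => x _; rewrite step_jump.
- by move=> x; rewrite subrK.
- by move=> x; rewrite addrK.
Qed.

Lemma step_probaD x y z : p (x + z) (y + z) = p x y.
Proof.
by rewrite /step_proba (inj_eq (addIr z)) opprD addrACA subrr addr0.
Qed.

(** Probability of visiting the origin within [n] steps, time 0 included; unlike
    [return_proba], which does not count the starting point. *)
Fixpoint hit (n : nat) (x : Z2) : \bar R :=
  if x == 0 then 1%E else
  if n is m.+1 then (\esum_(y in setT) ((p x y)%:E * hit m y))%E else 0%E.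

Definition return_proba n : \bar R := (\esum_(y in setT) ((p 0%R y)%:E * hit n y))%E.

Lemma hit0 n : hit n 0 = 1%E.
Proof. by case: n. Qed.

Lemma hitS n x : x != 0 -> hit n.+1 x = (\esum_(y in setT) ((p x y)%:E * hit n y))%E.
Proof. by move=> /negbTE /= ->. Qed.

Lemma hit_ge0 n x : (0 <= hit n x)%E.
Proof.
elim: n x => [|n ih] x /=; case: ifP => // _; apply: esum_ge0 => y _.
by rewrite mule_ge0// lee_fin step_proba_ge0.
Qed.

Lemma average_ge0 n x : (0 <= \esum_(y in setT) ((p x y)%:E * hit n y))%E.
Proof. by apply: esum_ge0 => y _; rewrite mule_ge0 ?hit_ge0// lee_fin step_proba_ge0. Qed.

Lemma hit_le1 n x : (hit n x <= 1)%E.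
Proof.
elim: n x => [|n ih] x /=; case: ifP => // _.
rewrite -(step_proba_suml x); apply: le_esum => y _.
by rewrite -[leRHS]mule1 lee_wpmul2l ?lee_fin ?step_proba_ge0.
Qed.

Lemma hit_homo n x : (hit n x <= hit n.+1 x)%E.
Proof.
elim: n x => [|n ih] x.
  by rewrite /=; case: ifP => // _; exact: (average_ge0 0).
have [->|x0] := eqVneq x 0; first by rewrite !hit0.
rewrite !hitS//; apply: le_esum => y _.
by rewrite lee_wpmul2l ?lee_fin ?step_proba_ge0//; exact: ih.
Qed.

(** The transition matrix is doubly stochastic, so averaging preserves the total
    mass, and each further step adds at most the unit mass of the origin. *)
Lemma hit_sum n : (\esum_(x in setT) hit n x <= n.+1%:R%:E)%E.
Proof.
elim: n => [|n ih].
  rewrite (esumID [set (0 : Z2)]); last by move=> x _; exact: hit_ge0.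
  rewrite setTI esum_set1 ?hit_ge0// hit0 esum1 ?adde0// => x [_ /= /eqP x0].
  by rewrite (negbTE x0).
have : (\esum_(x in setT) hit n.+1 x <= \esum_(x in setT) hit 0 x +
    \esum_(x in setT) \esum_(y in setT) ((p x y)%:E * hit n y))%E.
  rewrite -esumD; [|by move=> x _; exact: hit_ge0|by move=> x _; exact: average_ge0].
  apply: le_esum => x _ /=; case: ifP => _; last by rewrite add0e.
  by rewrite leeDl// average_ge0.
move/le_trans; apply.
rewrite -[leRHS]/((n.+2)%:R)%:E mulrS EFinD leeD//.
  rewrite (esumID [set (0 : Z2)]); last by move=> x _; exact: hit_ge0.
  rewrite setTI esum_set1 ?hit_ge0// hit0 esum1 ?adde0// => x [_ /= /eqP x0].
  by rewrite (negbTE x0).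
rewrite exchange_esum; last first.
  by move=> x y; rewrite mule_ge0 ?hit_ge0// lee_fin step_proba_ge0.
apply: le_trans ih; apply: le_esum => y _.
have h_fin : hit n y \is a fin_num.
  by rewrite ge0_fin_numE ?hit_ge0// (le_lt_trans (hit_le1 _ _))// ltry.
rewrite -(fineK h_fin); under eq_esum do rewrite muleC.
rewrite esumZl ?step_proba_sumr ?mule1//; first by rewrite fine_ge0// hit_ge0.
by move=> x _; rewrite lee_fin step_proba_ge0.
Qed.

End Walk.

(** * Dirichlet energy of the hitting probabilities *)

Section Energy.
Variables (R : realType) (J : Z2 -> R).
Hypothesis J_sum :
  (\esum_(x in [set z : Z2 | z != 0%R]) `|J x|%:E = 1)%E.

Local Notation p x y := (step_proba J x y).

Definition dirichlet (f : Z2 -> R) : \bar R :=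
  \esum_(z in setT) (p z.1 z.2 * (f z.1 - f z.2) ^+ 2)%:E.

Lemma dirichlet_ge0 f : (0 <= dirichlet f)%E.
Proof. by apply: esum_ge0 => z _; rewrite lee_fin mulr_ge0 ?step_proba_ge0 ?sqr_ge0. Qed.

Lemma le_dirichlet (k : R) f g : 0 <= k ->
  (forall x y, (f x - f y) ^+ 2 <= k * (g x - g y) ^+ 2) ->
  (dirichlet f <= k%:E * dirichlet g)%E.
Proof.
move=> k0 fg; rewrite /dirichlet -esumZl//; last first.
  by move=> z _; rewrite lee_fin mulr_ge0 ?step_proba_ge0 ?sqr_ge0.
apply: le_esum => z _; rewrite -EFinM lee_fin [leRHS]mulrCA.
by rewrite ler_wpM2l ?step_proba_ge0.
Qed.

Lemma dirichlet_shift f a : dirichlet (fun x => f (x - a)) = dirichlet f.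
Proof.
rewrite /dirichlet.
rewrite [RHS](@reindex_esumT _ _ _ (fun z => (z.1 - a, z.2 - a)) (fun z => (z.1 + a, z.2 + a))).
- by apply: eq_esum => -[x y] _ /=; rewrite step_probaD.
- by move=> [x y] /=; rewrite !subrK.
- by move=> [x y] /=; rewrite !addrK.
Qed.

(** The maximum is a contraction of each pair of values: when the maximum is
    attained by different functions at x and y, the variation is at most that of
    the function attaining the larger one. *)
Lemma dirichlet_max f g :
  (dirichlet (fun x => Num.max (f x) (g x)) <= dirichlet f + dirichlet g)%E.
Proof.
rewrite /dirichlet -esumD; do ?by move=> z _; rewrite lee_fin mulr_ge0 ?step_proba_ge0 ?sqr_ge0.
apply: le_esum => -[x y] _ /=; rewrite -EFinD lee_fin -mulrDr.
apply: ler_wpM2l; first exact: step_proba_ge0.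
have sq2 (u v w : R) : 0 <= u -> u <= v -> u ^+ 2 <= v ^+ 2 + w ^+ 2.
  by move=> u0 uv; rewrite ler_wpDr ?sqr_ge0// lerXn2r// nnegrE (le_trans u0).
case: (leP (f x) (g x)) => hx; case: (leP (f y) (g y)) => hy.
- by rewrite ler_wpDl ?sqr_ge0.
- case: (leP (g x) (f y)) => h.
    by rewrite -sqrrN -[(f x - f y) ^+ 2]sqrrN sq2 //; lra.
  by rewrite [leRHS]addrC sq2 //; lra.
- case: (leP (f x) (g y)) => h.
    by rewrite [leRHS]addrC -sqrrN -[(g x - g y) ^+ 2]sqrrN sq2 //; lra.
  by rewrite sq2 //; lra.
- by rewrite ler_wpDr ?sqr_ge0.
Qed.

Lemma hit_fin n x : hit J n x \is a fin_num.
Proof.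
by rewrite ge0_fin_numE ?hit_ge0// (le_lt_trans (hit_le1 J_sum _ _))// ltry.
Qed.

Lemma return_proba_le1 n : (return_proba J n <= 1)%E.
Proof.
rewrite -(step_proba_suml J_sum 0%R); apply: le_esum => y _.
by rewrite -[leRHS]mule1 lee_wpmul2l ?lee_fin ?step_proba_ge0// hit_le1.
Qed.

Lemma return_proba_ge0 n : (0 <= return_proba J n)%E.
Proof. exact: average_ge0. Qed.

(** Expand the square.  As the transition matrix is doubly stochastic, the energy
    of h is 2 sum h^2 - 2 sum_x h x (p h) x.  Outside the origin (p h) x >= h x,
    because h is the hitting probability within n steps and p h the one within
    n + 1 steps; the two sums cancel except at the origin, where they leave
    1 - return_proba n. *)
Lemma hit_energy n :
  (dirichlet (fun x => fine (hit J n x)) + 2%:E * return_proba J n <= 2%:E)%E.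
Proof.
set f := fun x => fine (hit J n x); set E := dirichlet f.
have p0 := step_proba_ge0 J.
have f0 x : 0 <= f x by rewrite fine_ge0// hit_ge0.
have fE x : (f x)%:E = hit J n x by rewrite fineK// hit_fin.
have f1 x : f x <= 1 by rewrite -lee_fin fE hit_le1.
have f00 : f 0 = 1 by rewrite /f hit0.
pose c x := \esum_(y in setT) (p x y * (f x * f y))%:E.
have cE x : c x = ((f x)%:E * \esum_(y in setT) ((p x y)%:E * hit J n y))%E.
  rewrite -esumZl//; last by move=> y _; rewrite mule_ge0 ?hit_ge0// lee_fin.
  by apply: eq_esum => y _; rewrite -fE -!EFinM mulrCA.
have cge x : x != 0 -> ((f x ^+ 2)%:E <= c x)%E.
  move=> x0; rewrite cE expr2 EFinM lee_wpmul2l ?lee_fin//.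
  by rewrite fE -hitS// hit_homo.
have c0 : c 0 = return_proba J n by rewrite cE f00 mul1e.
have p2 x y : (0 <= (p x y * f x ^+ 2)%:E)%E by rewrite lee_fin mulr_ge0 ?sqr_ge0.
have p2' x y : (0 <= (p x y * f y ^+ 2)%:E)%E by rewrite lee_fin mulr_ge0 ?sqr_ge0.
pose C := \esum_(z in setT) (p z.1 z.2 * (f z.1 * f z.2))%:E.
have CE : C = \esum_(x in setT) c x.
  rewrite /C esum_pair//=; last by move=> z; rewrite lee_fin !mulr_ge0.
pose S := \esum_(x in setT) (f x ^+ 2)%:E.
have S1 : \esum_(z in setT) (p z.1 z.2 * f z.1 ^+ 2)%:E = S.
  rewrite esum_pair//=; apply: eq_esum => x _.
  under eq_esum do rewrite mulrC EFinM.
  rewrite esumZl ?sqr_ge0//; last by move=> y _; rewrite lee_fin.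
  by rewrite (step_proba_suml J_sum) mule1.
have S2 : \esum_(z in setT) (p z.1 z.2 * f z.2 ^+ 2)%:E = S.
  rewrite esum_pair//= exchange_esum//; apply: eq_esum => x _.
  under eq_esum do rewrite mulrC EFinM.
  rewrite esumZl ?sqr_ge0//; last by move=> y _; rewrite lee_fin.
  by rewrite (step_proba_sumr J_sum) mule1.
have EC : (E + 2%:E * C = S + S)%E.
  rewrite /E /C -esumZl//; last by move=> z _; rewrite lee_fin !mulr_ge0.
  rewrite -{1}S1 -S2 -!esumD//; last 2 first.
  - by move=> z _; rewrite lee_fin mulr_ge0 ?sqr_ge0.
  - by move=> z _; rewrite mule_ge0 ?lee_fin ?mulr_ge0.
  by apply: eq_esum => z _; rewrite -EFinM -!EFinD; congr (_%:E); ring.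
pose Q := \esum_(x in ~` [set (0 : Z2)]) (f x ^+ 2)%:E.
have SQ : (S = 1 + Q)%E.
  rewrite /S (esumID [set (0 : Z2)]); last by move=> x _; rewrite lee_fin sqr_ge0.
  by rewrite !setTI esum_set1 ?lee_fin ?sqr_ge0// f00 expr1n.
have CQ : (return_proba J n + Q <= C)%E.
  have cge0 x : (0 <= c x)%E by apply: esum_ge0 => y _; rewrite lee_fin !mulr_ge0.
  rewrite CE (esumID [set (0 : Z2)])// !setTI esum_set1// c0 leeD//.
  by apply: le_esum => x /= /eqP; exact: cge.
have Q0 : (0 <= Q)%E by apply: esum_ge0 => x _; rewrite lee_fin sqr_ge0.
have Qfin : Q \is a fin_num.
  rewrite ge0_fin_numE//; apply: (@le_lt_trans _ _ S).
    by rewrite SQ leeDr.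
  apply: (@le_lt_trans _ _ (n.+1%:R%:E)); last by rewrite ltry.
  apply: le_trans (hit_sum J_sum n); apply: le_esum => x _.
  by rewrite -fE lee_fin expr2 ler_piMl.
have rfin : return_proba J n \is a fin_num.
  by rewrite ge0_fin_numE ?return_proba_ge0// (le_lt_trans (return_proba_le1 n))// ltry.
have C0 : (0 <= C)%E by apply: esum_ge0 => z _; rewrite lee_fin !mulr_ge0.
have E0 : (0 <= E)%E by exact: dirichlet_ge0.
move: EC CQ; rewrite SQ -(fineK Qfin) -(fineK rfin).
move: E C E0 C0 {CE} => [e||] [k||] //= e0 k0 [].
- move=> ek; rewrite !lee_fin => h; lra.
- by rewrite mulry gtr0_sg//= mul1e.
- by rewrite mulry gtr0_sg//= mul1e.
Qed.

End Energy.

(** * Return probabilities of the recurrent walk *)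

Section Recurrence.
Variables (R : realType) (J : Z2 -> R).
Hypothesis J_sum :
  (\esum_(x in [set z : Z2 | z != 0%R]) `|J x|%:E = 1)%E.
Variables (d : measure_display) (Omega : measurableType d).
Variables (P : probability Omega R) (X : nat -> Omega -> Z2).
Hypothesis X_walk : random_walk J P X.

Local Notation p x y := (step_proba J x y).

Let start k (z : nat -> Z2) : set Omega :=
  [set w | forall i, (i <= k)%N -> X i w = z i].

Let visit k n : set Omega := [set w | exists2 j, (j <= n)%N & X (k + j).+1 w = 0].

Let X_measurable n A : measurable (X n @^-1` A).
Proof.
have -> : X n @^-1` A = \bigcup_(z in A) (X n @^-1` [set z]).
  by apply/seteqP; split => [w Aw|w [z Az /= ->]//]; exists (X n w).
rewrite bigcup_mkcond; apply: countable_bigcupT_measurable => [|z]; first exact: countableP.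
by case: ifP => // _; exact: X_walk.1.
Qed.

Let start_measurable k z : measurable (start k z).
Proof.
have -> : start k z = \bigcap_(i in [set i | (i <= k)%N]) (X i @^-1` [set z i]).
  by apply/seteqP; split.
by apply: bigcap_measurable => [|i _]; [exists 0%N|exact: X_measurable].
Qed.

Let visit_measurable k n : measurable (visit k n).
Proof.
have -> : visit k n = \bigcup_(j in [set j | (j <= n)%N]) (X (k + j).+1 @^-1` [set 0]).
  by apply/seteqP; split.
by apply: bigcup_measurable => j _; exact: X_measurable.
Qed.

Let extend k (z : nat -> Z2) y : nat -> Z2 := fun i => if i == k.+1 then y else z i.

Let start_extend k z y : start k z `&` X k.+1 @^-1` [set y] = start k.+1 (extend k z y).
Proof.
apply/seteqP; split => [w [wz /= wy] i|w wz].
  rewrite /extend leq_eqVlt => /orP[/eqP->|]; first by rewrite eqxx.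
  by rewrite ltnS => ik; rewrite (ltn_eqF (_ : i < k.+1)%N) ?wz.
split => [i ik|/=]; last by rewrite wz// /extend eqxx.
by rewrite wz ?(leq_trans ik)// /extend (ltn_eqF (_ : i < k.+1)%N).
Qed.

Let start_proba k z y :
  P (start k.+1 (extend k z y)) = (P (start k z) * (p (z k) y)%:E)%E.
Proof.
rewrite !X_walk.2 -EFinM big_ord_recr/= -!mulrA /extend eqxx.
rewrite (ltn_eqF (_ : k < k.+1)%N)//; congr (_%:E); congr (_ * (_ * _)).
apply: eq_bigr => i _; have ik := ltn_ord i.
by have -> : (i == k.+1 :> nat) = false by [lia]; have -> : (i.+1 == k.+1) = false by lia.
Qed.

Let visit_extend k n y : y != 0 ->
  visit k n.+1 `&` X k.+1 @^-1` [set y] = visit k.+1 n `&` X k.+1 @^-1` [set y].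
Proof.
move=> y0; apply/seteqP; split => w [[j jn Xj] /= Xy]; split => //.
- case: j jn Xj => [|j] jn; first by rewrite addn0 Xy => /eqP; rewrite (negbTE y0).
  by rewrite addnS => Xj; exists j.
- by exists j.+1; rewrite ?addnS.
Qed.

(** Markov property of the walk, obtained from the finite-dimensional laws by
    splitting according to the position at time k + 1. *)
Lemma visit_proba n k z :
  (P (start k z `&` visit k n) =
   P (start k z) * \esum_(y in setT) ((p (z k) y)%:E * hit J n y))%E.
Proof.
have Pfin k' z' : P (start k' z') = (fine (P (start k' z')))%:E.
  by rewrite fineK// fin_num_measure.
have p0 := step_proba_ge0 J.
elim: n k z => [|n ih] k z.
all: rewrite (@measure_countable_partition _ _ _ P _ (X k.+1)); [|exact: measurableI|by move=> y; exact: X_measurable].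
all: rewrite Pfin -esumZl ?fine_ge0//; last by move=> y _; rewrite mule_ge0 ?hit_ge0// lee_fin.
all: apply: eq_esum => y _; rewrite -Pfin muleA -start_proba -start_extend.
all: have [->|y0] := eqVneq y 0.
1,3: rewrite hit0 mule1; congr (P _); apply/seteqP; split => [w [[]]//|w [ws w0]].
1,2: by split => //; split => //; exists 0%N; rewrite // addn0.
- rewrite [hit _ _ _]/= (negbTE y0) mule0.
  rewrite (_ : _ `&` _ = set0) ?measure0//; apply/seteqP; split => // w.
  move=> [[_ [j]]]; rewrite leqn0 => /eqP->; rewrite addn0 /= => -> y0'.
  by move: y0; rewrite -y0' eqxx.
- rewrite -setIA visit_extend// [X in _ `&` X]setIC setIA start_extend.
  apply: etrans (ih _ _) _; rewrite hitS//.
  by rewrite /extend eqxx.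
Qed.

(** Continuity from below: the events of returning to 0 within n steps increase to
    the event of returning at all. *)
Lemma recurrent_return_proba (e : R) : recurrent P X -> 0 < e ->
  exists n, ((1 - e)%:E <= return_proba J n)%E.
Proof.
move=> rec e0.
have P0 : P (start 0 (fun=> 0)) = 1%E by rewrite X_walk.2 eqxx big_ord0 mulr1.
have retE n : return_proba J n = P (start 0 (fun=> 0) `&` visit 0 n).
  by rewrite visit_proba P0 mul1e.
have mA n : measurable (start 0 (fun=> 0) `&` visit 0 n) by exact: measurableI.
have ndA : nondecreasing_seq (fun n => start 0 (fun=> 0) `&` visit 0 n).
  move=> m n mn; apply/subsetPset => w [ws [j jm wj]]; split => //.
  by exists j => //; exact: leq_trans mn.
have mU : measurable (\bigcup_n (start 0 (fun=> 0) `&` visit 0 n)).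
  exact: bigcupT_measurable.
have cvA : (fun n => P (start 0 (fun=> 0) `&` visit 0 n)) @ \oo -->
    P (\bigcup_n (start 0 (fun=> 0) `&` visit 0 n)) := nondecreasing_cvg_mu mA mU ndA.
have PU : P (\bigcup_n (start 0 (fun=> 0) `&` visit 0 n)) = 1%E.
  set A := \bigcup_n _ in mU cvA *.
  pose B := [set w | exists n, X n.+1 w = X 0%N w].
  have mB : measurable B.
    rewrite (_ : B = \bigcup_n \bigcup_z (X n.+1 @^-1` [set z] `&` X 0%N @^-1` [set z])).
      apply: bigcupT_measurable => n; apply: countable_bigcupT_measurable => [|z].
        exact: countableP.
      by apply: measurableI; exact: X_measurable.
    apply/seteqP; split => [w [n Xw]|w [n _ [z _ [/= nz z0]]]]; last by exists n; rewrite nz z0.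
    by exists n => //; exists (X 0%N w).
  have PB : P (~` B) = 0%E by rewrite probability_setC// rec subee.
  apply/eqP; rewrite eq_le probability_le1//= -P0 -[leRHS]adde0 -PB.
  rewrite addeC (@measureDI _ _ _ P _ B)//; apply: leeD.
    by apply: le_measure; rewrite ?inE; [exact: measurableD|exact: measurableC|by move=> w []].
  apply: le_measure; rewrite ?inE //; first exact: measurableI.
  move=> w [ws [n wn]]; exists n => //; split => //; exists n => //.
  by rewrite add0n wn ws.
rewrite PU in cvA; apply: contrapT => nle.
suff : (1 <= (1 - e)%:E :> \bar R)%E by rewrite lee_fin; lra.
apply: cvge_le cvA; apply: nearW => n /=; rewrite -retE leNgt; apply/negP => /ltW le.
by apply: nle; exists n.
Qed.

End Recurrence.

(** * Integer profiles of small energy *)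

Section Profile.
Variables (R : realType) (J : Z2 -> R).
Hypothesis J_sum :
  (\esum_(x in [set z : Z2 | z != 0%R]) `|J x|%:E = 1)%E.
Variables (d : measure_display) (Omega : measurableType d).
Variables (P : probability Omega R) (X : nat -> Omega -> Z2).
Hypothesis X_walk : random_walk J P X.
Hypothesis X_recurrent : recurrent P X.

Local Notation p x y := (step_proba J x y).

Let profile_of_hit (h : R) := Num.max 0 (2 * h - 1).

(** The function (2 h - 1)^+ has at most four times the energy of the hitting
    probability h, and it is supported where h > 1/2, a finite set since h is
    summable. *)
Lemma bump_profile (e : R) : 0 < e -> exists (f : Z2 -> R) (s : {fset Z2}),
  [/\ forall x, 0 <= f x <= 1, f 0 = 1, forall x, x \notin s -> f x = 0 &
      (dirichlet J f <= e%:E)%E].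
Proof.
move=> e0.
have [n rn] : exists n, ((1 - e / 8)%:E <= return_proba J n)%E.
  by apply: (recurrent_return_proba X_walk) => //; rewrite divr_gt0.
pose h x := fine (hit J n x).
have hE x : (h x)%:E = hit J n x by rewrite fineK// hit_fin.
have h1 x : h x <= 1 by rewrite -lee_fin hE hit_le1.
pose A := [set x | 2^-1 < h x].
have finA : finite_set A.
  apply: contrapT => /infinite_set_fset -/(_ (2 * n.+1).+1)[B BA cB].
  have : (\sum_(x <- B) (2^-1)%:E <= n.+1%:R%:E :> \bar R)%E.
    apply: le_trans (hit_sum J_sum n); apply: esum_ge; exists [set` B].
      by split=> //; exact: finite_fset.
    rewrite fsbig_finite//= set_fsetK big_seq [leRHS]big_seq.
    by apply: lee_sum => x xB; rewrite -hE lee_fin ltW//; exact: BA.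
  rewrite sumEFin lee_fin big_const_seq count_predT iter_addr_0.
  rewrite -[leLHS]mulr_natr ler_pdivrMl// -natrM ler_nat leqNgt.
  by rewrite cB.
exists (fun x => profile_of_hit (h x)), (fset_set A); split.
- by move=> x; rewrite /profile_of_hit le_max lexx/= ge_max ler01/=; have := h1 x; lra.
- by rewrite /h hit0/= /profile_of_hit max_r; lra.
- move=> x; rewrite in_fset_set// notin_setE /A /= => /negP; rewrite -leNgt => hx.
  by rewrite /profile_of_hit max_l//; lra.
have := hit_energy J_sum n.
have le4 : (dirichlet J (fun x => profile_of_hit (h x)) <= 4%:E * dirichlet J h)%E.
  apply: le_dirichlet => // x y; rewrite /profile_of_hit.
  case: (leP 0 (2 * h x - 1)) => hx; case: (leP 0 (2 * h y - 1)) => hy.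
  - nra.
  - have y0 : 0 <= 1 - 2 * h y by lra.
    rewrite subr0 -subr_ge0.
    rewrite (_ : 4 * _ - _ = (1 - 2 * h y) * (2 * (2 * h x - 1) + (1 - 2 * h y))); last by ring.
    by apply: mulr_ge0 => //; lra.
  - have x0 : 0 <= 1 - 2 * h x by lra.
    rewrite sub0r sqrrN -subr_ge0.
    rewrite (_ : 4 * _ - _ = (1 - 2 * h x) * (2 * (2 * h y - 1) + (1 - 2 * h x))); last by ring.
    by apply: mulr_ge0 => //; lra.
  - by rewrite subrr expr0n/= mulr_ge0 ?sqr_ge0.
rewrite -/h => hn; apply: le_trans le4 _.
have r0 := return_proba_ge0 J n.
have r_fin : return_proba J n \is a fin_num.
  by rewrite ge0_fin_numE// (le_lt_trans (return_proba_le1 J_sum n))// ltry.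
move: hn rn (dirichlet_ge0 J h); rewrite -(fineK r_fin).
case: (dirichlet J h) => [E||]//; rewrite -!EFinM -?EFinD ?lee_fin => *; lra.
Qed.

Lemma real_profile (L : seq Z2) (e : R) : 0 < e ->
  exists (f : Z2 -> R) (s : {fset Z2}),
  [/\ forall x, 0 <= f x <= 1, forall x, x \in L -> f x = 1,
      forall x, x \notin s -> f x = 0 & (dirichlet J f <= e%:E)%E].
Proof.
elim: L e => [|a L ih] e e0.
  exists (fun=> 0), fset0; split => //; first by move=> _; rewrite lexx ler01.
  rewrite /dirichlet esum1 ?lee_fin ?ltW// => z _.
  by rewrite subrr expr0n mulr0.
have e20 : 0 < e / 2 by rewrite divr_gt0.
have [f [s [f01 f1 f0 fe]]] := ih _ e20.
have [g [t [g01 g1 g0 ge]]] := bump_profile e20.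
exists (fun x => Num.max (f x) (g (x - a))), (s `|` [fset (x + a)%R | x in t])%fset; split.
- move=> x; have := f01 x; have := g01 (x - a); rewrite le_max ge_max.
  by move=> /andP[-> ->] /andP[-> ->].
- move=> x; rewrite in_cons => /orP[/eqP->|xL].
    by rewrite subrr g1 max_r//; have /andP[] := f01 a.
  by rewrite f1// max_l//; have /andP[] := g01 (x - a).
- move=> x; rewrite !inE negb_or => /andP[xs xt]; rewrite f0// g0 ?maxxx//.
  apply: contra xt => xt; apply/imfsetP; exists (x - a) => //.
  by rewrite subrK.
- apply: le_trans (dirichlet_max _ _ _) _.
  by rewrite (splitr e) EFinD leeD// dirichlet_shift.
Qed.

(** Double stochasticity again: a finite set of sites carries total transition mass
    equal to its cardinality, both for outgoing and for incoming steps. *)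
Lemma touching_mass (s : {fset Z2}) :
  (\esum_(z in setT) (((z.1 \in s)%:R + (z.2 \in s)%:R) * p z.1 z.2)%:E
   = (2 * #|` s|)%:R%:E)%E.
Proof.
have p0 := step_proba_ge0 J.
have card_s : (\esum_(x in setT) ((x \in s)%:R)%:E = (#|` s|)%:R%:E :> \bar R)%E.
  rewrite -(set_fsetK s) -sum1_size natr_sum -sumEFin.
  rewrite -fsbig_finite ?finite_fset// -esum_fset ?finite_fset//.
  rewrite [RHS]esum_mkcond; apply: eq_esum => x _.
  by rewrite set_fsetK mem_setE; case: (x \in s).
under eq_esum do rewrite mulrDl EFinD.
rewrite esumD; [|by move=> z _; rewrite lee_fin mulr_ge0..].
rewrite [X in (X + _)%E]esum_pair/=; last by move=> z; rewrite lee_fin mulr_ge0.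
rewrite [X in (_ + X)%E]esum_pair/=; last by move=> z; rewrite lee_fin mulr_ge0.
rewrite [X in (_ + X)%E]exchange_esum; last by move=> x y; rewrite lee_fin mulr_ge0.
rewrite mul2n -addnn natrD EFinD -!card_s; congr (_ + _)%E; apply: eq_esum => x _.
  under eq_esum do rewrite EFinM.
  rewrite esumZl//; last by move=> y _; rewrite lee_fin.
  by rewrite (step_proba_suml J_sum) mule1.
under eq_esum do rewrite EFinM.
rewrite esumZl//; last by move=> y _; rewrite lee_fin.
by rewrite (step_proba_sumr J_sum) mule1.
Qed.

(** Round down N times a real profile.  The rounding error of a difference is at
    most 1 and occurs only for pairs meeting the finite support, which contributes
    a constant to the energy, negligible with respect to N^2. *)
Lemma integer_profile (L : seq Z2) (e : R) : 0 < e ->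
  exists (s : {fset Z2}) (N0 : nat), forall N, (N0 <= N)%N ->
  exists t : Z2 -> nat,
  [/\ forall x, (t x <= N)%N, forall x, x \in L -> t x = N,
      forall x, x \notin s -> t x = 0%N &
      (dirichlet J (fun x => (t x)%:R) <= (e * N%:R ^+ 2)%:E)%E].
Proof.
move=> e0; have e30 : 0 < e / 3 by rewrite divr_gt0.
have [f [s [f01 f1 f0 fe]]] := real_profile L e30.
pose K := 4 * (#|` s|)%:R / (e / 3) : R.
exists s, (Num.truncn K).+1 => N KN.
have N_gtK : K < N%:R.
  apply: lt_le_trans (_ : (Num.truncn K).+1%:R <= _); last by rewrite ler_nat.
  exact: truncnS_gt.
have N1 : 1 <= N%:R :> R by rewrite ler1n (leq_trans _ KN).
have tP x : (Num.truncn (N%:R * f x))%:R <= N%:R * f x <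
    (Num.truncn (N%:R * f x))%:R + 1.
  have /andP[fx0 _] := f01 x.
  by rewrite natr1; apply: truncn_itv; rewrite mulr_ge0.
exists (fun x => Num.truncn (N%:R * f x)); split.
- move=> x; rewrite -(ler_nat R); have /andP[_ fx1] := f01 x.
  by have /andP[tx _] := tP x; apply: le_trans tx _; rewrite ler_piMr.
- by move=> x /f1 ->; rewrite mulr1 natrK.
- by move=> x /f0 ->; rewrite mulr0 truncn0.
set t := fun x => _.
(* t x - t y is u + r with |r| <= 1. *)
have step1 x y : (t x - t y) ^+ 2 <= 2 * N%:R ^+ 2 * (f x - f y) ^+ 2 + 2.
  pose u := N%:R * (f x - f y); pose r := t x - t y - u.
  have [r1 r2] : -1 <= r /\ r <= 1.
    by rewrite /r /u; have := tP x; have := tP y; rewrite -/(t x) -/(t y); split; lra.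
  have -> : t x - t y = u + r by rewrite /r; ring.
  have -> : 2 * N%:R ^+ 2 * (f x - f y) ^+ 2 = 2 * u ^+ 2 by rewrite /u; ring.
  by have := sqr_ge0 (u - r); have := mulr_ge0 (_ : 0 <= 1 - r) (_ : 0 <= 1 + r); nra.
have step x y : (t x - t y) ^+ 2 <=
    2 * N%:R ^+ 2 * (f x - f y) ^+ 2 + 2 * ((x \in s)%:R + (y \in s)%:R).
  have [xs|xs] := boolP (x \in s); last first.
    have [ys|ys] := boolP (y \in s); last first.
      by rewrite /t !f0// !subrr expr0n/= !mulr0 add0r mulr_ge0.
    by apply: le_trans (step1 x y) _; rewrite add0r mulr1.
  by apply: le_trans (step1 x y) _; rewrite lerD2l mulrDr mulr1 lerDl mulr_ge0.
have -> : (e * N%:R ^+ 2 = 2 * N%:R ^+ 2 * (e / 3) + (N%:R * (e / 3)) * N%:R)%R.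
  by field.
apply: (@le_trans _ _ ((2 * N%:R ^+ 2)%:E * dirichlet J f + 2%:E * (2 * #|` s|)%:R%:E)%E).
  have dz z : (0 <= (p z.1 z.2 * (f z.1 - f z.2) ^+ 2)%:E)%E.
    by rewrite lee_fin mulr_ge0 ?step_proba_ge0 ?sqr_ge0.
  have mz z : (0 <= (((z.1 \in s)%:R + (z.2 \in s)%:R) * p z.1 z.2)%:E)%E.
    by rewrite lee_fin mulr_ge0 ?step_proba_ge0.
  have N2 : 0 <= 2 * N%:R ^+ 2 :> R by rewrite mulr_ge0// sqr_ge0.
  rewrite -touching_mass -(esumZl N2 (fun z _ => dz z)).
  rewrite -(esumZl (ler0n R 2) (fun z _ => mz z)).
  rewrite -esumD; [|by move=> z _; rewrite mule_ge0// lee_fin..].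
  apply: le_esum => z _; rewrite -!EFinM -EFinD lee_fin.
  have := ler_wpM2l (step_proba_ge0 J z.1 z.2) (step z.1 z.2).
  by move/le_trans; apply; rewrite le_eqVlt; apply/orP; left; apply/eqP; ring.
rewrite [leRHS]EFinD leeD//.
  by rewrite [leRHS]EFinM lee_wpmul2l// lee_fin mulr_ge0// sqr_ge0.
rewrite -EFinM lee_fin natrM; move: N_gtK; rewrite /K ltr_pdivrMr// => h.
apply: (@le_trans _ _ (N%:R * (e / 3))); first by lra.
by rewrite ler_peMr// mulr_ge0// ltW.
Qed.

End Profile.

(** * Strict differentiability *)

Section StrictDerivative.
Variable R : realType.

Lemma row_norm_le n (v : 'rV[R]_n) (c : R) :
  0 <= c -> (forall i, `|v 0 i| <= c) -> `|v| <= c.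
Proof.
move=> c0 vc; rewrite [leLHS]/Num.Def.normr/= mx_normrE.
by apply: bigmax_le => //= -[i j] _; rewrite ord1; exact: vc.
Qed.

Lemma row_norm_ge n (v : 'rV[R]_n) i : `|v 0 i| <= `|v|.
Proof.
rewrite [leRHS]/Num.Def.normr/= mx_normrE.
exact: (le_bigmax _ (fun ij : 'I_1 * 'I_n => `|v ij.1 ij.2|) (0, i)).
Qed.

(** The mean value theorem, one coordinate at a time, along a segment in the
    direction e. *)
Lemma segment_mvt n m (F : 'rV[R]_n -> 'rV[R]_m) (x e : 'rV[R]_n) (b : 'rV[R]_m)
    (h c : R) : 0 <= h -> 0 <= c ->
  (forall t, 0 <= t <= h ->
     derivable F (x + t *: e) e /\ `|'D_e F (x + t *: e) - b| <= c) ->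
  `|F (x + h *: e) - F x - h *: b| <= c * h.
Proof.
move=> h0 c0 dF; apply: row_norm_le => [|k]; first by rewrite mulr_ge0.
pose g t := F (x + t *: e) 0 k; pose dg t := ('D_e F (x + t *: e)) 0 k.
have g_derive t : 0 <= t <= h -> is_derive t 1 g (dg t).
  move=> /dF[dFt _].
  have dFk : derivable (fun y => F y 0 k) (x + t *: e) e.
    by move/derivable_mxP : dFt; exact.
  have gE : (fun s => s^-1 *: ((g \o shift t) (s *: (1 : R)) - g t)) =
      (fun s => s^-1 *: (((fun y => F y 0 k) \o shift (x + t *: e)) (s *: e)
                         - F (x + t *: e) 0 k)).
    apply/funext => s; rewrite /g /=; congr (_ *: (F _ 0 k - _)).
    by rewrite scalerDl addrCA; congr (_ + _); rewrite [s *: 1]mulr1.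
  split; first by rewrite /derivable gE.
  by rewrite /dg derive_mx// mxE /derive gE.
have [|t|t th E] := @MVT_segment R g dg 0 h h0.
- by move=> t; rewrite in_itv/= => /andP[/ltW t0 /ltW th]; apply: g_derive; rewrite t0.
- apply: (@continuous_in_subspaceT _ _ `[0, h]%classic g) t => s.
  rewrite inE/= in_itv/= => /g_derive [dgs _].
  exact/differentiable_continuous/derivable1_diffP.
have /dF[_ dFb] : 0 <= t <= h by move: th; rewrite in_itv.
rewrite !mxE; move: E; rewrite /g scale0r addr0 subr0 => ->.
rewrite [h * _]mulrC -mulrBl normrM (ger0_norm h0) ler_wpM2r//.
by apply: le_trans dFb; have := row_norm_ge ('D_e F (x + t *: e) - b) k; rewrite !mxE.
Qed.

Lemma ball_segment n (x0 x e : 'rV[R]_n) (r h t : R) : 0 <= t <= h ->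
  `|x - x0| < r -> `|x + h *: e - x0| < r -> `|x + t *: e - x0| < r.
Proof.
move=> /andP[t0 th] xr; move: th; rewrite le_eqVlt => /orP[/eqP->//|th] yr.
have h0 : 0 < h by apply: le_lt_trans th.
have -> : x + t *: e - x0 = (1 - t / h) *: (x - x0) + (t / h) *: (x + h *: e - x0).
  rewrite [x + h *: e - x0]addrAC [(t / h) *: _]scalerDr scalerA divfK ?gt_eqF// addrA.
  by rewrite -scalerDl subrK scale1r addrAC.
apply: le_lt_trans (ler_normD _ _) _.
have th1 : t / h < 1 by rewrite ltr_pdivrMr// mul1r.
have th0 : 0 <= t / h by rewrite divr_ge0// ltW.
rewrite !normrZ !ger0_norm ?subr_ge0 ?invr_ge0 ?(ltW th1) ?(ltW h0)//.
rewrite [ltRHS](_ : r = (1 - t / h) * r + t / h * r); last by rewrite -mulrDl subrK mul1r.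
apply: ltr_leD; first by rewrite ltr_pM2l// subr_gt0.
by rewrite ler_wpM2l// ltW.
Qed.

(** If the partial derivatives on a ball are close to those of the linear map A,
    then F - A is Lipschitz with a small constant: go from x to y by changing one
    coordinate after the other.  The intermediate points stay in the ball because
    it is a ball of the maximum norm. *)
Lemma strict_derivative n m (F : 'rV[R]_n -> 'rV[R]_m) (A : 'M[R]_(n, m))
    (x0 : 'rV[R]_n) (r c : R) : 0 <= c ->
  (forall z, `|z - x0| < r -> forall i, derivable F z (delta_mx 0 i) /\
     `|'D_(delta_mx 0 i) F z - delta_mx 0 i *m A| <= c) ->
  forall x y, `|x - x0| < r -> `|y - x0| < r ->
  `|F y - F x - (y - x) *m A| <= n%:R * c * `|y - x|.
Proof.
move=> c0 dF.
have step x i h : `|x - x0| < r -> `|x + h *: delta_mx 0 i - x0| < r ->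
    `|F (x + h *: delta_mx 0 i) - F x - h *: (delta_mx 0 i *m A)| <= c * `|h|.
  have pos z k : 0 <= k -> `|z - x0| < r -> `|z + k *: delta_mx 0 i - x0| < r ->
      `|F (z + k *: delta_mx 0 i) - F z - k *: (delta_mx 0 i *m A)| <= c * k.
    move=> k0 zr kr; apply: segment_mvt => // t tk; apply: dF.
    exact: ball_segment tk zr kr.
  have [h0|h0] := leP 0 h; first by rewrite (ger0_norm h0); exact: pos.
  move=> xr yr; have := pos (x + h *: delta_mx 0 i) (- h).
  rewrite scaleNr addrK => /(_ _ yr xr); rewrite oppr_ge0 ltW// => /(_ isT).
  by rewrite ltr0_norm// -normrN opprD opprB scaleNr opprK.
move=> x y xr yr.
(* The k-th intermediate point has the first k coordinates of y. *)
pose z k : 'rV[R]_n := \row_j (if (j < k)%N then y 0 j else x 0 j).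
have r0 : 0 < r by apply: le_lt_trans xr.
have zr k : `|z k - x0| < r.
  have zle : `|z k - x0| <= Num.max `|x - x0| `|y - x0|.
    apply: row_norm_le => [|j]; first by rewrite le_max normr_ge0.
    rewrite !mxE le_max; case: ifP => _.
      by have := row_norm_ge (y - x0) j; rewrite !mxE => ->; rewrite orbT.
    by have := row_norm_ge (x - x0) j; rewrite !mxE => ->.
  by apply: le_lt_trans zle _; rewrite gt_max xr yr.
have z0 : z 0%N = x by apply/rowP => j; rewrite mxE.
have zn : z n = y by apply/rowP => j; rewrite mxE ltn_ord.
have zS k (kn : (k < n)%N) : z k.+1 = z k + (y 0 (Ordinal kn) - x 0 (Ordinal kn)) *: delta_mx 0 (Ordinal kn).
  apply/rowP => j; rewrite !mxE eqxx/= ltnS leq_eqVlt.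
  case: (eqVneq j (Ordinal kn)) => [->|jk] /=; first by rewrite eqxx ltnn mulr1 addrC subrK.
  by rewrite mulr0 addr0 (_ : (j == k :> nat) = false)//; apply/negbTE.
suff zk k : (k <= n)%N -> `|F (z k) - F x - (z k - x) *m A| <= k%:R * c * `|y - x|.
  by have := zk n (leqnn n); rewrite zn.
elim: k => [|k ih] kn; first by rewrite z0 !subrr mul0mx subrr normr0 !mul0r.
set h := (y 0 (Ordinal kn) - x 0 (Ordinal kn)).
have := zr k.+1; rewrite zS => zr1; have := step _ _ _ (zr k) zr1; rewrite -/h => st.
have -> : F (z k + h *: delta_mx 0 (Ordinal kn)) - F x - (z k + h *: delta_mx 0 (Ordinal kn) - x) *m A
  = (F (z k) - F x - (z k - x) *m A) +
    (F (z k + h *: delta_mx 0 (Ordinal kn)) - F (z k) - h *: (delta_mx 0 (Ordinal kn) *m A)).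
  rewrite [z k + _ - x]addrAC mulmxDl scalemxAl.
  by apply/rowP => j; rewrite !mxE; ring.
apply: le_trans (ler_normD _ _) _; rewrite -natr1 !mulrDl mul1r lerD ?ih 1?ltnW//.
apply: le_trans st _; rewrite ler_wpM2l//.
by have := row_norm_ge (y - x) (Ordinal kn); rewrite !mxE.
Qed.

End StrictDerivative.

(** * The multiplication of a Lie group near the identity *)

Section LocalMultiplication.
Variables (R : realType) (G : preTopologicalGroupType).

Lemma row_mx_norm_le n1 n2 (a : 'rV[R]_n1) (b : 'rV[R]_n2) (c : R) :
  `|a| <= c -> `|b| <= c -> `|row_mx a b| <= c.
Proof.
move=> ac bc; apply: row_norm_le => [|i]; first by rewrite (le_trans _ ac).
rewrite mxE; case: (fintype.split i) => j; [apply: le_trans ac|apply: le_trans bc]; exact: row_norm_ge.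
Qed.

Lemma row_mx_norm_gel n1 n2 (a : 'rV[R]_n1) (b : 'rV[R]_n2) : `|a| <= `|row_mx a b|.
Proof.
apply: row_norm_le => // i.
by have := row_norm_ge (row_mx a b) (lshift n2 i); rewrite row_mxEl.
Qed.

Lemma row_mx_norm_ger n1 n2 (a : 'rV[R]_n1) (b : 'rV[R]_n2) : `|b| <= `|row_mx a b|.
Proof.
apply: row_norm_le => // i.
by have := row_norm_ge (row_mx a b) (rshift n1 i); rewrite row_mxEr.
Qed.

(** In a chart translated so that the identity is at the origin, the multiplication
    m is C^1 with m u 0 = u and m 0 u = u, so its derivative at the origin is the
    addition and m - (addition) is a contraction near the origin. *)
Lemma lie_local_mul : lie_group R G ->
  exists n (phi : G -> 'rV[R]_n) (psi : 'rV[R]_n -> G)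
    (m : 'rV[R]_n -> 'rV[R]_n -> 'rV[R]_n) (r : R),
  [/\ 0 < r, psi 0 = 1%g,
      (forall V, nbhs 1%g V -> exists2 e, 0 < e & forall u, `|u| < e -> V (psi u)),
      (forall e, 0 < e -> nbhs 1%g [set x | `|phi x| < e /\ psi (phi x) = x]) &
      forall u u', `|u| < r -> `|u'| < r ->
        [/\ (psi u * psi u')%g = psi (m u u'), m u 0 = u, m 0 u' = u' &
            forall v v', `|v| < r -> `|v'| < r ->
            `|m u u' - m v v' - ((u - v) + (u' - v'))|
               <= 8^-1 * Num.max `|u - v| `|u' - v'| ]].
Proof.
move=> [_ _ mulC _ [n [A [[chartA coverA _] smoothM _]]]].
have [c Ac c1] := coverA 1%g.
have [oD oC invK mapC invC] := chartA c Ac.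
set v0 := chart_map c 1%g.
have Cv0 : chart_cod c v0 by exists 1%g.
have inv0 : chart_inv c v0 = 1%g by exact: invK.
have codK v : chart_cod c v -> chart_map c (chart_inv c v) = v.
  by move=> [x Dx <-]; rewrite invK.
pose F (w : 'rV[R]_(n + n)) := chart_map c (chart_inv c (lsubmx w) * chart_inv c (rsubmx w))%g.
pose D := [set w : 'rV[R]_(n + n) |
                 [/\ chart_cod c (lsubmx w), chart_cod c (rsubmx w) &
                     chart_dom c (chart_inv c (lsubmx w)
                                  * chart_inv c (rsubmx w))%g]].
have [_ F1] : Ck 1 D F by exact: smoothM.
have psi_cont V : nbhs 1%g V ->
    exists2 e, 0 < e & forall u, `|u| < e -> V (chart_inv c (v0 + u)).
  move=> V1; have invC0 : chart_inv c @ v0 --> chart_inv c v0 := invC _ Cv0.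
  move: invC0; rewrite inv0 => /(_ V V1).
  move=> /nbhs_ballP[e /= e0 eV]; exists e => // u ue; apply: eV.
  by rewrite -ball_normE /ball_/= opprD addrA subrr sub0r normrN.
have [V V1 VD] : exists2 V, nbhs (1%g : G) V & forall x y, V x -> V y -> chart_dom c (x * y)%g.
  have : nbhs ((1%g, 1%g) : G * G) [set p | chart_dom c (p.1 * p.2)%g].
    apply: (mulC (1%g, 1%g)) => /=; rewrite mulg1; exact: open_nbhs_nbhs.
  move=> [[V1 V2] /= [n1 n2] sub]; exists (V1 `&` V2); first exact: filterI.
  by move=> x y [x1 _] [_ y2]; exact: (sub (x, y)).
have [r1 r10 r1V] := psi_cont V V1.
have [r2 r20 r2C] : exists2 e, 0 < e & forall u, `|u| < e -> chart_cod c (v0 + u).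
  have /nbhs_ballP[e /= e0 eV] := open_nbhs_nbhs (conj oC Cv0).
  exists e => // u ue; apply: eV.
  by rewrite -ball_normE /ball_/= opprD addrA subrr sub0r normrN.
pose w0 : 'rV[R]_(n + n) := row_mx v0 v0.
pose r12 := Num.min r1 r2.
have Dball w : `|w - w0| < r12 -> D w.
  rewrite lt_min => /andP[w1 w2].
  have lw : lsubmx w = v0 + (lsubmx w - v0) by rewrite addrC subrK.
  have rw : rsubmx w = v0 + (rsubmx w - v0) by rewrite addrC subrK.
  have ww : w - w0 = row_mx (lsubmx w - v0) (rsubmx w - v0).
    by rewrite -[in LHS](hsubmxK w) /w0 opp_row_mx add_row_mx.
  have := row_mx_norm_gel (lsubmx w - v0) (rsubmx w - v0).
  have := row_mx_norm_ger (lsubmx w - v0) (rsubmx w - v0).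
  rewrite -ww => wr wl; split.
  - by rewrite lw; apply: r2C; exact: le_lt_trans w2.
  - by rewrite rw; apply: r2C; exact: le_lt_trans w2.
  - by rewrite lw rw; apply: VD; apply: r1V; exact: le_lt_trans w1.
pose M : 'M[R]_(n + n, n) := col_mx 1%:M 1%:M.
have ME a b : row_mx a b *m M = a + b by rewrite mul_row_col !mulmx1.
have Fl v : chart_cod c v -> F (row_mx v v0) = v.
  by move=> Cv; rewrite /F row_mxKl row_mxKr inv0 mulg1 codK.
have Fr v : chart_cod c v -> F (row_mx v0 v) = v.
  by move=> Cv; rewrite /F row_mxKl row_mxKr inv0 mul1g codK.
have Fw0 : F w0 = v0 by exact: Fl.
have small (e : 'rV[R]_n) : \forall h \near (0 : R)^', chart_cod c (v0 + h *: e).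
  have : h *: e @[h --> (0 : R)] --> (0 : 'rV[R]_n).
    by rewrite -[X in _ --> X](scale0r e); apply: cvgZr_tmp; exact: cvg_id.
  move=> /cvgr_dist_lt /(_ r2 r20) hr; apply: (@nbhs_dnbhs _ (0 : R)).
  by apply: filterS hr => h /=; rewrite sub0r normrN => hr; exact: r2C.
(* The difference quotients of F at w0 along the axes are constant, as
   F (row_mx v v0) = v and F (row_mx v0 v) = v. *)
have D0 i : 'D_(delta_mx 0 i) F w0 = delta_mx 0 i *m M.
  rewrite /derive; apply: cvg_lim => //; apply: cvg_near_cst.
  have shiftE (a b : 'rV[R]_n) (h : R) : delta_mx 0 i = row_mx a b ->
     h *: delta_mx 0 i + w0 = row_mx (v0 + h *: a) (v0 + h *: b).
    by move=> ->; rewrite scale_row_mx add_row_mx ![_ + v0]addrC.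
  have hn0 : \forall h \near (0 : R)^', h != 0 by exact: nbhs_dnbhs_neq.
  near=> h.
  have h0 : h != 0 by near: h; exact: nbhs_dnbhs_neq.
  have codh j : chart_cod c (v0 + h *: delta_mx 0 j).
    by move: j; near: h; apply: filter_forall => j; exact: small.
  have main (e : 'rV[R]_n) (e' : 'rV[R]_(n + n)) : F (h *: e' + w0) = v0 + h *: e ->
      h^-1 *: ((F \o shift w0) (h *: e') - F w0) = e.
    by rewrite /= => ->; rewrite Fw0 [v0 + _]addrC addrK scalerA mulVf// scale1r.
  rewrite -(splitK i); case: (fintype.split i) => j /=.
    rewrite delta_mx_lshift ME addr0; apply: main.
    rewrite scale_row_mx add_row_mx scaler0 add0r [_ + v0]addrC; apply: Fl.
    exact: codh.
  rewrite delta_mx_rshift ME add0r; apply: main.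
  rewrite scale_row_mx add_row_mx scaler0 add0r [_ + v0]addrC; apply: Fr.
  exact: codh.
pose k := (8 * (n + n).+1%:R)^-1 : R.
have k0 : 0 < k by rewrite invr_gt0 mulr_gt0.
have [r3 r30 r3D] : exists2 e, 0 < e & forall w, `|w - w0| < e ->
    forall i, `|'D_(delta_mx 0 i) F w - delta_mx 0 i *m M| <= k.
  have : \forall w \near w0, forall i, `|'D_(delta_mx 0 i) F w - delta_mx 0 i *m M| <= k.
    apply: (@filter_forall _ _ (fun i w => `|'D_(delta_mx 0 i) F w - delta_mx 0 i *m M| <= k) (nbhs w0)) => i.
    have [_ [Dc _]] := F1 i.
    have Dw0 : D w0 by apply: Dball; rewrite subrr normr0 lt_min r10 r20.
    have Dcont : 'D_(delta_mx 0 i) F @ w0 --> 'D_(delta_mx 0 i) F w0 := Dc _ Dw0.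
    move/cvgr_dist_le : Dcont => /(_ k k0); rewrite D0.
    by apply: filterS => w; rewrite distrC.
  move=> /nbhs_ballP[e /= e0 eV]; exists e => // w we; apply: eV.
  by rewrite -ball_normE /ball_/= distrC.
pose r := Num.min r12 r3.
have r0 : 0 < r by rewrite !lt_min r10 r20 r30.
have strict x y : `|x - w0| < r -> `|y - w0| < r ->
    `|F y - F x - (y - x) *m M| <= 8^-1 * `|y - x|.
  move=> xr yr; have := @strict_derivative R _ _ F M w0 r k (ltW k0).
  move=> /(_ _ x y xr yr) le; apply: le_trans (le _) _; last first.
    rewrite ler_wpM2r// /k invfM mulrCA ler_piMr ?invr_ge0//.
    by rewrite ler_pdivrMr// mul1r ler_nat.
  move=> z; rewrite lt_min => /andP[z12 z3] i; split; last exact: r3D.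
  by have [dF _] := F1 i; apply: dF; exact: Dball.
exists n, (fun x => chart_map c x - v0), (fun u => chart_inv c (v0 + u)),
  (fun u u' => F (row_mx (v0 + u) (v0 + u')) - v0), r.
have rmE u u' : row_mx (v0 + u) (v0 + u') - w0 = row_mx u u'.
  by rewrite /w0 opp_row_mx add_row_mx ![v0 + _]addrC !addrK.
split.
- exact: r0.
- by rewrite addr0.
- exact: psi_cont.
- move=> e e0.
  have mapC0 : chart_map c @ 1%g --> v0 := mapC _ c1.
  have domN : nbhs 1%g (chart_dom c) by exact: open_nbhs_nbhs.
  move/cvgr_dist_lt : mapC0 => /(_ e e0) mapN.
  near=> x => /=; split.
    by rewrite distrC; near: x.
  by rewrite addrC subrK invK//; near: x.
- move=> u u' ur u'r.
  have codv v : `|v| < r -> chart_cod c (v0 + v).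
    by rewrite !lt_min => /andP[/andP[_ ?] _]; exact: r2C.
  have inr v v' : `|v| < r -> `|v'| < r -> `|row_mx (v0 + v) (v0 + v') - w0| < r.
    move=> vr v'r; rewrite rmE.
    apply: (@le_lt_trans _ _ (Num.max `|v| `|v'|)); last by rewrite gt_max vr v'r.
    by apply: row_mx_norm_le; rewrite le_max lexx ?orbT.
  split.
  + have : D (row_mx (v0 + u) (v0 + u')).
      by apply: Dball; apply: lt_le_trans (inr _ _ ur u'r) _; rewrite ge_min lexx.
    rewrite /D /= row_mxKl row_mxKr => -[_ _ Duu'].
    by rewrite [v0 + (_ - v0)]addrC subrK /F row_mxKl row_mxKr invK.
  + by rewrite addr0 Fl ?[v0 + _]addrC ?addrK// addrC; exact: codv.
  + by rewrite addr0 Fr ?[v0 + _]addrC ?addrK// addrC; exact: codv.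
  + move=> v v' vr v'r; have := strict _ _ (inr _ _ vr v'r) (inr _ _ ur u'r).
    rewrite opp_row_mx add_row_mx ME.
    have vE (a b : 'rV[R]_n) : v0 + a - (v0 + b) = a - b.
      by rewrite opprD addrACA subrr add0r.
    rewrite !vE => st.
    rewrite (_ : F _ - v0 - (F (row_mx (v0 + v) (v0 + v')) - v0) =
      F (row_mx (v0 + u) (v0 + u')) - F (row_mx (v0 + v) (v0 + v'))); last first.
      by rewrite opprB addrA subrK.
    apply: le_trans st _.
    by rewrite ler_wpM2l ?invr_ge0//; apply: row_mx_norm_le; rewrite le_max lexx ?orbT.
Unshelve. all: by end_near.
Qed.

End LocalMultiplication.

(** * Square roots and dyadic roots *)

(** Lets the fixed point theorem be applied in spaces of row vectors. *)
HB.instance Definition _ (R : realType) n :=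
  Uniform_isComplete.Build 'rV[R]_n (@cauchy_cvg ('rV[R]_n : completeType)).

Section DyadicRoots.
Variable G : preTopologicalGroupType.

(** A substitute for lying on a one-parameter subgroup: the powers below 2^j of the
    root of order 2^(n0 + j) describe, as j grows, the same initial segment of the
    curve, and they are uniformly close to the identity when n0 is large. *)
Definition dyadic_roots (g : G) := exists root : nat -> G,
  [/\ root 0%N = g, forall n, (root n.+1 * root n.+1)%g = root n &
      forall V, nbhs (1%g : G) V -> exists n0, forall j k, (k < 2 ^ j)%N ->
        V (root (n0 + j)%N ^+ k)%g].

Lemma root_expg (root : nat -> G) :
  (forall n, (root n.+1 * root n.+1)%g = root n) ->
  forall n j, (root (n + j)%N ^+ (2 ^ j))%g = root n.
Proof.
move=> rootS n; elim=> [|j ih]; first by rewrite addn0 expg1.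
by rewrite expnS expgnA expg2 addnS rootS.
Qed.

Variables (R : realType) (n : nat) (psi : 'rV[R]_n -> G).
Variables (m : 'rV[R]_n -> 'rV[R]_n -> 'rV[R]_n) (r : R).
Hypothesis r0 : 0 < r.
Hypothesis mP : forall u u', `|u| < r -> `|u'| < r ->
  [/\ (psi u * psi u')%g = psi (m u u'), m u 0 = u, m 0 u' = u' &
      forall v v', `|v| < r -> `|v'| < r ->
        `|m u u' - m v v' - ((u - v) + (u' - v'))| <= 8^-1 * Num.max `|u - v| `|u' - v'| ].

(** The equation m u u = y reads u = (y - E u) / 2 where E u = m u u - 2 u is a
    contraction of ratio 1/8, so the right hand side is a contraction of the ball
    of radius 2/3 |y|. *)
Lemma square_root (y : 'rV[R]_n) : `|y| < r ->
  exists u, m u u = y /\ `|u| <= (2 / 3) * `|y|.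
Proof.
move=> yr.
pose U := [set u : 'rV[R]_n | `|u| <= (2 / 3) * `|y|].
have Ur u : U u -> `|u| < r.
  by rewrite /U /= => u_le; apply: le_lt_trans u_le _; have := normr_ge0 y; lra.
pose E u := m u u - (u + u).
have n0 : `|0 : 'rV[R]_n| < r by rewrite normr0.
have m00 : m 0 0 = 0 by have [_ ->] := mP n0 n0.
(* E u is the defect of m from addition on the diagonal. *)
have E_lip u v : U u -> U v -> `|E u - E v| <= 8^-1 * `|u - v|.
  move=> Uu Uv; have [_ _ _ /(_ v v (Ur _ Uv) (Ur _ Uv))] := mP (Ur _ Uu) (Ur _ Uu).
  rewrite maxxx; apply: le_trans; rewrite le_eqVlt; apply/orP; left; apply/eqP; congr (`| _ |).
  by apply/rowP => j; rewrite !mxE; ring.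
have U0 : U 0 by rewrite /U /= normr0 mulr_ge0.
have E_norm u : U u -> `|E u| <= 8^-1 * `|u|.
  by move=> Uu; have := E_lip _ _ Uu U0; rewrite /E m00 !addr0 !subr0.
pose f u := 2^-1 *: (y - E u).
have fU : set_fun U U f.
  move=> u Uu; rewrite /U /f /= normrZ ger0_norm ?invr_ge0//.
  have := normr_ge0 y; have := ler_normB y (E u); have := E_norm u Uu; move: (Uu); rewrite /U /=; lra.
have closedU : closed U.
  have -> : U = (fun u : 'rV[R]_n => `|u|) @^-1` [set x | x <= (2 / 3) * `|y|] by [].
  by apply: closed_comp => [u _|]; [exact: norm_continuous|exact: closed_le].
have fc : is_contraction (mkfun_fun fU).
  exists (8^-1)%:nng; split => /=; first by rewrite invf_lt1 ?ltr1n.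
  move=> [u v] [/= Uu Uv]; rewrite /f -scalerBr normrZ ger0_norm ?invr_ge0//.
  rewrite (_ : y - E u - (y - E v) = E v - E u); last by apply/rowP => j; rewrite !mxE; ring.
  rewrite distrC; have := E_lip _ _ Uu Uv; have := normr_ge0 (E u - E v) => *; lra.
have [u Uu fu] := banach_fixed_point fc closedU (ex_intro _ 0 U0).
exists u; split => //.
have : u + u = y - E u.
  rewrite {1 2}fu /= /f -scalerDl (_ : 2^-1 + 2^-1 = 1) ?scale1r//; lra.
by rewrite /E => /rowP h; apply/rowP => j; have := h j; rewrite !mxE; lra.
Qed.

(** The coordinates of successive square roots decrease geometrically with ratio
    q = 2/3.  A power k < 2^j of the j-th root beyond n0 is, by the binary expansion
    of k, a product of at most j distinct roots of index larger than n0, and its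
    coordinates are bounded by the tail of a geometric series. *)
Lemma local_dyadic_roots (u0 : 'rV[R]_n) : `|u0| < r / 7 -> psi 0 = 1%g ->
  (forall V, nbhs (1%g : G) V -> exists2 e, 0 < e & forall u, `|u| < e -> V (psi u)) ->
  dyadic_roots (psi u0).
Proof.
move=> u0r psi0 psiC.
have [sq sqP] : exists sq : 'rV[R]_n -> 'rV[R]_n, forall y, `|y| < r ->
    m (sq y) (sq y) = y /\ `|sq y| <= (2 / 3) * `|y|.
  have : forall y, exists u, `|y| < r -> m u u = y /\ `|u| <= (2 / 3) * `|y|.
    move=> y; have [yr|yr] := pselect (`|y| < r); last by exists 0.
    by have [u uP] := square_root yr; exists u.
  by move=> /choice[sq ?]; exists sq.
pose u k := iter k sq u0; pose q : R := 2 / 3.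
have q01 : 0 <= q <= 1 by rewrite /q; lra.
have u0_ge0 := normr_ge0 u0.
have u_le k : `|u k| <= q ^+ k * `|u0|.
  elim: k => [|k ih]; first by rewrite expr0 mul1r.
  have uk : `|u k| < r.
    apply: le_lt_trans ih _; apply: (@le_lt_trans _ _ `|u0|); last by lra.
    by rewrite ler_piMl// exprn_ile1//; case/andP: q01.
  have [_ h] := sqP _ uk; apply: le_trans h _.
  by rewrite exprS -[leRHS]mulrA ler_wpM2l//; case/andP: q01.
have q1 k : q ^+ k <= 1 by rewrite exprn_ile1//; case/andP: q01.
have q0 k : 0 <= q ^+ k by rewrite exprn_ge0//; case/andP: q01.
have u_r k : `|u k| < r.
  apply: le_lt_trans (u_le k) _; apply: (@le_lt_trans _ _ `|u0|); last by lra.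
  by rewrite ler_piMl.
pose root k := psi (u k).
have rootS k : (root k.+1 * root k.+1)%g = root k.
  have [-> _ _ _] := mP (u_r k.+1) (u_r k.+1).
  by have [-> _] := sqP _ (u_r k).
(* The factor 6 absorbs the bound |m u w| <= |w| + 2 |u|: with q = 2/3,
   2 q^(N+1) = 6 (q^(N+1) - q^(N+2)). *)
have bound j N k : (k < 2 ^ j)%N -> exists w, (root (N + j)%N ^+ k)%g = psi w /\
    `|w| <= 6 * (q ^+ N.+1 - q ^+ (N + j).+1) * `|u0|.
  elim: j N k => [|j ih] N k.
    by rewrite ltnS leqn0 => /eqP->; exists 0; rewrite expg0 psi0 normr0 addn0 subrr mulr0 mul0r.
  move=> k2; rewrite addnS -addSn.
  have qN : q ^+ N.+2 = q * q ^+ N.+1 by rewrite exprS.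
  have [kj|jk] := ltnP k (2 ^ j).
    have [w [-> wle]] := ih N.+1 k kj; exists w; split => //; apply: le_trans wle _.
    by rewrite ler_wpM2r// ler_wpM2l// lerD2r qN ler_piMl//; case/andP: q01.
  have kj : (k - 2 ^ j < 2 ^ j)%N by rewrite ltn_subLR// addnn -mul2n -expnS.
  have [w [wE wle]] := ih N.+1 _ kj.
  have wr : `|w| < r.
    apply: le_lt_trans wle _; have := q1 N.+2; have := q0 (N.+1 + j).+1 => ? ?; nra.
  exists (m (u N.+1) w).
  have [E _ m0w lip] := mP (u_r N.+1) wr; split.
    by rewrite -[in LHS](subnKC jk) expgnDr root_expg// wE E.
  have n0 : `|0 : 'rV[R]_n| < r by rewrite normr0.
  have := lip 0 w n0 wr; rewrite m0w subr0 subrr addr0 normr0 max_l// => h.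
  have h2 : `|m (u N.+1) w| <= `|w| + 2 * `|u N.+1|.
    have := ler_normD (m (u N.+1) w - w - u N.+1) (w + u N.+1).
    rewrite (_ : _ + (w + u N.+1) = m (u N.+1) w); last first.
      by apply/rowP => i; rewrite !mxE; ring.
    have := ler_normD w (u N.+1); have := normr_ge0 (u N.+1); lra.
  apply: le_trans h2 _; have := u_le N.+1.
  move: wle; rewrite qN {1}/q => ? ?; nra.
exists root; split => // V /psiC[e e0 eV].
have [n0 n0P] : exists n0, 6 * q ^+ n0.+1 * `|u0| < e.
  have qn : `|q| < 1 by rewrite ger0_norm; rewrite /q; lra.
  have := @cvg_geometric R (6 * q * `|u0|) q qn.
  move=> /cvgr_dist_lt /(_ e e0) [k _ /(_ k (leqnn k))] /=.
  rewrite sub0r normrN ger0_norm; last by rewrite !mulr_ge0//; case/andP: q01.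
  by move=> ke; exists k; rewrite exprS mulrA mulrAC.
exists n0 => j k kj; have [w [-> wle]] := bound j n0 k kj.
apply: eV; apply: le_lt_trans wle _; apply: le_lt_trans n0P.
by rewrite ler_wpM2r// ler_wpM2l// lerBlDr lerDl.
Qed.

End DyadicRoots.

(** * Generation of a connected Lie group by dyadic roots *)

Lemma nbhs_dyadic_roots (R : realType) (G : preTopologicalGroupType) :
  lie_group R G -> nbhs (1%g : G) [set g | dyadic_roots g].
Proof.
move=> /lie_local_mul[n [phi [psi [m [r [r0 psi0 psiC phiN mP]]]]]].
have r70 : 0 < r / 7 by rewrite divr_gt0.
apply: filterS (phiN _ r70) => g /= [phig <-].
exact: (local_dyadic_roots r0 mP).
Qed.

(** H is open and so is its complement, a union of translates of neighbourhoods of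
    the identity contained in H. *)
Lemma dyadic_roots_generate (R : realType) (G : preTopologicalGroupType)
    (H : set G) : lie_group R G -> connected [set: G] ->
  (forall g, dyadic_roots g -> H g) -> H 1%g ->
  (forall g h, H g -> H h -> H (g * h)%g) -> (forall g, H g -> H g^-1%g) ->
  forall g, H g.
Proof.
move=> lieG cG rootH H1 HM HV.
have translate (g : G) : nbhs g [set x | dyadic_roots (g^-1 * x)%g].
  have [_ _ mulC _ _] := lieG.
  have N1 : nbhs (g^-1 * g)%g [set x : G | dyadic_roots x].
    by rewrite mulVg; exact: nbhs_dyadic_roots lieG.
  have [[V1 V2] /= [n1 n2] sub] := mulC (g^-1%g, g) _ N1.
  apply: filterS n2 => x V2x; apply: (sub (g^-1%g, x)); split => //=.
  exact: nbhs_singleton.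
have openH : open H.
  rewrite openE => g Hg; apply: filterS (translate g) => x /= /rootH Hx.
  by have := HM _ _ Hg Hx; rewrite mulgA mulgV mul1g.
have closedH : closed H.
  rewrite -[H]setCK; apply: open_closedC; rewrite openE => g nHg.
  apply: filterS (translate g) => x /= /rootH Hx Hxx; apply: nHg.
  by have := HM _ _ Hxx (HV _ Hx); rewrite invgM invgK mulgA mulgV mul1g.
have -> : H = setT.
  apply: cG; first by exists 1%g.
  - by exists H => //; rewrite setTI.
  - by exists H => //; rewrite setTI.
by [].
Qed.

(** * Subcritical percolation on a finite set *)

Section Percolation.
Variables (R : realType) (T : finType).
Implicit Types (A : {ffun T * T -> bool}) (p : T * T -> R).

(** Law of independent bonds, the bond e being open with probability p e. *)
Definition bond_weight p A : R := \prod_e (if A e then p e else 1 - p e).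

Definition bond_mean p (f : {ffun T * T -> bool} -> R) : R :=
  \sum_A bond_weight p A * f A.

Lemma bond_weight_ge0 p A : (forall e, 0 <= p e <= 1) -> 0 <= bond_weight p A.
Proof.
by move=> p01; apply: prodr_ge0 => e _; have := p01 e; case: (A e) => /andP[]//; lra.
Qed.

Lemma sum_prod_bonds (a b : T * T -> R) :
  \sum_(A : {ffun T * T -> bool}) \prod_e (if A e then a e else b e) = \prod_e (a e + b e).
Proof.
transitivity (\prod_e \sum_(c : bool) if c then a e else b e); last first.
  by apply: eq_bigr => e _; rewrite big_bool.
by rewrite bigA_distr_bigA.
Qed.

Lemma bond_mean1 p : bond_mean p (fun=> 1) = 1.
Proof.
rewrite /bond_mean; under eq_bigr do rewrite mulr1.
by rewrite sum_prod_bonds big1// => e _; rewrite addrC subrK.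
Qed.

Lemma bond_mean_le p f g : (forall e, 0 <= p e <= 1) -> (forall A, f A <= g A) ->
  bond_mean p f <= bond_mean p g.
Proof. by move=> p01 fg; apply: ler_sum => A _; rewrite ler_wpM2l ?bond_weight_ge0. Qed.

Lemma bond_meanD p f g :
  bond_mean p (fun A => f A + g A) = bond_mean p f + bond_mean p g.
Proof. by rewrite -big_split; apply: eq_bigr => A _; rewrite mulrDr. Qed.

Lemma bond_meanZ p c f : bond_mean p (fun A => c * f A) = c * bond_mean p f.
Proof. by rewrite mulr_sumr; apply: eq_bigr => A _; rewrite mulrCA. Qed.

Lemma bond_mean_cst p c : bond_mean p (fun=> c) = c.
Proof.
rewrite -[RHS]mulr1 -(bond_mean1 p) -bond_meanZ.
by apply: eq_bigr => A _; rewrite mulr1.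
Qed.

Lemma bond_mean_sum p (I : finType) (P : pred I) (f : I -> {ffun T * T -> bool} -> R) :
  bond_mean p (fun A => \sum_(i | P i) f i A) = \sum_(i | P i) bond_mean p (f i).
Proof. by rewrite exchange_big; apply: eq_bigr => A _; rewrite mulr_sumr. Qed.

Definition set_bond A e (c : bool) : {ffun T * T -> bool} :=
  [ffun e' => if e' == e then c else A e'].

(** Pair the configurations that differ at the bond e only. *)
Lemma bond_mean_indep p e f :
  (forall A, f (set_bond A e true) = f (set_bond A e false)) ->
  bond_mean p (fun A => (A e)%:R * f A) = p e * bond_mean p f.
Proof.
move=> fe; rewrite /bond_mean.
have fset A c : f (set_bond A e c) = f A.
  have AE : A = set_bond A e (A e).
    by apply/ffunP => e'; rewrite ffunE; case: eqP => [->|].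
  by rewrite [in RHS]AE; case: c; case: (A e).
have rest A c : \prod_(e' | e' != e) (if set_bond A e c e' then p e' else 1 - p e') =
    \prod_(e' | e' != e) (if A e' then p e' else 1 - p e').
  by apply: eq_bigr => e' /negbTE ne; rewrite ffunE ne.
have wE A c : bond_weight p (set_bond A e c) = (if c then p e else 1 - p e) *
    \prod_(e' | e' != e) (if A e' then p e' else 1 - p e').
  by rewrite /bond_weight (bigD1 e)//= rest ffunE eqxx.
(* Closing e maps the configurations where e is open onto the others. *)
have reindexE (h : {ffun T * T -> bool} -> R) :
    \sum_(A : {ffun T * T -> bool} | A e) h (set_bond A e false) = \sum_(A : {ffun T * T -> bool} | ~~ A e) h A.
  rewrite [RHS](reindex_onto (fun A => set_bond A e false) (fun A => set_bond A e true)).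
    apply: eq_bigl => A; rewrite ffunE eqxx /=; apply/idP/eqP => [Ae|<-]; last by rewrite ffunE eqxx.
    by apply/ffunP => e'; rewrite !ffunE; case: eqP => [->|].
  move=> A Ae; apply/ffunP => e'; rewrite !ffunE; case: eqP => [->|//].
  exact/esym/negbTE.
rewrite [LHS](bigID (fun A : {ffun T * T -> bool} => A e))/= [X in _ + X]big1 ?addr0; last first.
  by move=> A /negbTE ->; rewrite mul0r mulr0.
rewrite [in RHS](bigID (fun A : {ffun T * T -> bool} => A e))/= mulrDr -reindexE !mulr_sumr -big_split/=.
apply: eq_bigr => A Ae; rewrite fset wE Ae mul1r.
have -> : bond_weight p A = p e * \prod_(e' | e' != e) (if A e' then p e' else 1 - p e').
  by rewrite /bond_weight (bigD1 e)//= Ae.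
ring.
Qed.

(** Bonds are indexed by ordered pairs; the two orientations play the same role for
    connectivity. *)
Definition bond_open A : rel T := fun x y => A (x, y) || A (y, x).

Lemma bond_openC A x y : bond_open A x y = bond_open A y x.
Proof. by rewrite /bond_open orbC. Qed.

Definition cluster_min (t : T -> nat) A (x : T) : nat :=
  t [arg min_(y < x | connect (bond_open A) x y) t y]%N.

Lemma cluster_min_le t A x y : connect (bond_open A) x y -> (cluster_min t A x <= t y)%N.
Proof. by move=> xy; rewrite /cluster_min; case: arg_minnP => // z _; exact. Qed.

Lemma cluster_minP t A x : exists2 y, connect (bond_open A) x y & cluster_min t A x = t y.
Proof.
by rewrite /cluster_min; case: arg_minnP => // z xz _; exists z.
Qed.

Lemma cluster_min_bond t A x y : bond_open A x y ->
  cluster_min t A x = cluster_min t A y.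
Proof.
have sub u v : bond_open A u v -> (cluster_min t A u <= cluster_min t A v)%N.
  move=> uv; have [w vw ->] := cluster_minP t A v.
  by apply: cluster_min_le; apply: connect_trans vw; exact: connect1.
move=> xy; apply/eqP; rewrite eqn_leq sub// sub// bond_openC//.
Qed.

Section Variation.
Variable f : T -> R.

(** A sum over all self-avoiding open walks of at most n steps from x through B,
    weighted so as to dominate (f x - f y)^2 for every end point y: the square of a
    sum of two increments is at most twice the sum of their squares. *)
Fixpoint walk_variation n (B : {set T}) (x : T) A : R :=
  if n is n'.+1 then
    \sum_(z in B) (bond_open A x z)%:R *
      (2 * (f x - f z) ^+ 2 + 2 * walk_variation n' (B :\ z) z A)
  else 0.

Lemma walk_variation_ge0 n B x A : 0 <= walk_variation n B x A.
Proof.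
elim: n B x => [//|n ih] B x /=; apply: sumr_ge0 => z _.
by rewrite mulr_ge0// addr_ge0// mulr_ge0// sqr_ge0.
Qed.

Lemma walk_variation_path A s n (B : {set T}) x : path (bond_open A) x s -> uniq s ->
  {subset s <= B} -> (size s <= n)%N -> (f x - f (last x s)) ^+ 2 <= walk_variation n B x A.
Proof.
elim: s n B x => [|z s ih] n B x /=; first by rewrite subrr expr0n walk_variation_ge0.
case: n => [//|n] /andP[xz zs] /andP[zns us] sB sn.
have zB : z \in B by apply: sB; rewrite mem_head.
have := ih n (B :\ z) z zs us _ sn.
have sBz : {subset s <= B :\ z}.
  move=> y ys; rewrite !inE (sB y) ?in_cons ?ys ?orbT// andbT.
  by apply: contra zns => /eqP <-.
move=> /(_ sBz) le.
rewrite /= (bigD1 z)//= xz mul1r.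
rewrite -[leLHS]addr0 lerD//; last first.
  apply: sumr_ge0 => y _; rewrite mulr_ge0// addr_ge0// mulr_ge0// ?sqr_ge0//.
  exact: walk_variation_ge0.
apply: le_trans (_ : 2 * (f x - f z) ^+ 2 + 2 * (f z - f (last z s)) ^+ 2 <= _).
  have := sqr_ge0 ((f x - f z) - (f z - f (last z s))); nra.
by rewrite lerD2l ler_wpM2l.
Qed.

(** Since the recursion removes each visited site, the bonds of a site are no longer
    looked at once the walk has left it; this gives the independence used in
    [walk_variation_mean]. *)
Lemma walk_variation_local n (B : {set T}) x A A' :
  (forall a b, a \in x |: B -> b \in x |: B -> A (a, b) = A' (a, b)) ->
  walk_variation n B x A = walk_variation n B x A'.
Proof.
elim: n B x => [//|n ih] B x AA' /=; apply: eq_bigr => z zB.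
congr (_%:R * (_ + 2 * _)).
  by rewrite /bond_open !AA' ?finset.setU11// finset.setU1r.
by apply: ih => a b; rewrite finset.setD1K// => aB bB; apply: AA'; exact: finset.setU1r.
Qed.

Variables (p : T * T -> R) (q : T -> T -> R).
Hypothesis p01 : forall e, 0 <= p e <= 1.
Hypothesis pq : forall x y, p (x, y) + p (y, x) <= q x y.
Hypothesis q_sum : forall y, \sum_x q x y <= 4^-1.

Let q0 x y : 0 <= q x y.
Proof. by apply: le_trans (pq x y); rewrite addr_ge0//; case/andP: (p01 (x, y)); case/andP: (p01 (y, x)). Qed.

(** The bound that results from [walk_variation] by replacing the indicators of
    open bonds by the bounds q on their probabilities and forgetting
    self-avoidance. *)
Fixpoint mean_variation n (x : T) : R :=
  if n is n'.+1 then \sum_z q x z * (2 * (f x - f z) ^+ 2 + 2 * mean_variation n' z)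
  else 0.

Lemma mean_variation_ge0 n x : 0 <= mean_variation n x.
Proof.
elim: n x => [//|n ih] x /=; apply: sumr_ge0 => z _.
by rewrite mulr_ge0// addr_ge0// mulr_ge0// sqr_ge0.
Qed.

(** The first bond of a self-avoiding walk is independent of the bonds used later. *)
Lemma walk_variation_mean n (B : {set T}) x : x \notin B ->
  bond_mean p (walk_variation n B x) <= mean_variation n x.
Proof.
elim: n B x => [|n ih] B x xB.
  by rewrite /bond_mean big1//= => A _; rewrite mulr0.
rewrite /= bond_mean_sum.
apply: (@le_trans _ _ (\sum_(z in B) q x z * (2 * (f x - f z) ^+ 2 + 2 * mean_variation n z))); last first.
  rewrite [leRHS](bigID (mem B))/= lerDl; apply: sumr_ge0 => z _.
  by rewrite mulr_ge0// addr_ge0// mulr_ge0// ?sqr_ge0// mean_variation_ge0.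
apply: ler_sum => z zB.
pose g A := 2 * (f x - f z) ^+ 2 + 2 * walk_variation n (B :\ z) z A.
have g0 A : 0 <= g A by rewrite addr_ge0// mulr_ge0// ?sqr_ge0// walk_variation_ge0.
have g_indep e : (e.1 == x) || (e.2 == x) ->
    forall A, g (set_bond A e true) = g (set_bond A e false).
  move=> ex A; congr (_ + 2 * _); apply: walk_variation_local => a b.
  rewrite finset.setD1K// => aB bB; rewrite !ffunE; case: eqP => // abe.
  by move: ex; rewrite -abe /= => /orP[]/eqP ax; [move: aB|move: bB]; rewrite ax (negbTE xB).
have gmean : bond_mean p g <= 2 * (f x - f z) ^+ 2 + 2 * mean_variation n z.
  rewrite /g bond_meanD; apply: lerD.
    by rewrite bond_mean_cst.
  by rewrite bond_meanZ ler_wpM2l//; apply: ih; rewrite finset.setD11.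
apply: (@le_trans _ _ (bond_mean p (fun A => (A (x, z))%:R * g A + (A (z, x))%:R * g A))).
  apply: bond_mean_le => // A; rewrite -mulrDl ler_wpM2r//; first exact: (g0 A).
  by rewrite /bond_open -natrD ler_nat; case: (A (x, z)); case: (A (z, x)).
rewrite bond_meanD !bond_mean_indep; [|by apply: g_indep; rewrite /= eqxx ?orbT..].
rewrite -mulrDl; apply: le_trans (ler_wpM2l _ gmean) _.
  by rewrite addr_ge0//; [case/andP: (p01 (x, z))|case/andP: (p01 (z, x))].
by rewrite ler_wpM2r// addr_ge0// mulr_ge0// ?sqr_ge0// mean_variation_ge0.
Qed.

(** Each step of the recursion multiplies the total by at most 2 / 4 and adds twice
    the energy: the factor 2 of the convexity inequality is beaten by the
    subcritical factor 1/4. *)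
Lemma mean_variation_sum n :
  \sum_x mean_variation n x <= 4 * \sum_x \sum_z q x z * (f x - f z) ^+ 2.
Proof.
set E := \sum_x _.
have E0 : 0 <= E by do 2 (apply: sumr_ge0 => ? _); rewrite mulr_ge0// sqr_ge0.
elim: n => [|n ih]; first by rewrite big1// mulr_ge0.
have -> : \sum_x mean_variation n.+1 x = 2 * E + 2 * \sum_z (\sum_x q x z) * mean_variation n z.
  rewrite /E !mulr_sumr.
  under [X in _ = _ + X]eq_bigr do rewrite mulr_suml mulr_sumr.
  rewrite [X in _ = _ + X]exchange_big -big_split/=; apply: eq_bigr => x _.
  rewrite mulr_sumr -big_split/=; apply: eq_bigr => z _; ring.
have : \sum_z (\sum_x q x z) * mean_variation n z <= 4^-1 * \sum_z mean_variation n z.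
  rewrite mulr_sumr; apply: ler_sum => z _; rewrite ler_wpM2r//.
  exact: mean_variation_ge0.
lra.
Qed.

End Variation.

(** The minimum over the cluster of x is the value at the end point of an open
    self-avoiding walk from x, so [walk_variation] bounds the square of the
    difference. *)
Lemma cluster_min_variance p (q : T -> T -> R) (t : T -> nat) :
  (forall e, 0 <= p e <= 1) ->
  (forall x y, p (x, y) + p (y, x) <= q x y) ->
  (forall y, \sum_x q x y <= 4^-1) ->
  bond_mean p (fun A => \sum_x ((t x)%:R - (cluster_min t A x)%:R) ^+ 2)
    <= 4 * \sum_x \sum_z q x z * ((t x)%:R - (t z)%:R) ^+ 2.
Proof.
move=> p01 pq q_sum; rewrite bond_mean_sum.
pose f x := (t x)%:R : R.
apply: le_trans (mean_variation_sum f p01 pq q_sum #|T|).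
apply: ler_sum => x _.
apply: le_trans (walk_variation_mean f p01 pq #|T| (B := [set~ x]) _); last by rewrite !inE eqxx.
apply: bond_mean_le => // A.
have [y /connectP[s0 s0p ->] ->] := cluster_minP t A x.
case: (shortenP s0p) => s sp us _.
apply: walk_variation_path sp _ _ _; first by case/andP: us.
- by move=> z zs; rewrite !inE; apply: contraTneq zs => ->; case/andP: us.
- by have := uniq_leq_size us (s2 := enum T) (fun z _ => mem_enum T z); rewrite -cardE => /ltnW.
Qed.

End Percolation.

(** * Second differences on the integers *)

Section SecondDifference.
Variable R : realType.
Implicit Types (f : int -> R) (k : int).

Definition diff2 (n : nat) f k : R := f (k + n%:Z) + f (k - n%:Z) - 2 * f k.

(** Up to the factor n^2, convolution with the triangular kernel on
    {-(n-1), ..., n-1}; see [triangle_diff2] for why the kernel is triangular. *)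
Definition triangle (n : nat) f k : R :=
  \sum_(i < n) \sum_(j < n) f (k + i%:Z - j%:Z).

(** Two telescoping sums: a second difference of step n is a triangular sum of
    second differences of step 1. *)
Lemma triangle_diff2 n f k : triangle n (diff2 1 f) k = diff2 n f k.
Proof.
pose e x := f (x + 1) - f x.
have tel x : \sum_(i < n) e (x + i%:Z) = f (x + n%:Z) - f x.
  elim: n => [|m ih]; first by rewrite big_ord0 addr0 subrr.
  rewrite big_ord_recr /= ih /e (_ : x + m.+1%:Z = x + m%:Z + 1); last by rewrite intS; ring.
  by ring.
have telV x : \sum_(j < n) (e (x - j%:Z) - e (x - j%:Z - 1)) = e x - e (x - n%:Z).
  elim: n {tel} => [|m ih]; first by rewrite big_ord0 subr0 subrr.
  rewrite big_ord_recr /= ih (_ : x - m.+1%:Z = x - m%:Z - 1); last by rewrite intS; ring.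
  by ring.
rewrite /triangle.
transitivity (\sum_(i < n) (e (k + i%:Z) - e (k - n%:Z + i%:Z))).
  apply: eq_bigr => i _; rewrite [k - _ + _]addrAC -telV; apply: eq_bigr => j _.
  by rewrite /diff2 /e subrK; ring.
rewrite sumrB !tel subrK /diff2; ring.
Qed.

(** Both sides are triangular sums, over n and over m, of second differences of
    step 1, and these operations commute. *)
Lemma diff2_triangle n m f k :
  diff2 n (triangle m f) k = triangle n (diff2 m f) k.
Proof.
have comm g : diff2 1 (triangle m g) = triangle m (diff2 1 g).
  apply/funext => x; rewrite /diff2 /triangle mulr_sumr -big_split -sumrB /=.
  apply: eq_bigr => i _; rewrite mulr_sumr -big_split -sumrB /=.
  apply: eq_bigr => j _ /=; congr (g _ + g _ - 2 * g _); ring.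
rewrite -triangle_diff2 comm; congr triangle; apply/funext => x.
exact: triangle_diff2.
Qed.

(** A second difference of step n of the average triangle m f / m^2 is thus of order
    (n / m)^2, as if f had a second derivative of order 1 / m^2, although f is
    only bounded. *)
Lemma diff2_triangle_le n m f (b : R) k : (forall x, `|f x| <= b) ->
  `|diff2 n (triangle m f) k| <= (n ^ 2)%:R * (4 * b).
Proof.
move=> fb; rewrite diff2_triangle.
have d2 x : `|diff2 m f x| <= 4 * b.
  rewrite /diff2; apply: le_trans (ler_normB _ _) _.
  have := ler_normD (f (x + m%:Z)) (f (x - m%:Z)).
  rewrite normrM ger0_norm//; have := fb x; have := fb (x + m%:Z); have := fb (x - m%:Z).
  lra.
apply: le_trans (ler_norm_sum _ _ _) _.
apply: (@le_trans _ _ (\sum_(i < n) n%:R * (4 * b))); last first.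
  by rewrite sumr_const card_ord -[leLHS]mulr_natl mulrA -natrM mulnn.
apply: ler_sum => i _; apply: le_trans (ler_norm_sum _ _ _) _.
apply: (@le_trans _ _ (\sum_(j < n) (4 * b))); first by apply: ler_sum => j _; exact: d2.
by rewrite sumr_const card_ord -[leLHS]mulr_natl.
Qed.

End SecondDifference.

(** * Configurations and integration over finitely many spins *)

Section Configurations.
Variables (S : ptopologicalType).

Lemma measurable_coord (x : Z2) :
  measurable_fun [set: config S] (fun phi : config S => (phi : Z2 -> S) x : borel S).
Proof.
move=> _ A mA; apply: sub_sigma_algebra; exists x => //.
by exists A => //; rewrite setTI.
Qed.

Lemma measurable_to_config d (T : measurableType d) (h : T -> config S) :
  (forall x, measurable_fun setT (fun t => (h t : Z2 -> S) x : borel S)) ->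
  measurable_fun setT h.
Proof.
move=> mh; apply: (@measurability _ _ T (config S) setT h (@coord_events S setT)) => //.
move=> _ [B [x _ [A mA <-]] <-].
rewrite !setTI; have := mh x measurableT A mA; rewrite setTI.
by rewrite -[X in measurable X -> _]/(h @^-1` ((fun phi : config S => (phi : Z2 -> S) x) @^-1` A)).
Qed.

Lemma measurable_update x :
  measurable_fun setT (fun p : config S * borel S => update p.1 x p.2 : config S).
Proof.
apply: measurable_to_config => y; rewrite /update.
case: (eqVneq y x) => _; first exact: measurable_snd.
exact: (measurableT_comp (measurable_coord y) measurable_fst).
Qed.

Lemma measurable_update_site (phi : Z2 -> S) x :
  measurable_fun setT (fun s : borel S => update phi x s : config S).
Proof.
apply: measurable_to_config => y; rewrite /update.
by case: (eqVneq y x) => _; [exact: measurable_id|exact: measurable_cst].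
Qed.

Lemma measurable_continuous_map (h : S -> S) : continuous h ->
  measurable_fun setT (h : borel S -> borel S).
Proof.
move=> /continuousP ch.
apply: (@measurability _ _ (borel S) (borel S) setT h (@open S)) => //.
move=> _ [A oA <-]; rewrite setTI; apply: sub_sigma_algebra; exact: ch.
Qed.

Definition site_map (h : Z2 -> S -> S) (phi : Z2 -> S) : Z2 -> S := fun x => h x (phi x).

Lemma measurable_site_map (h : Z2 -> S -> S) : (forall x, continuous (h x)) ->
  measurable_fun setT (site_map h : config S -> config S).
Proof.
move=> ch; apply: measurable_to_config => x.
exact: (measurableT_comp (measurable_continuous_map (ch x)) (measurable_coord x)).
Qed.

Lemma update_site_map (h : Z2 -> S -> S) phi x s :
  site_map h (update phi x s) = update (site_map h phi) x (h x s).
Proof. by apply/funext => y; rewrite /site_map /update; case: eqP => [->|]. Qed.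

End Configurations.

Section IntegrateSites.
Variables (R : realType) (S : ptopologicalType).
Variable lambda : {finite_measure set (borel S) -> \bar R}.
Implicit Types (f g : (Z2 -> S) -> \bar R) (W : seq Z2).
Local Open Scope ereal_scope.

Local Notation mfun f := (measurable_fun [set: config S] (f : config S -> \bar R)).
Local Notation I W f := (integrate_sites lambda W f).

Lemma integrate_sites_ge0 W f eta : (forall phi, 0 <= f phi) -> 0 <= I W f eta.
Proof.
move=> f0; elim: W eta => [|x W ih] eta /=; first exact: f0.
by apply: integral_ge0 => s _; exact: ih.
Qed.

Lemma measurable_integrate_sites W f : (forall phi, 0 <= f phi) -> mfun f ->
  mfun (I W f).
Proof.
move=> f0 mf; elim: W => [//|x W ih] /=.
apply: (@measurable_fun_fubini_tonelli_F _ _ (config S) (borel S) R lambda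
  (fun p => I W f (update p.1 x p.2))) => //.
- exact: measurableT_comp ih (measurable_update x).
- by move=> p; exact: integrate_sites_ge0.
Qed.

Let measurable_section W f x eta : (forall phi, 0 <= f phi) -> mfun f ->
  measurable_fun [set: borel S] (fun s => I W f (update eta x s)).
Proof.
move=> f0 mf; have := measurable_integrate_sites W f0 mf => mI.
exact: (measurableT_comp mI (measurable_update_site eta x)).
Qed.

Lemma integrate_sitesD W f g eta : (forall phi, 0 <= f phi) -> (forall phi, 0 <= g phi) ->
  mfun f -> mfun g -> I W (fun phi => f phi + g phi) eta = I W f eta + I W g eta.
Proof.
move=> f0 g0 mf mg; elim: W eta => [//|x W ih] eta /=.
under eq_integral do rewrite ih.
by apply: ge0_integralD => //; do ?[by move=> s _; exact: integrate_sites_ge0|exact: measurable_section].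
Qed.

Lemma integrate_sitesZ W (c : R) f eta : (0 <= c)%R -> (forall phi, 0 <= f phi) ->
  mfun f -> I W (fun phi => c%:E * f phi) eta = c%:E * I W f eta.
Proof.
move=> c0 f0 mf; elim: W eta => [//|x W ih] eta /=.
under eq_integral do rewrite ih.
by apply: ge0_integralZl_EFin => //; do ?[by move=> s _; exact: integrate_sites_ge0|exact: measurable_section].
Qed.

Lemma integrate_sites_sum W (K : finType) (P : pred K) (f : K -> (Z2 -> S) -> \bar R) eta :
  (forall k phi, 0 <= f k phi) -> (forall k, mfun (f k)) ->
  I W (fun phi => \sum_(k | P k) f k phi) eta = \sum_(k | P k) I W (f k) eta.
Proof.
move=> f0 mf; elim: W eta => [//|x W ih] eta /=.
under eq_integral do rewrite ih.
rewrite -[in RHS]big_filter -ge0_integral_sum//.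
- by apply: eq_integral => s _; rewrite big_filter.
- by move=> k; exact: measurable_section.
- by move=> k s _; exact: integrate_sites_ge0.
Qed.

Lemma le_integrate_sites W f g eta : (forall phi, 0 <= f phi) ->
  mfun f -> mfun g -> (forall phi, f phi <= g phi) -> I W f eta <= I W g eta.
Proof.
move=> f0 mf mg fg; have g0 phi : 0 <= g phi by apply: le_trans (fg phi).
elim: W eta => [//|x W ih] eta /=.
apply: ge0_le_integral => //; do ?[by move=> s _; exact: integrate_sites_ge0|exact: measurable_section].
Qed.

Lemma integrate_sites_cst W (c : R) eta : (0 <= c)%R ->
  I W (fun=> c%:E) eta < +oo.
Proof.
move=> c0.
suff -> : I W (fun=> c%:E) eta = (c * fine (lambda setT) ^+ size W)%:E by exact: ltry.
elim: W eta => [|x W ih] eta /=; first by rewrite expr0 mulr1.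
under eq_integral do rewrite ih.
have lfin : lambda setT \is a fin_num by exact: fin_num_measure.
rewrite (@integral_cst _ _ _ lambda)//.
transitivity ((c * fine (lambda setT) ^+ size W)%:E * (fine (lambda setT))%:E).
  by congr (_ * _); rewrite fineK.
by rewrite -EFinM; congr (_%:E); rewrite exprSr mulrA.
Qed.

Lemma integrate_sites_off W f eta eta' :
  (forall x, x \notin W -> eta x = eta' x) -> I W f eta = I W f eta'.
Proof.
elim: W eta eta' => [|x W ih] eta eta' ee /=.
  by congr f; apply/funext => x; exact: ee.
apply: eq_integral => s _; apply: ih => y yW; rewrite /update.
by case: eqVneq => // yx; apply: ee; rewrite inE negb_or yx.
Qed.

(** Invariance of the free measure, one site after the other; the sites outside W
    keep their rotated values as boundary condition. *)
Lemma integrate_sites_map W (h : Z2 -> S -> S) f eta :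
  (forall x, continuous (h x)) ->
  (forall x (A : set (borel S)), measurable A -> lambda (h x @^-1` A) = lambda A) ->
  (forall phi, 0 <= f phi) -> mfun f ->
  I W (fun phi => f (site_map h phi)) eta = I W f (site_map h eta).
Proof.
move=> ch hl f0 mf; elim: W eta => [//|x W ih] eta /=.
under eq_integral do rewrite ih update_site_map.
have mh := measurable_continuous_map (ch x).
pose F (s : borel S) := I W f (update (site_map h eta) x s).
have F0 s : 0 <= F s by exact: integrate_sites_ge0.
have mF : measurable_fun setT F by exact: measurable_section.
have := @ge0_integral_pushforward _ _ _ _ R _ mh lambda setT F measurableT mF (fun s _ => F0 s).
rewrite preimage_setT => <-.
by apply: eq_measure_integral => A mA _; exact: hl.
Qed.

End IntegrateSites.

(** * Continuous interactions on a compact space *)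

(** Registers the product as a pointed topological space, as needed to speak of
    compact subsets of S * S. *)
HB.instance Definition _ (S T : ptopologicalType) := Topological.on (S * T)%type.

Section CompactInteraction.
Variables (R : realType) (S : ptopologicalType) (U : S -> S -> R).
Hypothesis compactS : compact [set: S].
Hypothesis U_continuous : continuous (fun p : S * S => U p.1 p.2).

Let compactSS : compact [set: S * S].
Proof. by rewrite -setXTT; exact: compact_setX. Qed.

Lemma interaction_bounded : exists B : R, 0 <= B /\ forall s t, `|U s t| <= B.
Proof.
have : compact [set U p.1 p.2 | p in [set: S * S]].
  by apply: continuous_compact => //; exact: continuous_subspaceT.
move=> /compact_bounded[M [_ MP]]; exists (Num.max (M + 1) 0).
split=> [|s t]; first by rewrite le_max lexx orbT.
have := MP (M + 1); rewrite ltrDl ltr01 => /(_ isT (U s t)) UM.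
by rewrite le_max UM//; exists (s, t).
Qed.

(** Superlevel sets of U are countable unions of open rectangles, by compactness of
    the sets U >= a + 1/k.  This is what makes U measurable for the product of the
    Borel sigma-algebras, which may be smaller than the Borel sigma-algebra of
    S * S when S has no countable base. *)
Lemma interaction_rectangles (a : R) :
  exists (n : nat -> {fset S * S}) (O1 O2 : S * S -> set S),
  [/\ forall p, open (O1 p), forall p, open (O2 p) &
      [set p | a < U p.1 p.2] = \bigcup_k \bigcup_(p in [set` n k]) (O1 p `*` O2 p)].
Proof.
have [ Q QP] : exists Q : S * S -> set S * set S, forall p,
    [/\ open (Q p).1, open (Q p).2 & 
     (Q p).1 `*` (Q p).2 `<=` [set q | a < U q.1 q.2] /\
     (a < U p.1 p.2 -> ((Q p).1 `*` (Q p).2) p)].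
  suff : forall p : S * S, exists o : set S * set S, [/\ open o.1, open o.2 & 
     o.1 `*` o.2 `<=` [set q | a < U q.1 q.2] /\ (a < U p.1 p.2 -> (o.1 `*` o.2) p)].
    by move=> /choice[ Q QP]; exists Q.
  move=> p; have [ap|pa] := ltP a (U p.1 p.2); last first.
    by exists (set0, set0); split => /=; [exact: open0|exact: open0|split => // q []].
  have : nbhs p [set q | a < U q.1 q.2].
    have Uc : (fun p : S * S => U p.1 p.2) @ p --> U p.1 p.2 by exact: U_continuous.
    by apply: (Uc [set r | a < r]); apply: open_nbhs_nbhs; split; [exact: open_gt|].
  move=> [[N1 N2] /= [n1 n2] sub]; exists (interior N1, interior N2).
  split=> /=; [exact: open_interior|exact: open_interior|split=> [q [q1 q2]|_]].
    by apply: sub; split; exact: interior_subset.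
  by split.
have cov k : exists F : {fset S * S},
    [set p | a + k.+1%:R^-1 <= U p.1 p.2] `<=` \bigcup_(p in [set` F]) ((Q p).1 `*` (Q p).2).
  have : compact [set p | a + k.+1%:R^-1 <= U p.1 p.2].
    apply: (subclosed_compact _ compactSS) => //.
    have := @closed_ge R (a + k.+1%:R^-1); by apply: closed_comp => p _; exact: U_continuous.
  rewrite (@compact_cover (S * S)%type) => /(_ _ setT (fun p : S * S => (Q p).1 `*` (Q p).2)).
  case=> [p _|p /= ap|F _ sub]; last by exists F.
  - have [op1 op2 _] := QP p; rewrite openE => q [q1 q2].
    exists ((Q p).1, (Q p).2); last by move=> z [].
    by split => /=; apply: open_nbhs_nbhs.
  - exists p => //; have [_ _ [_ Qp]] := QP p; apply: Qp.
    by apply: lt_le_trans ap; rewrite ltrDl invr_gt0.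
have [n nP] := choice cov.
exists n, (fun p => (Q p).1), (fun p => (Q p).2); split.
- by move=> p; have [] := QP p.
- by move=> p; have [] := QP p.
apply/seteqP; split => [p /= ap|q [k _ [p _ qp]]]; last first.
  by have [_ _ [sub _]] := QP p; exact: sub.
have [k kP] : exists k, k.+1%:R^-1 < U p.1 p.2 - a.
  exists (Num.truncn (U p.1 p.2 - a)^-1).
  by rewrite invf_plt ?posrE ?subr_gt0// truncnS_gt.
by exists k => //; apply: nP; rewrite /= -lerBrDl ltW.
Qed.

Lemma measurable_interaction d (T : measurableType d) (f g : T -> borel S) :
  measurable_fun setT f -> measurable_fun setT g ->
  measurable_fun setT (fun t => U (f t) (g t)).
Proof.
move=> mf mg _.
apply: (measurability _ (RGenOInfty.measurableE R)) => //.
move=> _ [_ [a ->] <-]; rewrite setTI.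
have [n [ O1 [ O2 [op1 op2 E]]]] := interaction_rectangles a.
rewrite (_ : _ @^-1` _ = \bigcup_k \bigcup_(p in [set` n k]) (f @^-1` O1 p `&` g @^-1` O2 p)).
  apply: bigcupT_measurable => k; apply: fin_bigcup_measurable => // p _.
  have mO (O : set S) : open O -> measurable (O : set (borel S)).
    by move=> oO; exact: sub_sigma_algebra.
  by apply: measurableI; rewrite -[X in measurable X]setTI; [apply: mf|apply: mg] => //; exact: mO.
apply/seteqP; split => [t|t [k _ [p kp [t1 t2]]]] /=.
  rewrite in_itv/= andbT => at_; have : [set p | a < U p.1 p.2] (f t, g t) by [].
  by rewrite E => -[k _ [p kp [/= t1 t2]]]; exists k => //; exists p.
rewrite in_itv/= andbT.
suff : [set p | a < U p.1 p.2] (f t, g t) by [].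
by rewrite E; exists k => //; exists p.
Qed.

(** Uniform continuity: continuity at the identity for each pair of spins, made
    uniform by compactness of S * S. *)
Lemma interaction_modulus (G : preTopologicalGroupType) (act : G -> S -> S) (e : R) :
  continuous_action act -> 0 < e ->
  nbhs (1%g : G) [set g | forall s t, `|U (act g s) t - U s t| <= e].
Proof.
move=> [act1 _ actC] e0.
have /compact_near_coveringP := compactSS.
move=> /(_ G (nbhs (1%g : G)) (fun g p => `|U (act g p.1) p.2 - U p.1 p.2| <= e)).
have FF : Filter (nbhs (1%g : G)) by exact: nbhs_filter.
move=> /(_ FF) cover.
suff : \forall g \near (1%g : G), [set: S * S] `<=` (fun p => `|U (act g p.1) p.2 - U p.1 p.2| <= e).
  by apply: filterS => g h s t; exact: (h (s, t)).
apply: cover => -[s t] _.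
have c1 : (fun z : (S * S) * G => U (act z.2 z.1.1) z.1.2) @ ((s, t), 1%g : G) --> U s t.
  have Uc : (fun p : S * S => U p.1 p.2) @ (s, t) --> U s t := @U_continuous (s, t).
  have ac0 : (fun p : G * S => act p.1 p.2) @ (1%g : G, s) --> s.
    by have := actC (1%g, s); rewrite /continuous_at /= act1.
  have ac : (fun z : (S * S) * G => act z.2 z.1.1) @ ((s, t), 1%g : G) --> s.
    apply: (cvg_comp (fun z : (S * S) * G => (z.2, z.1.1)) _ _ ac0).
    apply: cvg_pair; first exact: cvg_snd.
    exact: cvg_comp cvg_fst cvg_fst.
  apply: (cvg_comp (fun z : (S * S) * G => (act z.2 z.1.1, z.1.2)) _ _ Uc).
  apply: cvg_pair => //.
  exact: cvg_comp cvg_fst cvg_snd.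
have c2 : (fun z : (S * S) * G => U z.1.1 z.1.2) @ ((s, t), 1%g : G) --> U s t.
  have Uc : (fun p : S * S => U p.1 p.2) @ (s, t) --> U s t := @U_continuous (s, t).
  exact: cvg_comp cvg_fst Uc.
have c12 := @cvgB _ _ _ _ (nbhs_filter ((s, t), 1%g : G)) _ _ _ _ c1 c2; rewrite subrr in c12.
move/cvgr0Pnorm_le : c12 => /(_ e e0).
done.
Qed.

End CompactInteraction.

(** * The Hamiltonian as a limit of finite sums *)

Lemma esum_tail (R : realType) (I : choiceType) (D : set I) (a : I -> \bar R)
    (Y : {fset I}) (k : R) :
  (forall i, D i -> 0 <= a i)%E -> (\esum_(i in D) a i < +oo)%E ->
  [set` Y] `<=` D -> 0 < k ->
  exists X : {fset I}, [/\ (Y `<=` X)%fset, [set` X] `<=` D &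
    (\esum_(i in D `&` ~` [set` X]) a i <= k%:E)%E].
Proof.
move=> a0 afin YD k0.
have E0 := esum_ge0 a0.
have Efin : \esum_(i in D) a i \is a fin_num by rewrite ge0_fin_numE.
have : (\esum_(i in D) a i - k%:E < \esum_(i in D) a i)%E.
  by rewrite lteBlDr// lteDl// lte_fin.
move=> /ereal_sup_gt[_ [Z [finZ ZD] <-]]; rewrite fsbig_finite// => lt.
pose X := (Y `|` fset_set Z)%fset.
have XD : [set` X] `<=` D.
  move=> i /=; rewrite inE => /orP[iY|]; first exact: YD.
  by rewrite in_fset_set// inE => /ZD.
exists X; split => //; first exact: fsubsetUl.
have split_sum := @esumID _ _ [set` X] D a a0.
move: split_sum; rewrite (setIidr XD).
have XE : \esum_(i in [set` X]) a i = (\sum_(i <- X) a i)%E.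
  rewrite esum_fset//; last by move=> i; rewrite inE => /XD/a0.
  by rewrite fsbig_finite//= set_fsetK.
have ZX : (\sum_(i <- fset_set Z) a i <= \esum_(i in [set` X]) a i)%E.
  apply: esum_ge; exists Z; last by rewrite fsbig_finite.
  by split => // i Zi /=; rewrite inE in_fset_set// mem_set// orbT.
have X0 : (0 <= \esum_(i in [set` X]) a i)%E by apply: esum_ge0 => i /XD/a0.
have T0 : (0 <= \esum_(i in D `&` ~` [set` X]) a i)%E by apply: esum_ge0 => i [/a0].
move: ZX lt Efin X0 T0.
case: (\esum_(i in D) a i) => [s||]//; case: (\esum_(i in [set` X]) a i) => [x||]//;
  case: (\esum_(i in D `&` ~` [set` X]) a i) => [t||]//; case: (\sum_(i <- fset_set Z) a i)%E => [z||]//.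
rewrite -EFinB lte_fin !lee_fin => ? ? _ ? ? [?]; lra.
Qed.

Section Hamiltonian.
Variables (R : realType) (S : ptopologicalType) (J : Z2 -> R) (U : S -> S -> R).
Hypothesis J_sum :
  (\esum_(x in [set z : Z2 | z != 0%R]) `|J x|%:E = 1)%E.
Variable B : R.
Hypothesis B0 : 0 <= B.
Hypothesis U_le : forall s t, `|U s t| <= B.

Let a (p : Z2 * Z2) : \bar R := `|J (p.1 - p.2)|%:E.

Let a0 p : (0 <= a p)%E. Proof. by rewrite lee_fin. Qed.

Let energy (phi : Z2 -> S) (p : Z2 * Z2) : R := J (p.1 - p.2) * U (phi p.1) (phi p.2).

Let energy_le phi p : `|energy phi p| <= B * `|J (p.1 - p.2)|.
Proof. by rewrite normrM mulrC ler_wpM2r. Qed.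

Lemma touching_sum_fin (W : {fset Z2}) : (\esum_(p in touching_pairs W) a p < +oo)%E.
Proof.
apply: (@le_lt_trans _ _ (2 * #|` W|)%:R%:E%E); last exact: ltry.
rewrite -(touching_mass J_sum) esum_mkcond; apply: le_esum => -[x y] _ /=.
case: ifPn => [|_]; last by rewrite lee_fin mulr_ge0// step_proba_ge0.
rewrite inE /touching_pairs /= => -[xy /orP xyW].
rewrite lee_fin /step_proba (negbTE xy) ler_peMl// -natrD ler1n addn_gt0.
by case/orP: xyW => ->; rewrite ?orbT.
Qed.

(** The bound on the error does not depend on the configuration, since |U| <= B. *)
Lemma hamiltonian_approx (W : {fset Z2}) (Y : {fset Z2 * Z2}) (k : R) : 0 < k ->
  [set` Y] `<=` touching_pairs W ->
  exists X : {fset Z2 * Z2}, [/\ (Y `<=` X)%fset, [set` X] `<=` touching_pairs W &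
    forall phi, `|hamiltonian J U W phi - \sum_(p <- X) energy phi p| <= B * k].
Proof.
move=> k0 YW; have [X [YX XW tail]] := esum_tail (fun p _ => a0 p) (touching_sum_fin W) YW k0.
exists X; split => // phi.
have part (f : Z2 * Z2 -> \bar R) : (forall p, 0 <= f p)%E -> (forall p, f p <= B%:E * a p)%E ->
  exists2 t, 0 <= t <= B * k & \esum_(p in touching_pairs W) f p = ((\sum_(p <- X) fine (f p)) + t)%:E.
  move=> f0 fa.
  have ffin p : f p \is a fin_num.
    by rewrite ge0_fin_numE//; apply: le_lt_trans (fa p) _; rewrite -EFinM ltry.
  have tf : (\esum_(p in touching_pairs W `&` ~` [set` X]) f p <= (B * k)%:E)%E.
    apply: (@le_trans _ _ (B%:E * \esum_(p in touching_pairs W `&` ~` [set` X]) a p)%E).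
      by rewrite -esumZl//; apply: le_esum.
    by rewrite EFinM lee_wpmul2l// lee_fin.
  have t0 : (0 <= \esum_(p in touching_pairs W `&` ~` [set` X]) f p)%E by exact: esum_ge0.
  exists (fine (\esum_(p in touching_pairs W `&` ~` [set` X]) f p)).
    by move: t0 tf; case: (\esum_(p in _) f p) => [t||]//=; rewrite !lee_fin => -> ->.
  rewrite (@esumID _ _ [set` X] _ f)// (setIidr XW) EFinD fineK; last first.
    by rewrite ge0_fin_numE//; apply: le_lt_trans tf _; rewrite ltry.
  congr (_ + _)%E; rewrite esum_fset//.
  by rewrite fsbig_finite//= set_fsetK -sumEFin; apply: eq_bigr => p _; rewrite fineK.
have pe p : (pair_energy J U phi)^\+%E p = (Num.max (energy phi p) 0)%:E.
  by rewrite funeposE /pair_energy -EFin_max.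
have ne p : (pair_energy J U phi)^\-%E p = (Num.max (- energy phi p) 0)%:E.
  by rewrite funenegE /pair_energy -EFinN -EFin_max.
have [tp tp_le tpE] : exists2 t, 0 <= t <= B * k &
    \esum_(p in touching_pairs W) (pair_energy J U phi)^\+%E p =
    ((\sum_(p <- X) fine ((pair_energy J U phi)^\+%E p)) + t)%:E.
  apply: part => p; rewrite pe; first by rewrite lee_fin le_max lexx orbT.
  rewrite /a -EFinM lee_fin ge_max mulr_ge0// andbT.
  by apply: le_trans (energy_le phi p); exact: ler_norm.
have [tn tn_le tnE] : exists2 t, 0 <= t <= B * k &
    \esum_(p in touching_pairs W) (pair_energy J U phi)^\-%E p =
    ((\sum_(p <- X) fine ((pair_energy J U phi)^\-%E p)) + t)%:E.
  apply: part => p; rewrite ne; first by rewrite lee_fin le_max lexx orbT.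
  rewrite /a -EFinM lee_fin ge_max mulr_ge0// andbT.
  by apply: le_trans (energy_le phi p); rewrite -normrN ler_norm.
rewrite /hamiltonian tpE tnE -EFinB /=.
have -> : \sum_(p <- X) energy phi p =
    \sum_(p <- X) fine ((pair_energy J U phi)^\+%E p) - \sum_(p <- X) fine ((pair_energy J U phi)^\-%E p).
  rewrite -sumrB; apply: eq_bigr => p _; rewrite pe ne /=.
  by case: (leP (energy phi p) 0) => ?; case: (leP (- energy phi p) 0) => ?; lra.
by rewrite ler_norml; move: tp_le tn_le => /andP[? ?] /andP[? ?]; apply/andP; split; lra.
Qed.

(** The part of the Hamiltonian which involves spins of W only, a finite sum. *)
Definition inner_energy (W : {fset Z2}) (phi : Z2 -> S) : R :=
  \sum_(e : W * W) (if val e.1 == val e.2 then 0 else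
     J (val e.1 - val e.2) * U (phi (val e.1)) (phi (val e.2))).

(** The pairs whose energy may change when the spins in L are rotated, and that are
    not accounted for by [inner_energy]. *)
Definition boundary_pairs (L W : {fset Z2}) : set (Z2 * Z2) :=
  [set p | p.1 != p.2 /\ ((p.1 \in L /\ p.2 \notin W) \/ (p.2 \in L /\ p.1 \notin W))].

(** Pairs avoiding L have the same energy in both configurations, and the pairs that
    meet L and leave W have small total coupling. *)
Lemma hamiltonian_change (L W : {fset Z2}) (k : R) phi phi' :
  (L `<=` W)%fset ->
  (\esum_(p in boundary_pairs L W) `|J (p.1 - p.2)|%:E <= k%:E)%E ->
  (forall x, x \notin L -> phi x = phi' x) ->
  `|(hamiltonian J U W phi' - hamiltonian J U W phi) -
    (inner_energy W phi' - inner_energy W phi)| <= 2 * B * k.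
Proof.
move=> LW bk pp'; apply/ler_addgt0Pr => e e0.
(* The pairs inside W, all of which the finite set X below is made to contain. *)
pose Y := [fset (val e.1, val e.2) | e : W * W & val e.1 != val e.2]%fset.
have YW : [set` Y] `<=` touching_pairs W.
  move=> p /= /imfsetP[[u v]] /=; rewrite inE /= => uv ->; split => //=.
  by left; exact: valP.
have k10 : 0 < e / (2 * (B + 1)) by rewrite divr_gt0// mulr_gt0// ltr_wpDl.
have [X [YX XW HX]] := hamiltonian_approx k10 YW.
have innerE psi : inner_energy W psi = \sum_(p <- X | p \in Y) energy psi p.
  transitivity (\sum_(p <- Y) energy psi p).
    rewrite big_imfset/=; last by move=> [u v] [u' v'] _ _ /= [/val_inj -> /val_inj ->].
    rewrite big_filter big_enum_cond /inner_energy [RHS]big_mkcond /=.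
    by apply: eq_bigr => e' _; case: eqVneq.
  rewrite -[RHS]big_filter; apply: perm_big; apply: uniq_perm => [||p].
  - exact: fset_uniq.
  - by rewrite filter_uniq// fset_uniq.
  - rewrite mem_filter; case: (boolP (p \in Y)) => //= pY.
    by apply/esym; exact: (fsubsetP YX).
pose out psi := \sum_(p <- X | p \notin Y) energy psi p.
have outer : `|out phi' - out phi| <= 2 * B * k.
  rewrite -sumrB; apply: le_trans (ler_norm_sum _ _ _) _.
  apply: (@le_trans _ _ (2 * B * \sum_(p <- X) (if p \in boundary_pairs L W then `|J (p.1 - p.2)| else 0))).
    rewrite big_mkcond mulr_sumr big_seq [leRHS]big_seq; apply: ler_sum => p pX.
    case: ifPn => pY; last by rewrite mulr_ge0// ?mulr_ge0//; case: ifP.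
    case: ifPn => [_|pbd].
      apply: le_trans (ler_normB _ _) _.
      have := energy_le phi p; have := energy_le phi' p; lra.
    have [p12 pW] := XW _ pX.
    have pp1 x : x \notin L -> phi' x = phi x by move=> xL; rewrite pp'.
    have [p1L p2L] : p.1 \notin L /\ p.2 \notin L.
      have notboth : ~ (p.1 \in W /\ p.2 \in W).
        move=> [p1W p2W]; move/negP : pY; apply; apply/imfsetP.
        by exists ([` p1W]%fset, [` p2W]%fset) => //=; case: (p).
      split; apply/negP => pL; move/negP: pbd; apply; rewrite inE; split => //.
        by left; split => //; apply/negP => p2W; apply: notboth; rewrite (fsubsetP LW).
      by right; split => //; apply/negP => p1W; apply: notboth; rewrite (fsubsetP LW p.2).
    by rewrite /energy !pp1// subrr normr0 mulr0.
  rewrite ler_wpM2l ?mulr_ge0// -lee_fin; apply: le_trans bk.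
  rewrite esum_mkcond -sumEFin; apply: esum_ge; exists [set` X].
    by split => //; exact: finite_fset.
  rewrite fsbig_finite//= set_fsetK; apply: lee_sum => p _.
  by case: ifP.
have Be : B * (e / (2 * (B + 1))) <= e / 2.
  have B1 : 0 < B + 1 by rewrite ltr_wpDl.
  have -> : B * (e / (2 * (B + 1))) = e / 2 * (B / (B + 1)).
    by field; rewrite gt_eqF.
  by rewrite ler_piMr ?divr_ge0 ?(ltW e0)// ler_pdivrMr// mul1r lerDl.
have splitE psi : \sum_(p <- X) energy psi p = inner_energy W psi + out psi.
  by rewrite innerE (bigID (fun p => p \in Y)).
have := HX phi; have := HX phi'; move: outer; rewrite !splitE.
rewrite !ler_norml => /andP[? ?] /andP[? ?] /andP[? ?]; apply/andP; split; lra.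
Qed.

End Hamiltonian.

(** * Measurability and bounds for the Boltzmann factor *)

Section HamiltonianBounds.
Variables (R : realType) (S : ptopologicalType) (J : Z2 -> R) (U : S -> S -> R).
Hypothesis J_sum :
  (\esum_(x in [set z : Z2 | z != 0%R]) `|J x|%:E = 1)%E.
Hypothesis compactS : compact [set: S].
Hypothesis U_continuous : continuous (fun p : S * S => U p.1 p.2).
Variable B : R.
Hypothesis B0 : 0 <= B.
Hypothesis U_le : forall s t, `|U s t| <= B.

(** The couplings touching L are summable; let W contain the sites of all but a
    tail of them. *)
Lemma small_boundary (L L0 : {fset Z2}) (k : R) : 0 < k ->
  exists W : {fset Z2}, [/\ (L `<=` W)%fset, (L0 `<=` W)%fset &
    (\esum_(p in boundary_pairs L W) `|J (p.1 - p.2)|%:E <= k%:E)%E].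
Proof.
move=> k0; have sub0 : [set` (fset0 : {fset Z2 * Z2})] `<=` touching_pairs L by [].
have [|X [_ XL tail]] := @esum_tail R _ (touching_pairs L) (fun p => `|J (p.1 - p.2)|%:E) fset0 k
   _ (touching_sum_fin J_sum L) sub0 k0; first by move=> p _; rewrite lee_fin.
exists (L `|` L0 `|` [fset p.1 | p in X] `|` [fset p.2 | p in X])%fset; split.
- by apply/fsubsetP => x xL; rewrite !inE xL.
- by apply/fsubsetP => x xL; rewrite !inE xL orbT.
apply: le_trans tail.
rewrite [leLHS]esum_mkcond [leRHS]esum_mkcond; apply: le_esum => p _.
case: ifPn => [|_]; last by case: ifP => //; rewrite lee_fin.
rewrite inE => -[p12 pLW]; rewrite mem_set//; split.
  by split => //; case: pLW => -[pL _]; [left|right].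
move=> /= pX; case: pLW => -[_]; rewrite !inE !negb_or => /andP[/andP[_ n1] n2].
- by move/negP: n2; apply; apply/imfsetP; exists p.
- by move/negP: n1; apply; apply/imfsetP; exists p.
Qed.

Lemma measurable_pair (x y : Z2) :
  measurable_fun setT (fun phi : config S => U ((phi : Z2 -> S) x) ((phi : Z2 -> S) y)).
Proof.
by apply: (measurable_interaction compactS U_continuous); exact: measurable_coord.
Qed.

(** A uniform limit of finite sums of measurable functions. *)
Lemma measurable_hamiltonian (W : {fset Z2}) :
  measurable_fun setT (hamiltonian J U W : config S -> R).
Proof.
have sub0 : [set` (fset0 : {fset Z2 * Z2})] `<=` touching_pairs W by [].
have /choice[X XP] : forall n, exists X : {fset Z2 * Z2}, forall phi,
    `|hamiltonian J U W phi - \sum_(p <- X) J (p.1 - p.2) * U (phi p.1) (phi p.2)| <= B * n.+1%:R^-1.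
  move=> n; have n0 : 0 < n.+1%:R^-1 :> R by rewrite invr_gt0.
  by have [X [_ _ XP]] := hamiltonian_approx J_sum B0 U_le n0 sub0; exists X.
apply: (@measurable_fun_cvg _ (config S) R setT
  (fun n (phi : config S) => \sum_(p <- X n) J (p.1 - p.2) * U ((phi : Z2 -> S) p.1) ((phi : Z2 -> S) p.2))).
  move=> n; apply: measurable_sum => p.
  by apply: measurable_funM; [exact: measurable_cst|exact: measurable_pair].
move=> phi _; apply/cvgrPdist_le => e e0.
have : (fun n => B * (n.+1%:R : R)^-1) @ \oo --> B * 0.
  by apply: cvgMl_tmp; exact: cvg_harmonic.
rewrite mulr0 => /cvgrPdist_le/(_ e e0); apply: filterS => n.
rewrite sub0r normrN ger0_norm ?mulr_ge0// => le.
exact: le_trans (XP n phi) le.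
Qed.

Lemma hamiltonian_bounded (W : {fset Z2}) : exists C, forall phi, `|hamiltonian J U W phi| <= C.
Proof.
have sub0 : [set` (fset0 : {fset Z2 * Z2})] `<=` touching_pairs W by [].
have [X [_ _ XP]] := hamiltonian_approx J_sum B0 U_le ltr01 sub0.
exists (B * 1 + \sum_(p <- X) `|J (p.1 - p.2)| * B) => phi.
rewrite -[hamiltonian J U W phi](subrK (\sum_(p <- X) J (p.1 - p.2) * U (phi p.1) (phi p.2))).
apply: le_trans (ler_normD _ _) _; apply: lerD; first exact: XP.
apply: le_trans (ler_norm_sum _ _ _) _; apply: ler_sum => p _.
by rewrite normrM ler_wpM2l.
Qed.

Lemma measurable_boltzmann (W : {fset Z2}) :
  measurable_fun setT (boltzmann J U W : config S -> R).
Proof.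
apply: measurableT_comp; first exact: measurable_expR.
by apply: measurable_funN; exact: measurable_hamiltonian.
Qed.

Lemma boltzmann_bounded (W : {fset Z2}) : exists2 C, 0 <= C & forall phi, boltzmann J U W phi <= C.
Proof.
have [C HC] := hamiltonian_bounded W; exists (expR C); first exact: expR_ge0.
move=> phi; rewrite /boltzmann ler_expR; apply: le_trans (HC phi).
by rewrite -normrN ler_norm.
Qed.

End HamiltonianBounds.

(** * Smoothing the interaction along a rotation *)

Section Smoothing.
Variables (R : realType) (S : Type) (U : S -> S -> R) (rot : int -> S -> S).
Hypothesis rot0 : forall s, rot 0 s = s.
Hypothesis rotD : forall k l s, rot (k + l) s = rot k (rot l s).
Hypothesis U_rot : forall k s t, U (rot k s) (rot k t) = U s t.
Variable B : R.
Hypothesis U_le : forall s t, `|U s t| <= B.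
Variable K : nat.
Hypothesis K0 : (0 < K)%N.

(** The average of U over relative rotations i - j with 0 <= i, j < K. *)
Definition smoothed (s t : S) : R :=
  (K%:R ^+ 2)^-1 * triangle K (fun k => U (rot k s) t) 0.

Let K2 : 0 < K%:R ^+ 2 :> R. Proof. by rewrite exprn_gt0// ltr0n. Qed.

Let U_rot2 k l s t : U (rot k s) (rot l t) = U (rot (k - l) s) t.
Proof. by rewrite -[RHS](U_rot l) -rotD addrCA subrr addr0. Qed.

Lemma smoothed_rot k l s t : smoothed (rot k s) (rot l t) =
  (K%:R ^+ 2)^-1 * triangle K (fun i => U (rot i s) t) (k - l).
Proof.
rewrite /smoothed /triangle; congr (_ * _); apply: eq_bigr => i _; apply: eq_bigr => j _.
by rewrite -rotD U_rot2; congr (U (rot _ _) _); ring.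
Qed.

Lemma smoothed_inv k s t : smoothed (rot k s) (rot k t) = smoothed s t.
Proof. by rewrite smoothed_rot subrr. Qed.

Lemma smoothed_near (e : R) s t : (forall k, (`|k| < K)%N -> `|U (rot k s) t - U s t| <= e) ->
  `|smoothed s t - U s t| <= e.
Proof.
move=> Ue.
have -> : smoothed s t - U s t = (K%:R ^+ 2)^-1 *
    \sum_(i < K) \sum_(j < K) (U (rot (i%:Z - j%:Z) s) t - U s t).
  under [X in _ = _ * X]eq_bigr do rewrite sumrB sumr_const card_ord.
  rewrite sumrB sumr_const card_ord mulrBr /smoothed /triangle; congr (_ - _).
  by rewrite -mulrnA -[X in _ * X]mulr_natl mulrA natrM -expr2 mulVf ?mul1r// gt_eqF.
rewrite normrM ger0_norm ?invr_ge0 ?(ltW K2)// ler_pdivrMl//.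
apply: le_trans (ler_norm_sum _ _ _) _.
apply: (@le_trans _ _ (\sum_(i < K) K%:R * e)); last first.
  by rewrite sumr_const card_ord -[leLHS]mulr_natl mulrA expr2.
apply: ler_sum => i _; apply: le_trans (ler_norm_sum _ _ _) _.
apply: (@le_trans _ _ (\sum_(j < K) e)); last by rewrite sumr_const card_ord -[leLHS]mulr_natl.
apply: ler_sum => j _; apply: Ue.
by have := ltn_ord i; have := ltn_ord j; lia.
Qed.

(** Only the relative rotation matters, by invariance of U, so this is a second
    difference of step |k - l| of a triangular average. *)
Lemma smoothed_diff2 k l s t :
  `|smoothed (rot k s) (rot l t) + smoothed (rot (- k) s) (rot (- l) t) - 2 * smoothed s t|
   <= (4 * B / K%:R ^+ 2) * (k - l)%:~R ^+ 2.
Proof.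
pose f i := U (rot i s) t.
have -> : smoothed (rot k s) (rot l t) + smoothed (rot (- k) s) (rot (- l) t) - 2 * smoothed s t
   = (K%:R ^+ 2)^-1 * diff2 `|k - l| (triangle K f) 0.
  rewrite !smoothed_rot /smoothed -/f /diff2.
  have -> : - k - - l = - (k - l) by ring.
  rewrite add0r sub0r; case: (leP 0 (k - l)) => h.
    by rewrite !gez0_abs//; ring.
  by rewrite !ltz0_abs// opprK; ring.
rewrite normrM ger0_norm ?invr_ge0 ?(ltW K2)// ler_pdivrMl//.
have -> : K%:R ^+ 2 * (4 * B / K%:R ^+ 2 * (k - l)%:~R ^+ 2) = (k - l)%:~R ^+ 2 * (4 * B) :> R.
  by field; rewrite pnatr_eq0 -lt0n.
have := @diff2_triangle_le R `|k - l| K f B 0 (fun i => U_le _ _).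
move/le_trans; apply; rewrite le_eqVlt; apply/orP; left; apply/eqP.
rewrite natrX natr_absz intr_norm real_normK ?num_real//; ring.
Qed.

End Smoothing.

(** * Joint weights of spins and bonds *)

Section JointWeight.
Variables (R : realType) (S : ptopologicalType) (J : Z2 -> R) (U : S -> S -> R).
Hypothesis J_sum :
  (\esum_(x in [set z : Z2 | z != 0%R]) `|J x|%:E = 1)%E.
Variables (rot : int -> S -> S).
Hypothesis rot0 : forall s, rot 0 s = s.
Hypothesis rotD : forall k l s, rot (k + l) s = rot k (rot l s).
Hypothesis U_rot : forall k s t, U (rot k s) (rot k t) = U s t.
Variable B : R.
Hypothesis B0 : 0 <= B.
Hypothesis U_le : forall s t, `|U s t| <= B.
Variable K : nat.
Hypothesis K0 : (0 < K)%N.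
Hypothesis U_near : forall k s t, (`|k| < K)%N -> `|U (rot k s) t - U s t| <= 16^-1.
Variable W : {fset Z2}.

Local Notation p x y := (step_proba J x y).
Local Notation V := (smoothed U rot K).
Implicit Types (e : W * W) (phi : Z2 -> S) (A : {ffun W * W -> bool}).

Definition inner_coupling e : R :=
  if val e.1 == val e.2 then 0 else J (val e.1 - val e.2).

(** The first term measures the error of replacing U by its smoothing; the second
    one, which bounds it in absolute value, makes the total nonnegative. *)
Definition excess phi e : R :=
  inner_coupling e * (V (phi (val e.1)) (phi (val e.2)) - U (phi (val e.1)) (phi (val e.2)))
  + p (val e.1) (val e.2) * 16^-1.

(** Chosen so that a closed bond contributes the factor exp (- excess), which turns
    U into its smoothing inside the Boltzmann factor. *)
Definition bond_proba phi e : R := 1 - expR (- excess phi e).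

(** The Boltzmann factor is the marginal of this weight ([joint_weight_sum]). *)
Definition joint_weight A phi : R := boltzmann J U W phi * bond_weight (bond_proba phi) A.

Lemma inner_coupling_norm e : `|inner_coupling e| = p (val e.1) (val e.2).
Proof. by rewrite /inner_coupling /step_proba; case: ifP; rewrite ?normr0. Qed.

Lemma inner_energyE phi :
  inner_energy J U W phi = \sum_e inner_coupling e * U (phi (val e.1)) (phi (val e.2)).
Proof. by apply: eq_bigr => e _; rewrite /inner_coupling; case: ifP; rewrite ?mul0r. Qed.

(** |V - U| <= 1/16, and the width 1/8 of the interval keeps the percolation
    subcritical. *)
Lemma excess_itv phi e : 0 <= excess phi e <= p (val e.1) (val e.2) / 8.
Proof.
set s := phi (val e.1); set t := phi (val e.2).
have : `|inner_coupling e * (V s t - U s t)| <= p (val e.1) (val e.2) * 16^-1.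
  rewrite normrM inner_coupling_norm ler_wpM2l ?step_proba_ge0//.
  by apply: smoothed_near => // k; exact: U_near.
rewrite ler_norml /excess -/s -/t => /andP[? ?]; apply/andP; split; lra.
Qed.

Lemma bond_proba_itv phi e : 0 <= bond_proba phi e <= p (val e.1) (val e.2) / 8.
Proof.
have /andP[w0 w1] := excess_itv phi e; rewrite /bond_proba; apply/andP; split.
  by rewrite subr_ge0 -expR0 ler_expR oppr_le0.
by apply: le_trans w1; have := expR_ge1Dx (- excess phi e); lra.
Qed.

Lemma bond_proba01 phi e : 0 <= bond_proba phi e <= 1.
Proof.
have /andP[-> _] := bond_proba_itv phi e.
by rewrite /bond_proba gerBl expR_ge0.
Qed.

Lemma joint_weight_ge0 A phi : 0 <= joint_weight A phi.
Proof. by rewrite mulr_ge0 ?expR_ge0// bond_weight_ge0//; exact: bond_proba01. Qed.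

Lemma joint_weight_sum phi : \sum_A joint_weight A phi = boltzmann J U W phi.
Proof.
rewrite -mulr_sumr -[RHS]mulr1; congr (_ * _).
by rewrite -(bond_mean1 (bond_proba phi)); apply: eq_bigr => A _; rewrite mulr1.
Qed.

Let logw A phi : R := - hamiltonian J U W phi - \sum_(e | ~~ A e) excess phi e.
Let closedw A phi : R := \prod_(e | A e) bond_proba phi e.

Let joint_weightE A phi : joint_weight A phi = expR (logw A phi) * closedw A phi.
Proof.
rewrite /joint_weight /boltzmann /bond_weight (bigID (fun e => A e))/= mulrCA mulrC; congr (_ * _).
  rewrite /logw expRD -sumrN expR_sum; congr (_ * _).
  by apply: eq_bigr => e /negbTE ->; rewrite /bond_proba subKr.
by apply: eq_bigr => e ->.
Qed.

Definition twist (a : Z2 -> int) : (Z2 -> S) -> Z2 -> S := site_map (fun x => rot (a x)).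

Variables (L : {fset Z2}) (k : R).
Hypothesis LW : (L `<=` W)%fset.
Hypothesis bk : (\esum_(p in boundary_pairs L W) `|J (p.1 - p.2)|%:E <= k%:E)%E.

Variables (a : Z2 -> int).
Hypothesis aL : forall x, x \notin L -> a x = 0.

(** Let l be the logarithm of the joint weight without its open bonds, whose factors
    do not change since the angles agree along open bonds.  Then exp l' + exp l''
    >= exp l (2 + l' + l'' - 2 l), and l' + l'' - 2 l is, up to the boundary term, a
    sum of second differences of the smoothed interaction over closed bonds. *)
Lemma joint_weight_twist A phi :
  (forall e : W * W, A e -> a (val e.1) = a (val e.2)) ->
  2 * (1 - (2 * B * k + 2 * B / K%:R ^+ 2 *
       \sum_(e : W * W) p (val e.1) (val e.2) * (a (val e.1) - a (val e.2))%:~R ^+ 2)) * joint_weight A phi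
  <= joint_weight A (twist a phi) + joint_weight A (twist (fun x => - a x) phi).
Proof.
move=> Aa; set phi1 := twist a phi; set phi2 := twist _ phi.
have U_fix (b : Z2 -> int) e : b (val e.1) = b (val e.2) ->
    U (twist b phi (val e.1)) (twist b phi (val e.2)) = U (phi (val e.1)) (phi (val e.2)).
  by rewrite /twist /site_map => ->; rewrite U_rot.
have excess_fix (b : Z2 -> int) e : b (val e.1) = b (val e.2) -> excess (twist b phi) e = excess phi e.
  move=> be; rewrite /excess U_fix// /twist /site_map be smoothed_inv//.
have closed1 : closedw A phi1 = closedw A phi.
  by apply: eq_bigr => e Ae; rewrite /bond_proba excess_fix// Aa.
have closed2 : closedw A phi2 = closedw A phi.
  by apply: eq_bigr => e Ae; rewrite /bond_proba excess_fix// (Aa _ Ae).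
have offL (b : Z2 -> int) : (forall x, x \notin L -> b x = 0) ->
    forall x, x \notin L -> phi x = twist b phi x.
  by move=> bL x xL; rewrite /twist /site_map bL// rot0.
have ham (b : Z2 -> int) : (forall x, x \notin L -> b x = 0) ->
    hamiltonian J U W (twist b phi) - hamiltonian J U W phi <=
    inner_energy J U W (twist b phi) - inner_energy J U W phi + 2 * B * k.
  move=> bL; have := hamiltonian_change J_sum B0 U_le LW bk (offL b bL).
  by rewrite ler_norml => /andP[_]; lra.
have h1 := ham a aL; have h2 : _ := ham (fun x => - a x) _.
have {}h2 := h2 (fun x xL => (congr1 -%R (aL xL)) : - a x = - 0).
set sumA := \sum_e p _ _ * _.
(* On closed bonds the second differences of U cancel between the energy and
   the excess, which leaves those of V. *)
have logs : logw A phi1 + logw A phi2 - 2 * logw A phi >=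
    - (4 * B * k) - 4 * B / K%:R ^+ 2 * sumA.
  pose d2 (F : (Z2 -> S) -> W * W -> R) e := F phi1 e + F phi2 e - 2 * F phi e.
  pose u psi e := inner_coupling e * U (psi (val e.1)) (psi (val e.2)).
  pose v psi e := inner_coupling e * V (psi (val e.1)) (psi (val e.2)).
  have ex psi e : excess psi e = v psi e - u psi e + p (val e.1) (val e.2) * 16^-1.
    by rewrite /excess mulrBr.
  have inner2 : inner_energy J U W phi1 + inner_energy J U W phi2 - 2 * inner_energy J U W phi
      = \sum_(e | ~~ A e) d2 u e.
    rewrite !inner_energyE mulr_sumr -big_split -sumrB (bigID (fun e => A e))/=.
    rewrite big1 ?add0r// => e Ae; rewrite !U_fix ?(Aa _ Ae)//; ring.
  have exc2 : \sum_(e | ~~ A e) excess phi1 e + \sum_(e | ~~ A e) excess phi2 e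
      - 2 * \sum_(e | ~~ A e) excess phi e =
      \sum_(e | ~~ A e) d2 v e - \sum_(e | ~~ A e) d2 u e.
    rewrite mulr_sumr -big_split -!sumrB/=; apply: eq_bigr => e _.
    rewrite !ex /d2; ring.
  have v2 : \sum_(e | ~~ A e) d2 v e <= 4 * B / K%:R ^+ 2 * sumA.
    apply: le_trans (ler_norm _) _; apply: le_trans (ler_norm_sum _ _ _) _.
    rewrite /sumA mulr_sumr [leRHS](bigID (fun e => A e))/= ler_wpDl//.
      have c0 : 0 <= 4 * B / K%:R ^+ 2 by apply: divr_ge0; rewrite ?mulr_ge0 ?exprn_ge0.
      by apply: sumr_ge0 => e _; rewrite mulr_ge0// mulr_ge0 ?step_proba_ge0 ?sqr_ge0.
    apply: ler_sum => e _.
    have -> : d2 v e = inner_coupling e * (V (phi1 (val e.1)) (phi1 (val e.2)) +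
        V (phi2 (val e.1)) (phi2 (val e.2)) - 2 * V (phi (val e.1)) (phi (val e.2))).
      by rewrite /d2 /v; ring.
    rewrite normrM inner_coupling_norm [leRHS]mulrCA.
    rewrite ler_wpM2l ?step_proba_ge0//; exact: smoothed_diff2.
  move: h1 h2 inner2 exc2 v2; rewrite /logw -/phi1 -/phi2; lra.
have q0 : 0 <= closedw A phi.
  by apply: prodr_ge0 => e _; case/andP: (bond_proba_itv phi e).
rewrite !joint_weightE closed1 closed2 -mulrDl mulrA ler_wpM2r//.
set m := logw A phi in logs *.
have E0 := expR_gt0 m.
(* The tangent of the exponential at m lies below its graph. *)
have expm l : expR m * (1 + (l - m)) <= expR l.
  rewrite (_ : expR l = expR m * expR (l - m)); last by rewrite -expRD addrC subrK.
  by rewrite ler_wpM2l ?(ltW E0)// expR_ge1Dx.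
have e1 := expm (logw A phi1); have e2 := expm (logw A phi2).
apply: le_trans (lerD e1 e2); rewrite -mulrDr mulrC ler_wpM2l ?(ltW E0)//.
have -> : 2 * B / K%:R ^+ 2 * sumA = (4 * B / K%:R ^+ 2 * sumA) / 2 by field; rewrite pnatr_eq0 -lt0n.
lra.
Qed.

End JointWeight.

(** * Rotating the clusters of open bonds *)

Section ClusterAngle.
Variables (R : realType) (S : ptopologicalType) (J : Z2 -> R) (U : S -> S -> R).
Hypothesis J_sum :
  (\esum_(x in [set z : Z2 | z != 0%R]) `|J x|%:E = 1)%E.
Variables (rot : int -> S -> S).
Hypothesis rot0 : forall s, rot 0 s = s.
Hypothesis rotD : forall k l s, rot (k + l) s = rot k (rot l s).
Hypothesis U_rot : forall k s t, U (rot k s) (rot k t) = U s t.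
Variable B : R.
Hypothesis B0 : 0 <= B.
Hypothesis U_le : forall s t, `|U s t| <= B.
Variable K : nat.
Hypothesis K0 : (0 < K)%N.
Hypothesis U_near : forall k s t, (`|k| < K)%N -> `|U (rot k s) t - U s t| <= 16^-1.
Variables (W L L0 : {fset Z2}) (k : R).
Hypothesis LW : (L `<=` W)%fset.
Hypothesis bk : (\esum_(p in boundary_pairs L W) `|J (p.1 - p.2)|%:E <= k%:E)%E.
Variables (N : nat) (t : Z2 -> nat).
Hypothesis N0 : (0 < N)%N.
Hypothesis tL0 : forall x, x \in L0 -> t x = (2 * N)%N.
Hypothesis tL : forall x, x \notin L -> t x = 0%N.
Variable D : R.
Hypothesis tD : (dirichlet J (fun x => (t x)%:R) <= D%:E)%E.

Local Notation p x y := (step_proba J x y).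
Implicit Types (A : {ffun W * W -> bool}) (phi : Z2 -> S).

Let height A (u : W) : nat := cluster_min (fun u => t (val u)) A u.

(** The angle is constant on clusters; the truncation at N makes it exactly N on L0
    as soon as the cluster minima reach N there, where the profile itself is
    2 N. *)
Definition angle A (x : Z2) : int :=
  if (insub x : option W) is Some u then Posz (minn N (height A u)) else 0.

(** Bond configurations whose clusters let all the sites of L0 be rotated by N. *)
Definition good_bonds A : bool :=
  [forall u : W, (val u \in L0) ==> (N <= height A u)%N].

Let angle_val A (u : W) : angle A (val u) = Posz (minn N (height A u)).
Proof. by rewrite /angle valK. Qed.

Lemma angle_off A x : x \notin L -> angle A x = 0.
Proof.
move=> xL; rewrite /angle; case: insubP => // u _ ux.
have := @cluster_min_le _ (fun u => t (val u)) A u u (connect0 _ _).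
by rewrite -/(height A u) /= ux tL// leqn0 => /eqP ->; rewrite minn0.
Qed.

Lemma angle_bond A (e : W * W) : A e -> angle A (val e.1) = angle A (val e.2).
Proof.
move=> Ae; rewrite !angle_val /height (@cluster_min_bond _ _ A e.1 e.2)//.
by rewrite /bond_open; case: e Ae => u v /= ->.
Qed.

Lemma angle_good A x : (L0 `<=` W)%fset -> good_bonds A -> x \in L0 -> angle A x = N%:Z.
Proof.
move=> L0W /forallP goodA xL0.
have xW : x \in W by exact: (fsubsetP L0W).
have := goodA [` xW]%fset; rewrite /= xL0 /= => Nx.
by rewrite -[x]/(val [` xW]%fset) angle_val (minn_idPl Nx).
Qed.

Let inner_dirichlet :
  \sum_(u : W) \sum_(v : W) p (val u) (val v) * ((t (val u))%:R - (t (val v))%:R) ^+ 2 <= D.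
Proof.
rewrite -lee_fin; apply: le_trans tD.
rewrite pair_big_dep/= -sumEFin; apply: esum_ge.
exists [set` [fset (val e.1, val e.2) | e : W * W]%fset].
  by split => //; exact: finite_fset.
rewrite fsbig_finite//= set_fsetK big_imfset/=; last first.
  by move=> [u v] [u' v'] _ _ /= [/val_inj -> /val_inj ->].
by rewrite big_enum.
Qed.

Let p_row (u : W) : \sum_(v : W) p (val u) (val v) <= 1.
Proof.
rewrite -lee_fin -(step_proba_suml J_sum (val u)) -sumEFin; apply: esum_ge.
exists [set` W]; first by split => //; exact: finite_fset.
by rewrite fsbig_finite//= set_fsetK big_seq_fsetE.
Qed.

Let p_col (v : W) : \sum_(u : W) p (val u) (val v) <= 1.
Proof.
rewrite -lee_fin -(step_proba_sumr J_sum (val v)) -sumEFin; apply: esum_ge.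
exists [set` W]; first by split => //; exact: finite_fset.
by rewrite fsbig_finite//= set_fsetK big_seq_fsetE.
Qed.

Let variance A : R := \sum_(u : W) ((t (val u))%:R - (height A u)%:R) ^+ 2.

Let variance_mean phi :
  bond_mean (bond_proba J U rot K phi) variance <= D.
Proof.
apply: le_trans inner_dirichlet.
(* The walk may be asymmetric; q symmetrizes it, and its rows sum to at most
   (1 + 1) / 8 = 1/4. *)
pose q (u v : W) := (p (val u) (val v) + p (val v) (val u)) / 8.
have := @cluster_min_variance R _ (bond_proba J U rot K phi) q (fun u => t (val u))
  (fun e => bond_proba01 J K0 U_near phi e).
have pq u v : bond_proba J U rot K phi (u, v) + bond_proba J U rot K phi (v, u) <= q u v.
  have /andP[_ h1] := bond_proba_itv J K0 U_near phi (u, v).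
  have /andP[_ h2] := bond_proba_itv J K0 U_near phi (v, u).
  by rewrite /q mulrDl lerD.
have qs v : \sum_u q u v <= 4^-1.
  by rewrite -mulr_suml big_split/=; have := p_row v; have := p_col v; lra.
move=> /(_ pq qs) /le_trans; apply; rewrite le_eqVlt; apply/orP; left; apply/eqP.
set F := \sum_(u : W) \sum_(v : W) p _ _ * _.
have F2 : F = \sum_(u : W) \sum_(v : W) p (val v) (val u) * ((t (val u))%:R - (t (val v))%:R) ^+ 2.
  rewrite /F exchange_big; apply: eq_bigr => u _; apply: eq_bigr => v _ /=; ring.
have -> : \sum_(u : W) \sum_(v : W) q u v * ((t (val u))%:R - (t (val v))%:R) ^+ 2 =
    (F + F) / 8.
  rewrite {2}F2 /F -big_split mulr_suml/=; apply: eq_bigr => u _.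
  by rewrite -big_split mulr_suml; apply: eq_bigr => v _; rewrite /q /=; ring.
by field.
Qed.

Let variance_ge0 A : 0 <= variance A.
Proof. by apply: sumr_ge0 => u _; rewrite sqr_ge0. Qed.

Let bad_variance A : ~~ good_bonds A -> N%:R ^+ 2 <= variance A.
Proof.
move=> /forallPn[u]; rewrite negb_imply -ltnNge => /andP[uL0 uN].
rewrite /variance (bigD1 u)//= tL0// -[leLHS]addr0 lerD//; last first.
  by apply: sumr_ge0 => v _; rewrite sqr_ge0.
rewrite lerXn2r ?nnegrE ?subr_ge0 ?ler_nat//; first by lia.
by rewrite lerBrDr -natrD ler_nat; lia.
Qed.

Let angle_variation A :
  \sum_(e : W * W) p (val e.1) (val e.2) * (angle A (val e.1) - angle A (val e.2))%:~R ^+ 2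
  <= 3 * D + 6 * variance A.
Proof.
have p0 := step_proba_ge0 J.
(* Truncation at N is 1-Lipschitz. *)
have lip (a b : nat) : ((minn N a)%:Z - (minn N b)%:Z)%:~R ^+ 2 <= (a%:R - b%:R) ^+ 2 :> R.
  have -> : a%:R - b%:R = (a%:Z - b%:Z)%:~R :> R by rewrite rmorphB.
  rewrite -[leLHS]real_normK ?num_real// -[leRHS]real_normK ?num_real//.
  rewrite lerXn2r ?nnegrE ?normr_ge0// -!intr_norm ler_int; lia.
pose T (u : W) : R := (t (val u))%:R; pose d A (u : W) : R := T u - (height A u)%:R.
apply: (@le_trans _ _ (\sum_(u : W) \sum_(v : W) p (val u) (val v) *
    (3 * (T u - T v) ^+ 2 + 3 * d A u ^+ 2 + 3 * d A v ^+ 2))).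
  rewrite pair_big_dep/=; apply: ler_sum => -[u v] _ /=; rewrite ler_wpM2l//.
  rewrite !angle_val; apply: le_trans (lip _ _) _.
  have -> : (height A u)%:R - (height A v)%:R = (T u - T v) - d A u + d A v by rewrite /d; ring.
  rewrite -subr_ge0 (_ : _ - _ = (T u - T v + d A u) ^+ 2 + (T u - T v - d A v) ^+ 2 +
    (d A u + d A v) ^+ 2); last by ring.
  by rewrite !addr_ge0 ?sqr_ge0.
have -> : \sum_(u : W) \sum_(v : W) p (val u) (val v) *
    (3 * (T u - T v) ^+ 2 + 3 * d A u ^+ 2 + 3 * d A v ^+ 2) =
  3 * (\sum_(u : W) \sum_(v : W) p (val u) (val v) * (T u - T v) ^+ 2) +
  3 * (\sum_(u : W) d A u ^+ 2 * \sum_(v : W) p (val u) (val v)) +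
  3 * (\sum_(v : W) d A v ^+ 2 * \sum_(u : W) p (val u) (val v)).
  under [X in _ = _ + 3 * X]eq_bigr do rewrite mulr_sumr.
  rewrite [X in _ = _ + 3 * X]exchange_big !mulr_sumr -!big_split/=.
  apply: eq_bigr => u _; rewrite !mulr_sumr -!big_split/=; apply: eq_bigr => v _; ring.
have r1 : \sum_(u : W) d A u ^+ 2 * \sum_(v : W) p (val u) (val v) <= variance A.
  by apply: ler_sum => u _; rewrite ler_piMr ?sqr_ge0.
have r2 : \sum_(v : W) d A v ^+ 2 * \sum_(u : W) p (val u) (val v) <= variance A.
  by apply: ler_sum => u _; rewrite ler_piMr ?sqr_ge0.
have := inner_dirichlet; rewrite -/T; lra.
Qed.

Local Notation joint A phi := (joint_weight J U rot K A phi).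

(** Average [joint_weight_twist] over the bonds.  The defect of a bond configuration
    A is bounded by c A, whose mean is small because the mean of the variance is at
    most D.  The term variance / N^2 of c A is at least 1 on bad configurations
    ([bad_variance]), so that these can be dropped: the left hand side is
    nonpositive there. *)
Lemma good_twists phi :
  2 * (1 - (D / N%:R ^+ 2 + 2 * B * k + 18 * B * D / K%:R ^+ 2)) * boltzmann J U W phi <=
  \sum_(A | good_bonds A) (joint A (twist rot (angle A) phi) +
                           joint A (twist rot (fun x => - angle A x) phi)).
Proof.
have N2 : 0 < N%:R ^+ 2 :> R by rewrite exprn_gt0// ltr0n.
(* The first term pays for bad configurations, the others for the defect of
   [joint_weight_twist]. *)
pose c A := variance A / N%:R ^+ 2 + 2 * B * k + 2 * B / K%:R ^+ 2 * (3 * D + 6 * variance A).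
have cmean : bond_mean (bond_proba J U rot K phi) c <=
    D / N%:R ^+ 2 + 2 * B * k + 18 * B * D / K%:R ^+ 2.
  have cE : bond_mean (bond_proba J U rot K phi) c =
      (N%:R ^+ 2)^-1 * bond_mean (bond_proba J U rot K phi) variance + (2 * B * k +
      2 * B / K%:R ^+ 2 * (3 * D + 6 * bond_mean (bond_proba J U rot K phi) variance)).
    have w1 : \sum_(A : {ffun W * W -> bool}) bond_weight (bond_proba J U rot K phi) A = 1.
      have := @bond_mean1 R _ (@bond_proba R S J U rot K W phi).
      by rewrite /bond_mean => <-; apply: eq_bigr => A _; rewrite mulr1.
    rewrite /bond_mean.
    transitivity (\sum_(A : {ffun W * W -> bool})
      (((N%:R ^+ 2)^-1 + 2 * B / K%:R ^+ 2 * 6) * (bond_weight (bond_proba J U rot K phi) A * variance A)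
       + (2 * B * k + 2 * B / K%:R ^+ 2 * (3 * D)) * bond_weight (bond_proba J U rot K phi) A)).
      by apply: eq_bigr => A _; rewrite /c; ring.
    by rewrite big_split/= -!mulr_sumr w1; ring.
  have vm := variance_mean phi; rewrite cE.
  have v1 : (N%:R ^+ 2)^-1 * bond_mean (bond_proba J U rot K phi) variance <= D / N%:R ^+ 2.
    by rewrite [leRHS]mulrC ler_wpM2l// invr_ge0 ltW.
  have -> : 18 * B * D / K%:R ^+ 2 = 2 * B / K%:R ^+ 2 * (9 * D).
    by field; rewrite pnatr_eq0 -lt0n.
  rewrite -!addrA lerD// lerD2l ler_wpM2l//; last by lra.
  by apply: divr_ge0; rewrite ?mulr_ge0 ?exprn_ge0.
have joint0 A psi : 0 <= joint A psi by exact: joint_weight_ge0.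
have k0 : 0 <= k.
  by rewrite -lee_fin; apply: le_trans bk; apply: esum_ge0 => *; rewrite lee_fin.
have cK : 0 <= 2 * B / K%:R ^+ 2 by apply: divr_ge0; rewrite ?mulr_ge0 ?exprn_ge0.
have D0 : 0 <= D by rewrite -lee_fin; apply: le_trans tD; exact: dirichlet_ge0.
have Bk : 0 <= 2 * B * k by rewrite !mulr_ge0.
apply: (@le_trans _ _ (\sum_A 2 * (1 - c A) * joint A phi)).
  have -> : \sum_A 2 * (1 - c A) * joint A phi =
     2 * (1 - bond_mean (bond_proba J U rot K phi) c) * boltzmann J U W phi.
    have -> : 1 - bond_mean (bond_proba J U rot K phi) c = bond_mean (bond_proba J U rot K phi) (fun A => 1 - c A).
      have := @bond_mean1 R _ (@bond_proba R S J U rot K W phi); rewrite /bond_mean => {1}<-.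
      by rewrite -sumrB; apply: eq_bigr => A _; rewrite mulr1 mulrBr mulr1.
    rewrite /bond_mean mulr_sumr mulr_suml.
    by apply: eq_bigr => A _; rewrite /joint_weight; ring.
  by rewrite ler_wpM2r ?expR_ge0// ler_wpM2l// lerD2l lerN2.
rewrite [leRHS]big_mkcond /=; apply: ler_sum => A _; case: ifPn => [gA|/bad_variance bad].
  apply: le_trans (joint_weight_twist J_sum rot0 rotD U_rot B0 U_le K0 U_near LW bk
    (@angle_off A) phi (@angle_bond A)).
  rewrite ler_wpM2r// ler_wpM2l// lerD2l lerN2 /c -addrA -[leLHS]add0r lerD//.
    by rewrite divr_ge0// ltW.
  by rewrite lerD2l ler_wpM2l.
apply: mulr_le0_ge0 => //; rewrite -oppr_ge0 -mulrN opprB mulr_ge0// subr_ge0 /c.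
rewrite -addrA -[leLHS]addr0 lerD//; first by rewrite ler_pdivlMr// mul1r.
by rewrite addr_ge0// mulr_ge0// addr_ge0 ?mulr_ge0.
Qed.

End ClusterAngle.

(** * Approximate convexity of the Gibbs kernel *)

Lemma coord_events_local (S : ptopologicalType) (V : set Z2) (A : set (Z2 -> S)) :
  <<s coord_events V >> A ->
  forall phi psi : Z2 -> S, (forall x, V x -> phi x = psi x) -> A phi -> A psi.
Proof.
move=> sA.
suff sub : <<s @coord_events S V >> `<=`
  [set A | forall phi psi : Z2 -> S, (forall x, V x -> phi x = psi x) -> (A phi <-> A psi)].
  by move=> phi psi e; case: (sub _ sA phi psi e).
apply: smallest_sub; last first.
  move=> _ [x Vx [C mC <-]] phi psi e /=.
  by split => -[_ h]; split => //=; rewrite /= ?e// -?e.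
split => /= [phi psi _ //|C loc phi psi e|F loc phi psi e].
- by split => -[_ nC]; split => // Ch; apply: nC; move: Ch; [move/(loc _ _ e)|move/(loc _ _ e)].
- by split => -[n _ Fn]; exists n => //; move: Fn; [move/(loc n _ _ e)|move/(loc n _ _ e)].
Qed.

Lemma coord_events_sub (S : ptopologicalType) (V V' : set Z2) : V `<=` V' ->
  <<s @coord_events S V >> `<=` <<s @coord_events S V' >>.
Proof.
move=> VV'; apply: sub_sigma_algebra2 => A [x Vx Ax].
by exists x => //; exact: VV'.
Qed.

Section KernelConvexity.
Variables (R : realType) (S : ptopologicalType) (J : Z2 -> R) (U : S -> S -> R).
Variable lambda : {finite_measure set (borel S) -> \bar R}.
Hypothesis J_sum :
  (\esum_(x in [set z : Z2 | z != 0%R]) `|J x|%:E = 1)%E.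
Hypothesis compactS : compact [set: S].
Hypothesis U_continuous : continuous (fun p : S * S => U p.1 p.2).
Variables (rot : int -> S -> S).
Hypothesis rot0 : forall s, rot 0 s = s.
Hypothesis rotD : forall k l s, rot (k + l) s = rot k (rot l s).
Hypothesis rot_continuous : forall k, continuous (rot k).
Hypothesis rot_lambda : forall k (A : set (borel S)), measurable A ->
  lambda (rot k @^-1` A) = lambda A.
Hypothesis U_rot : forall k s t, U (rot k s) (rot k t) = U s t.
Variable B : R.
Hypothesis B0 : 0 <= B.
Hypothesis U_le : forall s t, `|U s t| <= B.
Variable K : nat.
Hypothesis K0 : (0 < K)%N.
Hypothesis U_near : forall k s t, (`|k| < K)%N -> `|U (rot k s) t - U s t| <= 16^-1.

Lemma measurable_joint_weight (W : {fset Z2}) (A : {ffun W * W -> bool}) :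
  measurable_fun setT (joint_weight J U rot K A : config S -> R).
Proof.
apply: measurable_funM; first exact: (measurable_boltzmann J_sum compactS U_continuous B0 U_le W).
have mU i j x y : measurable_fun setT (fun phi : config S =>
    U (rot i ((phi : Z2 -> S) x)) (rot j ((phi : Z2 -> S) y))).
  apply: (measurable_interaction compactS U_continuous).
    exact: (measurableT_comp (measurable_continuous_map (@rot_continuous i)) (measurable_coord x)).
  exact: (measurableT_comp (measurable_continuous_map (@rot_continuous j)) (measurable_coord y)).
have mU0 i x y : measurable_fun setT (fun phi : config S =>
    U (rot i ((phi : Z2 -> S) x)) ((phi : Z2 -> S) y)).
  have -> : (fun phi : config S => U (rot i ((phi : Z2 -> S) x)) ((phi : Z2 -> S) y)) =
      (fun phi : config S => U (rot i ((phi : Z2 -> S) x)) (rot 0 ((phi : Z2 -> S) y))).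
    by apply/funext => phi; rewrite rot0.
  exact: mU.
have mV x y : measurable_fun setT (fun phi : config S =>
    smoothed U rot K ((phi : Z2 -> S) x) ((phi : Z2 -> S) y)).
  apply: measurable_funM; first exact: measurable_cst.
  by apply: measurable_sum => i; apply: measurable_sum => j; exact: mU0.
have mx e : measurable_fun setT (fun phi : config S => excess J U rot K phi e : R).
  apply: measurable_funD; last exact: measurable_cst.
  apply: measurable_funM; first exact: measurable_cst.
  apply: measurable_funB; first exact: mV.
  have -> : (fun phi : config S => U ((phi : Z2 -> S) (val e.1)) ((phi : Z2 -> S) (val e.2))) =
      (fun phi : config S => U (rot 0 ((phi : Z2 -> S) (val e.1))) ((phi : Z2 -> S) (val e.2))).
    by apply/funext => phi; rewrite rot0.
  exact: mU0.
have mp e : measurable_fun setT (fun phi : config S => bond_proba J U rot K phi e : R).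
  apply: measurable_funB; first exact: measurable_cst.
  apply: measurableT_comp; first exact: measurable_expR.
  exact: measurable_funN.
apply: measurable_prod => e _; case: (A e); first exact: mp.
by apply: measurable_funB; [exact: measurable_cst|exact: mp].
Qed.

Variables (W L L0 : {fset Z2}) (k : R).
Hypothesis LW : (L `<=` W)%fset.
Hypothesis L0W : (L0 `<=` W)%fset.
Hypothesis bk : (\esum_(p in boundary_pairs L W) `|J (p.1 - p.2)|%:E <= k%:E)%E.
Variables (N : nat) (t : Z2 -> nat).
Hypothesis N0 : (0 < N)%N.
Hypothesis tL0 : forall x, x \in L0 -> t x = (2 * N)%N.
Hypothesis tL : forall x, x \notin L -> t x = 0%N.
Variable D : R.
Hypothesis tD : (dirichlet J (fun x => (t x)%:R) <= D%:E)%E.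
Let loss := D / N%:R ^+ 2 + 2 * B * k + 18 * B * D / K%:R ^+ 2.
Hypothesis loss1 : loss <= 1.

Variable A0 : set (Z2 -> S).
Hypothesis A0_local : <<s coord_events [set x | x \in L0] >> A0.

Definition shifted (m : int) : set (Z2 -> S) := site_map (fun=> rot m) @^-1` A0.

Local Notation joint A := (joint_weight J U rot K A).
Local Notation I f eta := (integrate_sites lambda W f eta).
Local Notation bz := (boltzmann J U W).

Let mA0 : measurable (A0 : set (config S)).
Proof. by apply: (coord_events_sub (V := [set x | x \in L0])). Qed.

Let mshift m : measurable (shifted m : set (config S)).
Proof.
have := @measurable_site_map S (fun=> rot m) (fun _ => @rot_continuous m).
by move=> /(_ measurableT _ mA0); rewrite setTI.
Qed.

Let m_indic (E : set (config S)) (f : config S -> R) : measurable E -> measurable_fun setT f ->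
  measurable_fun [set: config S] (fun phi => (\1_E phi * f phi)%:E).
Proof.
move=> mE mf; apply/measurable_EFinP; exact: measurable_funM.
Qed.

Let joint0 (A : {ffun W * W -> bool}) phi : 0 <= joint A phi.
Proof. exact: joint_weight_ge0. Qed.

Let one_sided (m : int) (a : {ffun W * W -> bool} -> Z2 -> int) eta :
  (forall A x, x \notin L -> a A x = 0) ->
  (forall A x, good_bonds L0 N t A -> x \in L0 -> a A x = - m) ->
  (\sum_(A : {ffun W * W -> bool} | good_bonds L0 N t A)
     I (fun phi => (\1_A0 phi * joint A (twist rot (a A) phi))%:E) eta
   <= I (fun phi => (\1_(shifted m) phi * bz phi)%:E) eta)%E.
Proof.
move=> a0 am.
have -> : (fun phi => (\1_(shifted m) phi * bz phi)%:E) =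
   (fun phi => (\sum_(A : {ffun W * W -> bool}) (\1_(shifted m) phi * joint A phi)%:E)%E) :> ((Z2 -> S) -> \bar R).
  by apply/funext => phi; rewrite sumEFin -mulr_sumr joint_weight_sum.
have js0 (A : {ffun W * W -> bool}) phi : (0 <= (\1_(shifted m) phi * joint A phi)%:E)%E.
  by rewrite lee_fin mulr_ge0.
have mjs (A : {ffun W * W -> bool}) :
    measurable_fun [set: config S] (fun phi => (\1_(shifted m) phi * joint A phi)%:E).
  by apply: m_indic; [exact: mshift|exact: measurable_joint_weight].
rewrite (integrate_sites_sum lambda W xpredT eta js0 mjs).
rewrite [leRHS](bigID (good_bonds L0 N t))/= -[leLHS]adde0; apply: leeD; last first.
  apply: sume_ge0 => A _; apply: integrate_sites_ge0 => phi.
  by rewrite lee_fin mulr_ge0.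
apply: lee_sum => A gA.
pose g phi : \bar R := (\1_(shifted m) phi * joint A phi)%:E.
have gE phi : (\1_A0 phi * joint A (twist rot (a A) phi))%:E =
    g (site_map (fun x => rot (a A x)) phi).
  rewrite /g; congr (_ * _)%:E; rewrite /indic; congr (_%:R); congr nat_of_bool.
  apply/idP/idP; rewrite !inE => h.
    apply: (coord_events_local A0_local _ h) => x xL0.
    by rewrite /site_map am// -rotD subrr rot0.
  apply: (coord_events_local A0_local _ h) => x xL0.
  by rewrite /site_map am// -rotD subrr rot0.
rewrite (_ : (fun phi => (\1_A0 phi * joint A (twist rot (a A) phi))%:E) =
  (fun phi => g (site_map (fun x => rot (a A x)) phi))); last exact/funext.
have g0 phi : (0 <= g phi)%E by rewrite lee_fin mulr_ge0.
have mg : measurable_fun [set: config S] g.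
  by apply: m_indic; [exact: mshift|exact: measurable_joint_weight].
rewrite (integrate_sites_map (f := g) (h := fun x => rot (a A x)) W eta
  (fun x => @rot_continuous _) (fun x => @rot_lambda _) g0 mg).
rewrite le_eqVlt; apply/orP; left; apply/eqP; apply: integrate_sites_off => x xW.
rewrite /site_map a0 ?rot0//; apply: contra xW; exact: (fsubsetP LW).
Qed.

(** Integrate [good_twists].  For a good bond configuration A the rotation by [angle]
    acts on L0 as the rotation by N, and the change of variables in the free
    measure turns the integral over A0 into one over a shift of A0. *)
Lemma integrated_convexity eta :
  ((2 * (1 - loss))%:E * I (fun phi => (\1_A0 phi * bz phi)%:E) eta <=
   I (fun phi => (\1_(shifted N%:Z) phi * bz phi)%:E) eta +
   I (fun phi => (\1_(shifted (- N%:Z)) phi * bz phi)%:E) eta)%E.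
Proof.
have mb : measurable_fun setT (bz : config S -> R).
  exact: (measurable_boltzmann J_sum compactS U_continuous B0 U_le W).
pose am A x := - @angle W N t A x.
have h1 := @one_sided N%:Z am eta.
have h2 := @one_sided (- N%:Z) (@angle W N t) eta.
have offL A x : x \notin L -> @angle W N t A x = 0 by exact: angle_off.
have {}h1 := h1 (fun A x xL => (congr1 -%R (offL A x xL)) : am A x = - 0)
   (fun A x gA xL0 => congr1 -%R (angle_good L0W gA xL0)).
have {}h2 := h2 offL.
have {}h2 : (_ <= _)%E := h2 (fun A x gA xL0 => etrans (angle_good L0W gA xL0) (esym (opprK _))).
apply: le_trans (leeD h1 h2).
have mtw (A : {ffun W * W -> bool}) b : measurable_fun [set: config S] (fun phi => (\1_A0 phi * joint A (twist rot b phi))%:E).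
  apply: m_indic => //; apply: (measurableT_comp (measurable_joint_weight A)).
  by apply: measurable_site_map => x; exact: rot_continuous.
have tw0 (b : {ffun W * W -> bool} -> Z2 -> int) A phi :
    (0 <= (\1_A0 phi * joint A (twist rot (b A) phi))%:E)%E.
  by rewrite lee_fin mulr_ge0.
have mtws (b : {ffun W * W -> bool} -> Z2 -> int) : measurable_fun [set: config S]
    (fun phi => \sum_(A | good_bonds L0 N t A) (\1_A0 phi * joint A (twist rot (b A) phi))%:E)%E.
  rewrite (_ : (fun phi : config S => _) = (fun phi : config S =>
    \sum_(A <- [seq A <- index_enum _ | good_bonds L0 N t A]) (\1_A0 phi * joint A (twist rot (b A) phi))%:E)%E); last first.
    by apply/funext => phi; rewrite big_filter.
  by apply: emeasurable_sum => A; exact: mtw.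
have tws0 (b : {ffun W * W -> bool} -> Z2 -> int) phi :
    (0 <= \sum_(A | good_bonds L0 N t A) (\1_A0 phi * joint A (twist rot (b A) phi))%:E)%E.
  by apply: sume_ge0 => A _; exact: tw0.
have indic0 phi : (0 <= (\1_A0 phi * bz phi)%:E)%E by rewrite lee_fin mulr_ge0// expR_ge0.
have mindic : measurable_fun [set: config S] (fun phi => (\1_A0 phi * bz phi)%:E) by exact: m_indic.
have loss0 : 0 <= 2 * (1 - loss) by rewrite mulr_ge0// subr_ge0.
rewrite -(integrate_sites_sum lambda W _ eta (tw0 am) (fun A => mtw A (am A))).
rewrite -(integrate_sites_sum lambda W _ eta (tw0 (@angle W N t)) (fun A => mtw A _)).
rewrite -(integrate_sitesD lambda W eta (tws0 am) (tws0 _) (mtws am) (mtws _)).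
rewrite -(integrate_sitesZ lambda W eta loss0 indic0 mindic).
apply: le_integrate_sites.
- by move=> phi; rewrite -EFinM lee_fin !mulr_ge0 ?subr_ge0 ?expR_ge0.
- by apply: emeasurable_funM; [exact: measurable_cst|exact: m_indic].
- by apply: emeasurable_funD; exact: mtws.
move=> phi; rewrite !sumEFin -EFinD -EFinM lee_fin -!mulr_sumr -mulrDr mulrCA.
rewrite ler_wpM2l// [leRHS]addrC -big_split/=.
exact: (good_twists J_sum rot0 rotD U_rot B0 U_le K0 U_near LW bk N0 tL0 tL tD phi).
Qed.

Lemma kernel_convexity eta :
  2 * (1 - loss) * gibbs_kernel J U lambda W A0 eta <=
  gibbs_kernel J U lambda W (shifted N%:Z) eta + gibbs_kernel J U lambda W (shifted (- N%:Z)) eta.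
Proof.
have mb : measurable_fun setT (bz : config S -> R).
  exact: (measurable_boltzmann J_sum compactS U_continuous B0 U_le W).
have [C C0 bC] := boltzmann_bounded J_sum B0 U_le W.
have Ifin (E : set (config S)) : measurable E ->
    I (fun phi => (\1_E phi * bz phi)%:E) eta \is a fin_num.
  move=> mE; rewrite ge0_fin_numE; last first.
    by apply: integrate_sites_ge0 => phi; rewrite lee_fin mulr_ge0// expR_ge0.
  apply: le_lt_trans (integrate_sites_cst lambda W eta C0).
  apply: le_integrate_sites.
  - by move=> phi; rewrite lee_fin mulr_ge0// expR_ge0.
  - exact: m_indic.
  - exact: measurable_cst.
  - move=> phi; rewrite lee_fin; apply: le_trans (bC phi).
    by rewrite ler_piMl ?expR_ge0// indicE; case: (_ \in _).
have := integrated_convexity eta.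
rewrite -(fineK (Ifin _ mA0)) -(fineK (Ifin _ (mshift N%:Z))) -(fineK (Ifin _ (mshift (- N%:Z)))).
rewrite -EFinM -EFinD lee_fin /gibbs_kernel mulrA -mulrDl => h.
rewrite ler_wpM2r// invr_ge0 /partition_function fine_ge0//.
by apply: integrate_sites_ge0 => phi; rewrite lee_fin expR_ge0.
Qed.

End KernelConvexity.

(** * Bounded convex sequences and integer powers *)

(** The slopes of a convex sequence are monotone, so a nonzero slope would make it
    unbounded in one of the two directions. *)
Lemma bounded_convex_int (R : realType) (a : int -> R) :
  (forall k, 0 <= a k <= 1) -> (forall k, 2 * a k <= a (k + 1) + a (k - 1)) ->
  a 1 = a 0.
Proof.
have half (b : int -> R) : (forall k, 0 <= b k <= 1) ->
    (forall k, 2 * b k <= b (k + 1) + b (k - 1)) -> b 1 <= b 0.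
  move=> b01 bconv; rewrite leNgt; apply/negP => b10.
  pose c := b 1 - b 0; have c0 : 0 < c by rewrite subr_gt0.
  have slope (n : nat) : c <= b (n.+1%:Z) - b n%:Z.
    elim: n => [//|n ih]; apply: le_trans ih _.
    have := bconv n.+1%:Z.
    have -> : n.+1%:Z + 1 = n.+2%:Z by rewrite [RHS]intS addrC.
    have -> : n.+1%:Z - 1 = n%:Z by rewrite intS addrC addKr.
    lra.
  have growth (n : nat) : n%:R * c <= b n%:Z - b 0.
    elim: n => [|n ih]; first by rewrite mul0r subrr.
    by rewrite -natr1 mulrDl mul1r; have := slope n; lra.
  have := growth (Num.truncn c^-1).+1.
  have := truncnS_gt c^-1; rewrite -(ltr_pM2r c0) mulVf ?gt_eqF//.
  have /andP[_ b1] := b01 (Num.truncn c^-1).+1%:Z; have /andP[b0 _] := b01 0.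
  lra.
move=> a01 aconv; apply/eqP; rewrite eq_le half//=.
have := half (fun k => a (- k)) (fun k => a01 _).
have aconv' k : 2 * a (- k) <= a (- (k + 1)) + a (- (k - 1)).
  by have := aconv (- k); rewrite opprD opprB addrC [1 - k]addrC.
move=> /(_ aconv'); rewrite oppr0 => aN1.
by have := aconv 0; rewrite add0r sub0r; lra.
Qed.

Section IntegerPowers.
Variable G : preTopologicalGroupType.

Definition zpow (h : G) (k : int) : G :=
  match k with Posz n => (h ^+ n)%g | Negz n => (h^-1 ^+ n.+1)%g end.

Lemma zpowS h k : zpow h (k + 1) = (h * zpow h k)%g.
Proof.
case: k => [n|n]; first by rewrite -[n%:Z + 1]/(n + 1)%N%:Z addn1 /= expgS.
case: n => [|n]; first by rewrite /= expg1 mulgV.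
have -> : Negz n.+1 + 1 = Negz n by rewrite !NegzE; lia.
by rewrite /= [in RHS]expgS mulgA mulgV mul1g.
Qed.

Lemma zpowP h k : zpow h (k - 1) = (h^-1 * zpow h k)%g.
Proof. by rewrite -[in RHS](subrK 1 k) zpowS mulgA mulVg mul1g. Qed.

Lemma zpowD h k l : zpow h (k + l) = (zpow h k * zpow h l)%g.
Proof.
elim/int_rec: k => [|n ih|n ih].
- by rewrite add0r /= mul1g.
- by rewrite -[in LHS]addn1 PoszD addrAC zpowS ih -addn1 PoszD zpowS mulgA.
- rewrite intS opprD [-1 + _]addrC addrAC zpowP ih zpowP mulgA//.
Qed.

Variables (R : realType) (S : Type) (act : G -> S -> S) (U : S -> S -> R).
Hypothesis actM : forall g h s, act (g * h)%g s = act g (act h s).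
Hypothesis act1 : forall s, act 1%g s = s.
Hypothesis U_invariant : forall g s t, U (act g s) (act g t) = U s t.

(** For negative powers, move the rotation to the other spin by invariance. *)
Lemma zpow_near h (e : R) K :
  (forall k, (k < K)%N -> forall s t, `|U (act (h ^+ k)%g s) t - U s t| <= e) ->
  forall k s t, (`|k| < K)%N -> `|U (act (zpow h k) s) t - U s t| <= e.
Proof.
move=> near k s t; have [k0|k0] := leP 0 k.
  by case: k k0 => // n _ /near; exact.
case: k k0 => // n _ nK; have near_n := near n.+1 nK.
rewrite -[zpow h (Negz n)]/(h^-1 ^+ n.+1)%g.
set s' := act _ s; rewrite distrC.
have -> : U s t = U (act (h ^+ n.+1)%g s') t; last exact: near_n.
by rewrite /s' -actM expVgn mulgV act1.
Qed.

End IntegerPowers.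

(** * Convexity of a Gibbs state along rotations *)

Section GibbsInvariance.
Variables (R : realType) (G : preTopologicalGroupType) (S : ptopologicalType).
Variables (J : Z2 -> R) (U : S -> S -> R) (act : G -> S -> S).
Variable lambda : {finite_measure set (borel S) -> \bar R}.
Hypothesis J_sum :
  (\esum_(x in [set z : Z2 | z != 0%R]) `|J x|%:E = 1)%E.
Hypothesis compactS : compact [set: S].
Hypothesis U_continuous : continuous (fun p : S * S => U p.1 p.2).
Hypothesis actP : continuous_action act.
Hypothesis U_invariant : forall g s t, U (act g s) (act g t) = U s t.
Hypothesis lambda_invariant : invariant_measure act lambda.
Variable mu : probability (config S) R.
Hypothesis mu_gibbs : gibbs_state J U lambda mu.

Lemma act_continuous g : continuous (act g).
Proof.
move=> s; have [_ _ actC] := actP.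
have ac : (fun p : G * S => act p.1 p.2) @ (g, s) --> act g s := actC (g, s).
apply: (cvg_comp (fun s => (g, s)) _ _ ac).
by apply: cvg_pair => //; exact: cvg_cst.
Qed.

Lemma measurable_config_act g : measurable_fun setT (config_act act g : config S -> config S).
Proof. exact: (measurable_site_map (h := fun=> act g) (fun=> @act_continuous g)). Qed.

Lemma cylinder_preimage g V (A : set (Z2 -> S)) :
  <<s coord_events V >> A -> <<s coord_events V >> (config_act act g @^-1` A).
Proof.
move=> sA; pose P := [set A : set (Z2 -> S) | <<s coord_events V >> (config_act act g @^-1` A)].
suff : <<s @coord_events S V >> `<=` P by move=> /(_ A sA).
have [s0 sC sU] := smallest_sigma_algebra setT (@coord_events S V).
apply: smallest_sub.
  split; rewrite /P /=.
  - by rewrite preimage_set0.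
  - by move=> C CP; rewrite setTD preimage_setC -setTD; exact: sC.
  - by move=> F FP; rewrite preimage_bigcup; exact: sU.
move=> _ [x Vx [C mC <-]]; rewrite /P /=; apply: sub_sigma_algebra; exists x => //.
exists (act g @^-1` C); last by rewrite !setTI.
have := measurable_continuous_map (@act_continuous g).
by move=> /(_ measurableT C mC); rewrite setTI.
Qed.

Lemma measurable_gibbs_kernel (W : {fset Z2}) (A : set (config S)) : measurable A ->
  measurable_fun setT (gibbs_kernel J U lambda W A : config S -> R).
Proof.
move=> mA; have [B [B0 UB]] := interaction_bounded compactS U_continuous.
have mb := measurable_boltzmann J_sum compactS U_continuous B0 UB W.
apply: measurable_funM.
  apply: (measurableT_comp (fine_measurable measurableT)).
  apply: measurable_integrate_sites; first by move=> phi; rewrite lee_fin mulr_ge0// expR_ge0.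
  by apply/measurable_EFinP; exact: measurable_funM.
have mZ : measurable_fun setT (partition_function J U lambda W : config S -> R).
  apply: (measurableT_comp (fine_measurable measurableT)).
  apply: measurable_integrate_sites; first by move=> phi; rewrite lee_fin expR_ge0.
  exact/measurable_EFinP.
rewrite (_ : (fun eta : config S => _) = (fun eta : config S => (partition_function J U lambda W eta) `^ (-1))).
  exact: (measurableT_comp (measurable_powR _) mZ).
apply/funext => eta; rewrite powR_inv1// /partition_function fine_ge0//.
by apply: integrate_sites_ge0 => phi; rewrite lee_fin expR_ge0.
Qed.

Lemma gibbs_kernel_ge0 (W : {fset Z2}) (A : set (Z2 -> S)) eta :
  0 <= gibbs_kernel J U lambda W A eta.
Proof.
apply: divr_ge0; apply: fine_ge0; apply: integrate_sites_ge0 => phi;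
  by rewrite lee_fin ?mulr_ge0 ?expR_ge0.
Qed.

Lemma gibbs_mean (W : {fset Z2}) (A : set (Z2 -> S)) :
  <<s coord_events [set x | x \in W] >> A ->
  mu A = (\int[mu]_eta (gibbs_kernel J U lambda W A eta)%:E)%E.
Proof.
move=> sA; have := mu_gibbs sA (B := setT); rewrite setIT; apply.
by have [s0 sC _] := smallest_sigma_algebra setT (@coord_events S [set x | x \notin W]);
  rewrite -[X in _ X]setD0; exact: sC.
Qed.

Variables (d : measure_display) (Omega : measurableType d) (P : probability Omega R).
Variable X : nat -> Omega -> Z2.
Hypothesis X_walk : random_walk J P X.
Hypothesis X_recurrent : recurrent P X.

(** The order of the choices: n0 first, for the powers below 2^j of the root of order
    2^(n0 + j) to move U by at most 1/16; then the energy eta, small with respect to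
    M = 2^n0; then the profile and the box; the fineness K of the roots only has to
    be large enough for the profile to exist at height 2 N, N = M K. *)
Lemma cylinder_convexity g (L0 : {fset Z2}) (A0 : set (Z2 -> S)) :
  dyadic_roots g -> <<s coord_events [set x | x \in L0] >> A0 ->
  2 * fine (mu A0) <= fine (mu (config_act act g @^-1` A0)) +
                      fine (mu (config_act act g^-1%g @^-1` A0)).
Proof.
move=> [root [root0 rootS rootV]] sA0.
have [act1 actM _] := actP.
have [B [B0 UB]] := interaction_bounded compactS U_continuous.
have e16 : 0 < 16^-1 :> R by rewrite invr_gt0.
have [n0 n0P] := rootV _ (interaction_modulus compactS U_continuous actP e16).
apply/ler_addgt0Pr => e e0.
pose M : R := (2 ^ n0)%:R.
(* With energy eta (2 N)^2, boundary mass eta and N = M K, the loss in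
   [kernel_convexity] is exactly C eta. *)
pose C := 4 + 2 * B + 72 * B * M ^+ 2.
have C0 : 0 < C by rewrite /C !ltr_wpDr// !mulr_ge0// sqr_ge0.
pose eta := Num.min 1 (e / 2) / C.
have eta0 : 0 < eta by rewrite divr_gt0// lt_min ltr01 divr_gt0.
have [L [Nmin profile]] := integer_profile J_sum X_walk X_recurrent (L0 : seq Z2) eta0.
have [W [LW L0W bd]] := small_boundary J_sum L L0 eta0.
pose K := (2 ^ Nmin)%N; pose N := (2 ^ (n0 + Nmin))%N.
have K0 : (0 < K)%N by rewrite expn_gt0.
have N0 : (0 < N)%N by rewrite expn_gt0.
have NE : N%:R = M * K%:R :> R by rewrite /N expnD natrM.
have NminN : (Nmin <= 2 * N)%N.
  apply: leq_trans (ltnW (ltn_expl Nmin (isT : (1 < 2)%N))) _.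
  by rewrite -/K /N expnD mulnA leq_pmull// muln_gt0 expn_gt0.
have [t [tN tL0 tL tD]] := profile _ NminN.
pose h := root (n0 + Nmin)%N.
pose rot k s := act (zpow h k) s.
have rot0 s : rot 0 s = s by rewrite /rot /= act1.
have rotD k l s : rot (k + l) s = rot k (rot l s) by rewrite /rot zpowD actM.
have rotC k : continuous (rot k) by exact: act_continuous.
have rot_lambda k (A : set (borel S)) : measurable A -> lambda (rot k @^-1` A) = lambda A.
  by move=> mA; exact: lambda_invariant.
have U_rot k s u : U (rot k s) (rot k u) = U s u by exact: U_invariant.
have near k s u : (`|k| < K)%N -> `|U (rot k s) u - U s u| <= 16^-1.
  by apply: (zpow_near actM act1) => i iK s' u'; have := n0P Nmin i iK; exact.
have hN : (h ^+ N)%g = g by have := root_expg rootS 0 (n0 + Nmin); rewrite add0n root0.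
have rotN : rot N%:Z = act g by apply/funext => s; rewrite /rot /= hN.
have rotNN : rot (- N%:Z) = act g^-1%g.
  apply/funext => s; rewrite -[s in LHS]act1 -(mulgV g) actM -rotN.
  by rewrite -rotD addNr rot0.
have D2 : eta * (2 * N)%:R ^+ 2 = 4 * eta * N%:R ^+ 2 by rewrite natrM exprMn; ring.
rewrite D2 in tD.
pose loss := 4 * eta * N%:R ^+ 2 / N%:R ^+ 2 + 2 * B * eta + 18 * B * (4 * eta * N%:R ^+ 2) / K%:R ^+ 2.
have lossE : loss = Num.min 1 (e / 2).
  rewrite -[RHS](divfK (lt0r_neq0 C0)) -/eta /loss /C NE.
  by field; rewrite !pnatr_eq0 -!lt0n K0 expn_gt0.
have loss1 : loss <= 1 by rewrite lossE ge_min lexx.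
have losse : loss <= e / 2 by rewrite lossE ge_min lexx orbT.
have conv := kernel_convexity J_sum compactS U_continuous rot0 rotD rotC rot_lambda U_rot B0 UB K0
  near LW L0W bd N0 tL0 tL tD loss1 sA0.
have cyl A : <<s @coord_events S [set x | x \in L0] >> A ->
    <<s @coord_events S [set x | x \in W] >> A.
  by apply: coord_events_sub => x; exact: (fsubsetP L0W).
have cylT A : <<s @coord_events S [set x | x \in L0] >> A -> measurable (A : set (config S)).
  exact: coord_events_sub.
pose A1 := config_act act g @^-1` A0; pose A2 := config_act act g^-1%g @^-1` A0.
have sA1 : <<s coord_events [set x | x \in L0] >> A1 by exact: cylinder_preimage.
have sA2 : <<s coord_events [set x | x \in L0] >> A2 by exact: cylinder_preimage.
have E1 : shifted rot A0 N%:Z = A1 by rewrite /shifted rotN.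
have E2 : shifted rot A0 (- N%:Z) = A2 by rewrite /shifted rotNN.
rewrite E1 E2 in conv.
have l0 : 0 <= 2 * (1 - loss) by rewrite mulr_ge0// subr_ge0.
have mk A : <<s coord_events [set x | x \in L0] >> A ->
    measurable_fun [set: config S] (fun eta => (gibbs_kernel J U lambda W A eta)%:E).
  by move=> /cylT mA; apply/measurable_EFinP; exact: measurable_gibbs_kernel.
have : ((2 * (1 - loss))%:E * mu A0 <= mu A1 + mu A2)%E.
  rewrite !(gibbs_mean (W := W)); try exact: cyl.
  rewrite -ge0_integralZl_EFin//; last 2 first.
  - by move=> phi _; rewrite lee_fin gibbs_kernel_ge0.
  - exact: mk.
  rewrite -ge0_integralD//; last 4 first.
  - by move=> phi _; rewrite lee_fin gibbs_kernel_ge0.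
  - exact: mk.
  - by move=> phi _; rewrite lee_fin gibbs_kernel_ge0.
  - exact: mk.
  apply: ge0_le_integral => //.
  - by move=> phi _; rewrite -EFinM lee_fin mulr_ge0// gibbs_kernel_ge0.
  - by apply: emeasurable_funM; [exact: measurable_cst|exact: mk].
  - by apply: emeasurable_funD; exact: mk.
  - by move=> phi _; rewrite -EFinM -EFinD lee_fin; exact: conv.
have mufin A : <<s coord_events [set x | x \in L0] >> A -> mu A = (fine (mu A))%:E.
  by move=> /cylT mA; rewrite fineK// fin_num_measure.
have mu01 : 0 <= fine (mu A0) <= 1.
  rewrite fine_ge0//= -lee_fin -mufin//; apply: probability_le1; exact: cylT.
rewrite (mufin _ sA0) (mufin _ sA1) (mufin _ sA2) -EFinM -EFinD lee_fin -/A1 -/A2.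
case/andP: mu01 => m0 m1 le.
have : loss * fine (mu A0) <= e / 2.
  by apply: le_trans losse; rewrite ler_piMr//; move: lossE => ->; rewrite le_min ler01 divr_ge0// ltW.
nra.
Qed.

End GibbsInvariance.

(** * Invariance of the Gibbs state *)

Section GeneratedInvariance.
Variables (R : realType) (G : preTopologicalGroupType) (S : ptopologicalType).
Variable act : G -> S -> S.
Hypothesis actP : continuous_action act.
Variable mu : probability (config S) R.

Lemma cylinders_setI_closed :
  setI_closed [set A | exists L0 : {fset Z2}, <<s @coord_events S [set x | x \in L0] >> A].
Proof.
move=> A A' [L0 sA] [L0' sA']; exists (L0 `|` L0')%fset.
pose T := g_sigma_algebraType (@coord_events S [set x | x \in (L0 `|` L0')%fset]).
apply: (@measurableI _ T).
- by apply: coord_events_sub sA => x /= xL; rewrite inE xL.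
- by apply: coord_events_sub sA' => x /= xL; rewrite inE xL orbT.
Qed.

Lemma measurable_cylinders : @measurable _ (config S) =
  <<s [set A | exists L0 : {fset Z2}, <<s @coord_events S [set x | x \in L0] >> A] >>.
Proof.
apply/seteqP; split.
  apply: sub_sigma_algebra2 => A [x _ [C mC <-]]; exists [fset x]%fset.
  by apply: sub_sigma_algebra; exists x; [rewrite /= inE|exists C].
apply: smallest_sub; first exact: smallest_sigma_algebra.
by move=> A [L0]; exact: coord_events_sub.
Qed.

(** Events depending on finitely many spins are stable under intersection and
    generate the sigma-algebra. *)
Lemma invariant_from_cylinders g :
  (forall (L0 : {fset Z2}) A0, <<s coord_events [set x | x \in L0] >> A0 ->
    mu (config_act act g @^-1` A0) = mu A0) ->
  forall A : set (config S), measurable A -> mu (config_act act g @^-1` A) = mu A.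
Proof.
move=> cyl A mA.
have mpre (B : set (config S)) : measurable B -> measurable (config_act act g @^-1` B : set (config S)).
  by move=> mB; have := measurable_config_act actP g measurableT mB; rewrite setTI.
move: A mA; rewrite measurable_cylinders.
pose inv := [set A : set (config S) | mu (config_act act g @^-1` A) = mu A].
refine (@dynkin_induction _ (config S) _ inv measurable_cylinders
  cylinders_setI_closed _ _ _ _); rewrite /inv /=.
- by rewrite preimage_setT.
- by move=> B [L0]; exact: cyl.
- move=> B mB BE; have := probability_setC mu (mpre _ mB).
  by rewrite preimage_setC => ->; rewrite BE probability_setC.
- move=> F mF tF FE; rewrite preimage_bigcup !measure_bigcup//; last first.
  - move=> i j _ _ [phi [Fi Fj]]; apply: (tF i j) => //; exists (config_act act g phi); split.
    - exact: Fi.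
    - exact: Fj.
  - by move=> n _; exact: mpre.
  by apply: eq_eseriesr => n _; exact: FE.
Qed.

End GeneratedInvariance.

Section DyadicInvariance.
Variables (R : realType) (G : preTopologicalGroupType) (S : ptopologicalType).
Variables (J : Z2 -> R) (U : S -> S -> R) (act : G -> S -> S).
Variable lambda : {finite_measure set (borel S) -> \bar R}.
Hypothesis J_sum :
  (\esum_(x in [set z : Z2 | z != 0%R]) `|J x|%:E = 1)%E.
Hypothesis compactS : compact [set: S].
Hypothesis U_continuous : continuous (fun p : S * S => U p.1 p.2).
Hypothesis actP : continuous_action act.
Hypothesis U_invariant : forall g s t, U (act g s) (act g t) = U s t.
Hypothesis lambda_invariant : invariant_measure act lambda.
Variable mu : probability (config S) R.
Hypothesis mu_gibbs : gibbs_state J U lambda mu.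
Variables (d : measure_display) (Omega : measurableType d) (P : probability Omega R).
Variable X : nat -> Omega -> Z2.
Hypothesis X_walk : random_walk J P X.
Hypothesis X_recurrent : recurrent P X.

Lemma config_actM g h : config_act act (g * h)%g = config_act act g \o config_act act h.
Proof. by have [_ actM _] := actP; apply/funext => phi; apply/funext => x; rewrite /config_act /= actM. Qed.

Lemma config_act1 : config_act act 1%g = id.
Proof. by have [act1 _ _] := actP; apply/funext => phi; apply/funext => x; rewrite /config_act act1. Qed.

(** Apply [cylinder_convexity] to all the events g^k A0 and conclude by
    [bounded_convex_int]. *)
Lemma cylinder_invariance g (L0 : {fset Z2}) (A0 : set (Z2 -> S)) :
  dyadic_roots g -> <<s coord_events [set x | x \in L0] >> A0 ->
  mu (config_act act g @^-1` A0) = mu A0.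
Proof.
move=> gP sA0.
pose Ak k := config_act act (zpow g k) @^-1` A0.
have sAk k : <<s coord_events [set x | x \in L0] >> (Ak k) by exact: cylinder_preimage.
have mAk k : measurable (Ak k : set (config S)) by exact: coord_events_sub (sAk k).
have muE k : mu (Ak k) = (fine (mu (Ak k)))%:E by rewrite fineK// fin_num_measure.
have A0E : Ak 0 = A0 by rewrite /Ak /= config_act1.
have A1E : Ak 1 = config_act act g @^-1` A0 by rewrite /Ak /= expg1.
rewrite -A1E -[in RHS]A0E muE [RHS]muE; congr (_%:E).
apply: (bounded_convex_int (a := fun k => fine (mu (Ak k)))) => k.
  by rewrite fine_ge0//= -lee_fin -muE probability_le1.
have := cylinder_convexity J_sum compactS U_continuous actP U_invariant
  lambda_invariant mu_gibbs X_walk X_recurrent gP (sAk k).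
suff shift h l : (zpow g k * h)%g = zpow g l -> config_act act h @^-1` Ak k = Ak l.
  rewrite (shift g (k + 1)) ?(shift g^-1%g (k - 1))//.
    by rewrite zpowD -[zpow g (- 1)]/(g^-1 ^+ 1)%g expg1.
  by rewrite zpowD /= expg1.
by move=> hl; rewrite /Ak -hl config_actM comp_preimage.
Qed.

End DyadicInvariance.

Theorem theorem2 (R : realType)
  (G : preTopologicalGroupType) (lieG : lie_group R G)
  (compactG : compact [set: G]) (connectedG : connected [set: G])
  (S : ptopologicalType) (compactS : compact [set: S])
  (act : G -> S -> S) (actP : continuous_action act)
  (J : int * int -> R)
  (J_sum : (\esum_(x in [set z : int * int | z != 0%R]) `|J x|%:E = 1)%E)
  (d : measure_display) (Omega : measurableType d) (P : probability Omega R)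
  (X : nat -> Omega -> int * int)
  (X_walk : random_walk J P X) (X_recurrent : recurrent P X)
  (U : S -> S -> R)
  (U_continuous : continuous (fun p : S * S => U p.1 p.2))
  (U_invariant : forall g s t, U (act g s) (act g t) = U s t)
  (lambda : {finite_measure set (borel S) -> \bar R})
  (lambda_invariant : invariant_measure act lambda)
  (mu : probability (config S) R) (mu_gibbs : gibbs_state J U lambda mu) :
  invariant_state act mu.
Proof.
pose H : set G := [set g | forall A : set (config S), measurable A ->
  mu (config_act act g @^-1` A) = mu A].
have mact g (A : set (config S)) : measurable A ->
    measurable (config_act act g @^-1` A : set (config S)).
  by move=> mA; have := measurable_config_act actP g measurableT mA; rewrite setTI.
apply: (@dyadic_roots_generate R G H lieG connectedG).
- move=> g gP A mA; apply: (invariant_from_cylinders actP) mA => L0 A0 sA0.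
  exact: (cylinder_invariance J_sum compactS U_continuous actP U_invariant
    lambda_invariant mu_gibbs X_walk X_recurrent gP sA0).
- by move=> A mA; rewrite (config_act1 actP).
- move=> g h Hg Hh A mA.
  by rewrite (config_actM actP) comp_preimage Hh ?Hg//; exact: mact.
- move=> g Hg A mA; rewrite -(Hg _ (mact g^-1%g _ mA)) -comp_preimage.
  by rewrite -(config_actM actP) mulVg (config_act1 actP).
Qed.
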